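(* Assume the standing setting below, and let $\psi$ be a positive function, defined for all sufficiently large $q$, which is nonincreasing, bounded, and slowly varying (for each $K>0$, $\psi(Kq)\asymp\psi(q)$ with constants depending on $K$). (i) If $\sum_{q}\frac{\log(q)\,\psi(q)^\delta}{q}<\infty$, then $\mu$-almost every $x\in J$ is badly symbolically approximable with respect to $\psi$. (ii) If $\psi(q)<1$ for all sufficiently large $q$ and $\sum_{q}\frac{\log(q)\,\psi(q)^\delta}{q\,|\log\psi(q)|}=\infty$ (sum over sufficiently large $q$), then $\mu$-almost every $x\in J$ is symbolically well approximable with respect to $\psi$. In particular, for every $\varepsilon>0$, case (i) applies to $\psi(q)=(\log q)^{-(2/\delta+\varepsilon)}$, and case (ii) applies to $\psi(q)=(\log q)^{-2/\delta}$.
   Context: Standing setting: $(u_a)_{a\in E}$ is a rational IFS on $\mathbb{R}$, $u_a(x)=\frac{p_a}{q_a}x+\frac{r_a}{q_a}$ with $p_a\in\{\pm1\}$, $r_a\in\mathbb{Z}$, $q_a\in\mathbb{N}$, $q_a\ge2$, $\#E\ge2$, satisfying the strong separation condition (a closed interval $I$ with the $u_a(I)$ pairwise disjoint subsets of $I$); $\pi(\omega)=\lim_n u_{\omega_1}\circ\cdots\circ u_{\omega_n}(0)$ is the coding map, $J$ the limit set, $\delta$ its Hausdorff dimension, $\mu=\mathcal{H}^\delta|_J/\mathcal{H}^\delta(J)$. Every rational in $J$ has a unique, eventually periodic coding $\omega$. Intrinsic denominator: with $n\ge0$ minimal such that $(\omega_i)_{i>n}$ is periodic and $m\ge1$ its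 minimal period, $q_{\mathrm{int}}:=\big(\prod_{i=1}^n q_{\omega_i}\big)\big(\prod_{i=1}^m q_{\omega_{n+i}}-\prod_{i=1}^m p_{\omega_{n+i}}\big)$. A point $x\in J$ is badly symbolically approximable w.r.t. $\psi$ if there is $\varepsilon>0$ with $|x-p/q|\ge\varepsilon\psi(q_{\mathrm{int}})/q_{\mathrm{int}}$ for all $p/q\in\mathbb{Q}\cap J$; otherwise it is symbolically well approximable w.r.t. $\psi$. *)

(* Defs.v *)
From Stdlib Require Import Reals ZArith Lra Lia.
Open Scope R_scope.

(* The alphabet E is {0,...,N-1}; the map u_a(x) = (p_a x + r_a)/q_a. *)
Record IFS := mkIFS {
  ifsN : nat;
  ifsp : nat -> Z;
  ifsr : nat -> Z;
  ifsq : nat -> nat }.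

Definition u (F : IFS) (a : nat) (x : R) : R :=
  (IZR (ifsp F a) * x + IZR (ifsr F a)) / INR (ifsq F a).

Definition in_I (lo hi x : R) : Prop := lo <= x <= hi.

Definition rational_IFS (F : IFS) : Prop :=
  (2 <= ifsN F)%nat /\
  (forall a, (a < ifsN F)%nat -> ifsp F a = 1%Z \/ ifsp F a = (-1)%Z) /\
  (forall a, (a < ifsN F)%nat -> (2 <= ifsq F a)%nat) /\
  (exists lo hi, lo <= hi /\
     (forall a x, (a < ifsN F)%nat -> in_I lo hi x -> in_I lo hi (u F a x)) /\
     (forall a b x y, (a < ifsN F)%nat -> (b < ifsN F)%nat -> a <> b ->
        in_I lo hi x -> in_I lo hi y -> u F a x <> u F b y)).

(* A word w : nat -> nat is 0-indexed: w 0 is omega_1 of the paper. *)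
Definition valid_word (F : IFS) (w : nat -> nat) : Prop :=
  forall i, (w i < ifsN F)%nat.

Fixpoint comp (F : IFS) (w : nat -> nat) (n : nat) (x : R) : R :=
  match n with
  | O => x
  | S k => comp F w k (u F (w k) x)
  end.

Definition coding (F : IFS) (w : nat -> nat) (x : R) : Prop :=
  Un_cv (fun n => comp F w n 0) x.

Definition limit_set (F : IFS) (x : R) : Prop :=
  exists w, valid_word F w /\ coding F w x.

(* d^s, with the convention 0^s = 0 (diameter of the empty set / points). *)
Definition rpow (d s : R) : R :=
  if Req_EM_T d 0 then 0 else Rpower d s.

(* H^s(A) = 0: for every eta > 0 the eta-approximate s-dimensional
   Hausdorff outer measure H^s_eta(A) vanishes, i.e. for every eps > 0
   there is a countable cover (U i) of A by sets of diameter <= d i <= eta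
   with sum_i (d i)^s <= eps. *)
Definition H_null (s : R) (A : R -> Prop) : Prop :=
  forall eta eps, 0 < eta -> 0 < eps ->
    exists (U : nat -> R -> Prop) (d : nat -> R),
      (forall x, A x -> exists i, U i x) /\
      (forall i, 0 <= d i <= eta /\
         (forall x y, U i x -> U i y -> Rabs (x - y) <= d i)) /\
      (forall n, sum_f_R0 (fun i => rpow (d i) s) n <= eps).

Definition is_glb (S : R -> Prop) (m : R) : Prop :=
  (forall s, S s -> m <= s) /\ (forall b, (forall s, S s -> b <= s) -> b <= m).

Definition hausdorff_dim (A : R -> Prop) (delta : R) : Prop :=
  is_glb (fun s => 0 <= s /\ H_null s A) delta.

(* mu-almost every x in J satisfies P, where mu = H^delta|_J / H^delta(J):
   the set of points of J failing P is H^delta-null. *)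
Definition mu_ae (F : IFS) (delta : R) (P : R -> Prop) : Prop :=
  H_null delta (fun x => limit_set F x /\ ~ P x).

Fixpoint prodZ (f : nat -> Z) (n : nat) : Z :=
  match n with
  | O => 1%Z
  | S k => (prodZ f k * f k)%Z
  end.

(* the tail (w_i)_{i > n} (paper indexing) is periodic with period m *)
Definition periodic_from (w : nat -> nat) (n m : nat) : Prop :=
  forall i, (n <= i)%nat -> w (i + m)%nat = w i.

Definition min_pre_period (w : nat -> nat) (n m : nat) : Prop :=
  (1 <= m)%nat /\ periodic_from w n m /\
  (forall n' m', (1 <= m')%nat -> periodic_from w n' m' -> (n <= n')%nat) /\
  (forall m', (1 <= m')%nat -> periodic_from w n m' -> (m <= m')%nat).

Definition q_int (F : IFS) (w : nat -> nat) (n m : nat) : Z :=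
  (prodZ (fun i => Z.of_nat (ifsq F (w i))) n *
   (prodZ (fun i => Z.of_nat (ifsq F (w (n + i)%nat))) m
    - prodZ (fun i => ifsp F (w (n + i)%nat)) m))%Z.

Definition is_rational (y : R) : Prop :=
  exists a b : Z, b <> 0%Z /\ y = IZR a / IZR b.

Definition badly_symb_approx (F : IFS) (psi : R -> R) (x : R) : Prop :=
  exists eps, 0 < eps /\
    forall y w n m,
      is_rational y -> limit_set F y ->
      valid_word F w -> coding F w y -> min_pre_period w n m ->
      Rabs (x - y) >= eps * psi (IZR (q_int F w n m)) / IZR (q_int F w n m).

Definition symb_well_approx (F : IFS) (psi : R -> R) (x : R) : Prop :=
  ~ badly_symb_approx F psi x.

Definition admissible (psi : R -> R) (q0 : R) : Prop :=
  (forall q, q0 <= q -> 0 < psi q) /\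
  (forall x y, q0 <= x -> x <= y -> psi y <= psi x) /\
  (exists M, forall q, q0 <= q -> psi q <= M) /\
  (forall K, 0 < K -> exists c C Q, 0 < c /\ 0 < C /\
     forall q, Q <= q -> c * psi q <= psi (K * q) /\ psi (K * q) <= C * psi q).

Definition series_converges (a : nat -> R) : Prop :=
  exists (Q : nat) (l : R), infinite_sum (fun n => a (n + Q)%nat) l.

Definition term1 (delta : R) (psi : R -> R) (k : nat) : R :=
  ln (INR k) * Rpower (psi (INR k)) delta / INR k.

Definition term2 (delta : R) (psi : R -> R) (k : nat) : R :=
  ln (INR k) * Rpower (psi (INR k)) delta / (INR k * Rabs (ln (psi (INR k)))).

Definition psi_log (t : R) (q : R) : R := Rpower (ln q) (- t).

(* Main.v *)
(** By Moran's equation [sum_a q_a^(-delta) = 1] the weights [q_a^(-delta)] define a Bernoulli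
    measure on words, and a null set for it is [H^delta]-null on the limit set.  A rational
    with preperiod [n] and period [m] has an intrinsic denominator comparable to the product
    of the first [n + m] denominators of its coding, so both parts reduce to weighted counts
    of finite words.

    Convergence: a word of length [k] is the beginning of [k] rationals, one for each
    [n < k = n + m], so the balls of radius [psi(q)/q] have total [delta]-mass at most a
    constant times [sum_k k psi(2^k)^delta], which is the hypothesis condensed.

    Divergence: if a block of letters read at position [n] reappears at position [n + m],
    then the point is close to the rational with preperiod [n] and period [m].  In stage
    [j] one reads about [2^j] letters and then about [2^j / |log psi|] disjoint blocks, each
    cut as soon as its denominator exceeds [t ~ 1/psi], and counts the occurrences of
    these blocks among the letters read first.  Conditionally on those letters the blocks
    are independent, and a single word overlaps itself only with geometrically decaying
    probability, so the second moment method gives a hit with probability at least a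
    constant times [m / (m + 1)], where [m = 4^j psi^delta / |log psi|].  Stages use disjoint
    letters, hence are independent, and the sum of the [m] diverges. *)
From Stdlib Require Import Reals ZArith Lra Lia List Cantor FinFun.
From Stdlib Require Import ChoiceFacts ClassicalEpsilon FunctionalExtensionality.
From Coquelicot Require Import Rcomplements.
Require Import Defs.
Import ListNotations.
Open Scope R_scope.

(** * Finite sums *)

Definition sum_list {A : Type} (f : A -> R) (l : list A) : R :=
  fold_right (fun a s => f a + s) 0 l.

Notation "\sum_ ( a <- l ) F" := (sum_list (fun a => F) l)
  (at level 41, a name, l at level 50, F at level 41).
Notation "\sum_ ( i < n ) F" := (sum_list (fun i => F) (seq 0 n))
  (at level 41, i name, n at level 50, F at level 41).

Lemma sum_list_app {A : Type} (f : A -> R) l l' :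
  \sum_(a <- l ++ l') f a = \sum_(a <- l) f a + \sum_(a <- l') f a.
Proof. induction l as [|a l IH]; simpl; [ring|rewrite IH; ring]. Qed.

Lemma sum_list_ext {A : Type} (f g : A -> R) l :
  (forall a, In a l -> f a = g a) -> \sum_(a <- l) f a = \sum_(a <- l) g a.
Proof.
  induction l as [|a l IH]; simpl; intros Hfg; [reflexivity|].
  rewrite Hfg, IH; auto.
Qed.

Lemma sum_list_le {A : Type} (f g : A -> R) l :
  (forall a, In a l -> f a <= g a) -> \sum_(a <- l) f a <= \sum_(a <- l) g a.
Proof.
  induction l as [|a l IH]; simpl; intros Hfg; [lra|].
  apply Rplus_le_compat; auto.
Qed.

Lemma sum_list_const {A : Type} (l : list A) c : \sum_(a <- l) c = INR (length l) * c.
Proof.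
  induction l as [|a l IH]; [simpl; ring|].
  change (c + \sum_(a <- l) c = INR (S (length l)) * c). rewrite IH, S_INR. ring.
Qed.

Lemma sum_list_nonneg {A : Type} (f : A -> R) l :
  (forall a, In a l -> 0 <= f a) -> 0 <= \sum_(a <- l) f a.
Proof.
  intros Hf. apply Rle_trans with (\sum_(a <- l) 0).
  - rewrite sum_list_const. lra.
  - now apply sum_list_le.
Qed.

Lemma sum_list_eq_0 {A : Type} (f : A -> R) l :
  (forall a, In a l -> f a = 0) -> \sum_(a <- l) f a = 0.
Proof. intros Hf. rewrite (sum_list_ext _ (fun _ => 0)), sum_list_const; [ring|exact Hf]. Qed.

Lemma sum_list_neq_0 {A : Type} (f : A -> R) l :
  \sum_(a <- l) f a <> 0 -> exists a, In a l /\ f a <> 0.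
Proof.
  intros Hsum. apply NNPP. intros Hno. apply Hsum, sum_list_eq_0. intros a Ha.
  apply NNPP. intros Hfa. apply Hno. now exists a.
Qed.

Lemma sum_list_plus {A : Type} (f g : A -> R) l :
  \sum_(a <- l) (f a + g a) = \sum_(a <- l) f a + \sum_(a <- l) g a.
Proof. induction l as [|a l IH]; simpl; [ring|rewrite IH; ring]. Qed.

Lemma sum_list_scal {A : Type} (f : A -> R) c l : \sum_(a <- l) c * f a = c * (\sum_(a <- l) f a).
Proof. induction l as [|a l IH]; simpl; [ring|rewrite IH; ring]. Qed.

Lemma sum_list_swap {A B : Type} (f : A -> B -> R) l l' :
  \sum_(a <- l) (\sum_(b <- l') f a b) = \sum_(b <- l') (\sum_(a <- l) f a b).
Proof.
  induction l as [|a l IH]; simpl.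
  - symmetry. now apply sum_list_eq_0.
  - now rewrite IH, <- sum_list_plus.
Qed.

Lemma sum_list_map {A B : Type} (f : B -> R) (h : A -> B) l :
  \sum_(b <- map h l) f b = \sum_(a <- l) f (h a).
Proof. induction l as [|a l IH]; simpl; [reflexivity|now rewrite IH]. Qed.

Lemma sum_list_flat_map {A B : Type} (f : B -> R) (h : A -> list B) l :
  \sum_(b <- flat_map h l) f b = \sum_(a <- l) (\sum_(b <- h a) f b).
Proof.
  induction l as [|a l IH]; simpl; [reflexivity|].
  now rewrite sum_list_app, IH.
Qed.

Lemma sum_list_incl {A : Type} (f : A -> R) l l' : (forall a, 0 <= f a) -> NoDup l -> incl l l' ->
  \sum_(a <- l) f a <= \sum_(a <- l') f a.
Proof.
  intros Hf Hl. revert l'. induction Hl as [|a l Ha Hl IH]; intros l' Hincl.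
  - now apply sum_list_nonneg.
  - destruct (in_split a l') as [l1 [l2 ->]]; [apply Hincl; now left|].
    assert (Hrest : \sum_(a <- l) f a <= \sum_(a <- l1 ++ l2) f a).
    { apply IH. intros b Hb. specialize (Hincl b (or_intror Hb)).
      rewrite in_app_iff in *. destruct Hincl as [|[<-|]]; auto. contradiction. }
    rewrite sum_list_app in *. simpl. lra.
Qed.

Section SumLt.

Implicit Types (f g : nat -> R) (n m : nat).

Lemma sum_lt_S f n : \sum_(i < S n) f i = \sum_(i < n) f i + f n.
Proof. rewrite seq_S, sum_list_app. simpl. ring. Qed.

Lemma sum_lt_S_l f n : \sum_(i < S n) f i = f 0%nat + \sum_(i < n) f (S i).
Proof. simpl. now rewrite <- seq_shift, sum_list_map. Qed.

Lemma sum_lt_add f n m : \sum_(i < n + m) f i = \sum_(i < n) f i + \sum_(i < m) f (n + i)%nat.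
Proof.
  induction m as [|m IH]; [rewrite Nat.add_0_r; simpl; ring|].
  rewrite Nat.add_succ_r, !sum_lt_S, IH. ring.
Qed.

Lemma sum_lt_ext f g n :
  (forall i, (i < n)%nat -> f i = g i) -> \sum_(i < n) f i = \sum_(i < n) g i.
Proof. intros Hfg. apply sum_list_ext. intros i Hi. apply in_seq in Hi. apply Hfg. lia. Qed.

Lemma sum_lt_le f g n :
  (forall i, (i < n)%nat -> f i <= g i) -> \sum_(i < n) f i <= \sum_(i < n) g i.
Proof. intros Hfg. apply sum_list_le. intros i Hi. apply in_seq in Hi. apply Hfg. lia. Qed.

Lemma sum_lt_lt f g n : (0 < n)%nat ->
  (forall i, (i < n)%nat -> f i < g i) -> \sum_(i < n) f i < \sum_(i < n) g i.
Proof.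
  intros Hn Hfg. destruct n as [|n]; [lia|]. rewrite !sum_lt_S.
  apply Rplus_le_lt_compat; [apply sum_lt_le; intros; left|]; apply Hfg; lia.
Qed.

Lemma sum_lt_const n c : \sum_(i < n) c = INR n * c.
Proof. now rewrite sum_list_const, length_seq. Qed.

Lemma sum_lt_mono f n m : (forall i, 0 <= f i) -> (n <= m)%nat ->
  \sum_(i < n) f i <= \sum_(i < m) f i.
Proof.
  intros Hf Hnm. replace m with (n + (m - n))%nat by lia. rewrite sum_lt_add.
  assert (0 <= \sum_(i < m - n) f (n + i)%nat) by now apply sum_list_nonneg.
  lra.
Qed.

Lemma sums_common_length (f : nat -> nat -> R) c N : (forall a i, 0 <= f a i) ->
  (forall a, (a < N)%nat -> exists n, c < \sum_(i < n) f a i) ->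
  exists n, forall a, (a < N)%nat -> c < \sum_(i < n) f a i.
Proof.
  intros Hf. induction N as [|N IH]; intros Hc; [exists 0%nat; lia|].
  destruct IH as [n1 Hn1]; [intros; apply Hc; lia|].
  destruct (Hc N) as [n2 Hn2]; [lia|]. exists (max n1 n2). intros a Ha.
  assert (Hmono : forall n, (n <= max n1 n2)%nat ->
    \sum_(i < n) f a i <= \sum_(i < max n1 n2) f a i) by (intros; now apply sum_lt_mono).
  destruct (Nat.eq_dec a N) as [->|Hne].
  - eapply Rlt_le_trans; [apply Hn2|apply Hmono; lia].
  - eapply Rlt_le_trans; [apply (Hn1 a); lia|apply Hmono; lia].
Qed.

Lemma sum_lt_eqb f n b :
  \sum_(a < n) (if Nat.eqb a b then f a else 0) = if Nat.ltb b n then f b else 0.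
Proof.
  induction n as [|n IH]; [reflexivity|]. rewrite sum_lt_S, IH.
  destruct (Nat.eqb_spec n b), (Nat.ltb_spec b n), (Nat.ltb_spec b (S n));
    subst; try lia; ring.
Qed.

Lemma sum_f_R0_sum_lt f n : sum_f_R0 f n = \sum_(i < S n) f i.
Proof. induction n as [|n IH]; [simpl; ring|]. rewrite sum_lt_S, <- IH. reflexivity. Qed.

Lemma sum_lt_nth {A : Type} (f : A -> R) (d : A) l n : (forall a, 0 <= f a) -> f d = 0 ->
  \sum_(j < n) f (nth j l d) <= \sum_(a <- l) f a.
Proof.
  intros Hf Hd. revert n. induction l as [|a l IH]; intros n.
  - rewrite sum_list_eq_0; [simpl; lra|]. intros [|j] _; exact Hd.
  - destruct n as [|n]; [now apply sum_list_nonneg|].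
    rewrite sum_lt_S_l. specialize (IH n). simpl. lra.
Qed.

Lemma sum_lt_consecutive_blocks (N : nat -> nat) f n : (forall j, (N j <= N (S j))%nat) ->
  \sum_(j < n) (\sum_(i < N (S j) - N j) f (N j + i)%nat) =
  \sum_(i < N n - N 0%nat) f (N 0%nat + i)%nat.
Proof.
  intros HN.
  assert (HN0 : forall j, (N 0%nat <= N j)%nat)
    by (induction j as [|j IH]; [lia|specialize (HN j); lia]).
  induction n as [|n IH]; [now rewrite Nat.sub_diag|].
  specialize (HN n). specialize (HN0 n). rewrite sum_lt_S, IH.
  replace (N (S n) - N 0%nat)%nat with ((N n - N 0%nat) + (N (S n) - N n))%nat by lia.
  rewrite sum_lt_add. f_equal. apply sum_lt_ext. intros i _. f_equal. lia.
Qed.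

Lemma sum_lt_telescope f n : \sum_(i < n) (f (S i) - f i) = f n - f 0%nat.
Proof. induction n as [|n IH]; [simpl; ring|]. rewrite sum_lt_S, IH. ring. Qed.

Lemma sum_lt_geometric x n : (1 - x) * (\sum_(i < n) x ^ i) = 1 - x ^ n.
Proof.
  induction n as [|n IH]; [simpl; ring|].
  rewrite sum_lt_S, Rmult_plus_distr_l, IH. simpl. ring.
Qed.

Lemma sum_lt_geometric_le x n : 0 <= x < 1 -> \sum_(i < n) x ^ i <= / (1 - x).
Proof.
  intros Hx. apply Rmult_le_reg_l with (1 - x); [lra|].
  rewrite sum_lt_geometric, Rinv_r by lra.
  assert (0 <= x ^ n) by (apply pow_le; lra). lra.
Qed.

Lemma sum_lt_rev f n : \sum_(i < n) f (n - i)%nat = \sum_(i < n) f (S i).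
Proof.
  induction n as [|n IH]; [reflexivity|].
  rewrite sum_lt_S_l, (sum_lt_S (fun i => f (S i))), <- IH.
  rewrite (sum_lt_ext _ (fun i => f (n - i)%nat)) by reflexivity. simpl. ring.
Qed.

Lemma sum_lt_pow_dist_le x n i : 0 <= x < 1 -> (i <= n)%nat ->
  \sum_(j < n) x ^ ((i - j) + (j - i)) <= 2 / (1 - x).
Proof.
  intros Hx Hi. replace n with (i + (n - i))%nat by lia. rewrite sum_lt_add.
  rewrite (sum_lt_ext (fun j => x ^ (i - j + (j - i))) (fun j => x ^ (i - j)))
    by (intros; f_equal; lia).
  rewrite (sum_lt_ext (fun j => x ^ (i - (i + j) + (i + j - i))) (fun j => x ^ j))
    by (intros; f_equal; lia).
  rewrite (sum_lt_rev (fun j => x ^ j)). simpl. rewrite sum_list_scal.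
  pose proof (sum_lt_geometric_le x i Hx). pose proof (sum_lt_geometric_le x (n - i) Hx).
  assert (0 <= \sum_(j < i) x ^ j) by (apply sum_list_nonneg; intros; apply pow_le; lra).
  unfold Rdiv. nra.
Qed.

Lemma sum_lt_half_pow_S_le c n : 0 <= c -> \sum_(i < n) c * (/ 2) ^ S i <= c.
Proof.
  intros Hc. rewrite (sum_lt_ext _ (fun i => c / 2 * (/ 2) ^ i)).
  - rewrite sum_list_scal. pose proof (sum_lt_geometric_le (/ 2) n ltac:(lra)).
    replace c with (c / 2 * / (1 - / 2)) at 2 by field.
    apply Rmult_le_compat_l; lra.
  - intros i _. simpl. field.
Qed.

Lemma sum_cantor_le (f : nat * nat -> R) c :
  (forall x, 0 <= f x) -> (forall n m, \sum_(k < n) (\sum_(j < m) f (k, j)) <= c) ->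
  forall n, \sum_(i < n) f (Cantor.of_nat i) <= c.
Proof.
  intros Hf Hc n. rewrite <- (sum_list_map f Cantor.of_nat).
  apply Rle_trans with (\sum_(x <- list_prod (seq 0 n) (seq 0 n)) f x).
  - apply sum_list_incl; [exact Hf| |].
    + apply Injective_map_NoDup; [|apply seq_NoDup].
      intros x y Hxy. rewrite <- (Cantor.cancel_to_of x), <- (Cantor.cancel_to_of y).
      now rewrite Hxy.
    + intros [k j] Hkj. apply in_map_iff in Hkj. destruct Hkj as [i [Hi Hin]].
      apply in_seq in Hin. pose proof (Cantor.to_nat_non_decreasing k j) as Hle.
      rewrite <- Hi, Cantor.cancel_to_of in Hle. apply in_prod; apply in_seq; lia.
  - rewrite list_prod_as_flat_map, sum_list_flat_map.
    erewrite sum_list_ext; [apply (Hc n n)|]. intros k _. apply sum_list_map.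
Qed.

End SumLt.

Fixpoint prod_lt (n : nat) (f : nat -> R) : R :=
  match n with O => 1 | S k => prod_lt k f * f k end.

Lemma prod_lt_ext n f g : (forall i, (i < n)%nat -> f i = g i) -> prod_lt n f = prod_lt n g.
Proof.
  induction n as [|n IH]; intros Hfg; simpl; [reflexivity|].
  rewrite IH, Hfg; [reflexivity|lia|]. intros i Hi. apply Hfg. lia.
Qed.

Lemma prod_lt_1 n f : (forall i, (i < n)%nat -> f i = 1) -> prod_lt n f = 1.
Proof.
  intros Hf. rewrite (prod_lt_ext n f (fun _ => 1) Hf).
  induction n as [|n IH]; simpl; [reflexivity|]. rewrite IH; [ring|auto].
Qed.

Lemma prod_lt_nonneg n f : (forall i, 0 <= f i) -> 0 <= prod_lt n f.
Proof. intros Hf. induction n as [|n IH]; simpl; [lra|]. now apply Rmult_le_pos. Qed.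

Lemma prod_lt_le_exp n f p : (forall i, 0 <= f i <= 1 - p i) ->
  prod_lt n f <= exp (- \sum_(i < n) p i).
Proof.
  intros Hf. induction n as [|n IH]; [simpl; rewrite Ropp_0, exp_0; lra|].
  rewrite sum_lt_S, Ropp_plus_distr, exp_plus. pose proof (exp_ineq1_le (- p n)).
  apply Rmult_le_compat; [apply prod_lt_nonneg; apply Hf|apply Hf|exact IH|].
  specialize (Hf n). lra.
Qed.

(** * Divergent series of nonnegative terms *)

Definition diverges (f : nat -> R) : Prop := forall M, exists n, M <= \sum_(i < n) f i.

Lemma diverges_add (f : nat -> R) J : (forall i, 0 <= f i) ->
  diverges f -> diverges (fun i => f (J + i)%nat).
Proof.
  intros Hf Hdiv M. destruct (Hdiv (\sum_(i < J) f i + M)) as [n Hn]. exists n.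
  pose proof (sum_lt_mono f n (J + n) Hf ltac:(lia)) as Hle.
  rewrite sum_lt_add in Hle. lra.
Qed.

Lemma diverges_of_add (f : nat -> R) J : (forall i, 0 <= f i) ->
  diverges (fun i => f (J + i)%nat) -> diverges f.
Proof.
  intros Hf Hdiv M. destruct (Hdiv M) as [n Hn]. exists (J + n)%nat.
  rewrite sum_lt_add.
  assert (0 <= \sum_(i < J) f i) by now apply sum_list_nonneg. lra.
Qed.

Lemma diverges_le (f g h : nat -> R) C K : 0 < C ->
  (forall i, f i <= C * g i + h i) -> (forall n, \sum_(i < n) h i <= K) ->
  diverges f -> diverges g.
Proof.
  intros HC Hfg Hh Hdiv M. destruct (Hdiv (C * M + K)) as [n Hn]. exists n.
  assert (Hle : \sum_(i < n) f i <= \sum_(i < n) (C * g i + h i))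
    by (apply sum_list_le; auto).
  rewrite sum_list_plus, sum_list_scal in Hle. specialize (Hh n).
  apply Rmult_le_reg_l with C; lra.
Qed.

Lemma diverges_scal_le (f g : nat -> R) C : 0 < C ->
  (forall i, f i <= C * g i) -> diverges f -> diverges g.
Proof.
  intros HC Hfg. apply (diverges_le f g (fun _ => 0) C 0 HC).
  - intros i. specialize (Hfg i). lra.
  - intros n. rewrite sum_lt_const. lra.
Qed.

Lemma diverges_of_telescope (f L : nat -> R) :
  (forall i, L (S i) - L i <= f i) -> (forall M, exists n, M <= L n) -> diverges f.
Proof.
  intros Hf HL M. destruct (HL (M + L 0%nat)) as [n Hn]. exists n.
  apply Rle_trans with (\sum_(i < n) (L (S i) - L i)).
  - rewrite sum_lt_telescope. lra.
  - now apply sum_list_le.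
Qed.

Lemma diverges_of_frequently_ge (f : nat -> R) e : 0 < e -> (forall i, 0 <= f i) ->
  (forall n, exists i, (n <= i)%nat /\ e <= f i) -> diverges f.
Proof.
  intros He Hf Hfreq M.
  assert (Hk : forall k, exists n, INR k * e <= \sum_(i < n) f i).
  { induction k as [|k [n Hn]]; [exists 0%nat; simpl; lra|].
    destruct (Hfreq n) as [i [Hi Hei]]. exists (S i). rewrite S_INR, sum_lt_S.
    pose proof (sum_lt_mono f n i Hf Hi). lra. }
  destruct (INR_archimed e M He) as [k HkM]. destruct (Hk k) as [n Hn].
  exists n. lra.
Qed.

Lemma diverges_saturate (m : nat -> R) K : 0 < K -> (forall i, 0 <= m i) ->
  diverges m -> diverges (fun i => m i / (2 * m i + K)).
Proof.
  intros HK Hm Hdiv.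
  assert (Hx : forall i, 0 <= m i / (2 * m i + K))
    by (intros i; specialize (Hm i); apply Rdiv_le_0_compat; lra).
  destruct (classic (exists J, forall i, (J <= i)%nat -> m i <= K)) as [[J HJ]|Hlarge].
  - apply (diverges_of_add _ J Hx).
    apply (diverges_scal_le (fun i => m (J + i)%nat) _ (3 * K)); [lra| |now apply diverges_add].
    intros i. specialize (HJ (J + i)%nat ltac:(lia)). specialize (Hm (J + i)%nat).
    unfold Rdiv. rewrite <- Rmult_assoc. apply Rle_div_r; [lra|nra].
  - apply (diverges_of_frequently_ge _ (/ 3)); [lra|exact Hx|].
    intros n. apply NNPP. intros Hno. apply Hlarge. exists n. intros i Hi.
    apply Rnot_lt_le. intros Hlt. apply Hno. exists i. split; [exact Hi|].
    apply Rle_div_r; lra.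
Qed.

(** * Elementary estimates *)

Lemma exp_le x y : x <= y -> exp x <= exp y.
Proof. intros [Hxy|<-]; [left; now apply exp_increasing|right; reflexivity]. Qed.

Lemma Rpower_pos x y : 0 < Rpower x y.
Proof. apply exp_pos. Qed.

Lemma Rpower_1_l y : Rpower 1 y = 1.
Proof. unfold Rpower. now rewrite ln_1, Rmult_0_r, exp_0. Qed.

Lemma Rpower_inv_l x y : 0 < x -> Rpower (/ x) y = Rpower x (- y).
Proof. intros Hx. unfold Rpower. rewrite ln_Rinv by exact Hx. f_equal. ring. Qed.

Lemma Rle_Rpower_opp_l a b s : 0 <= s -> 0 < a <= b -> Rpower b (- s) <= Rpower a (- s).
Proof.
  intros Hs Hab. rewrite !Rpower_Ropp.
  apply Rinv_le_contravar; [apply Rpower_pos|now apply Rle_Rpower_l].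
Qed.

Lemma ln_nonneg x : 1 <= x -> 0 <= ln x.
Proof. intros Hx. rewrite <- ln_1. apply ln_le; lra. Qed.

Lemma ln_pos x : 1 < x -> 0 < ln x.
Proof. intros Hx. rewrite <- ln_1. apply ln_increasing; lra. Qed.

Lemma ln_le_sub_1 x : 0 < x -> ln x <= x - 1.
Proof. intros Hx. pose proof (exp_ineq1_le (ln x)) as He. rewrite exp_ln in He; lra. Qed.

Lemma ln_sub_le x y : 0 < x <= y -> ln y - ln x <= (y - x) / x.
Proof.
  intros Hxy. rewrite <- ln_div by lra. replace ((y - x) / x) with (y / x - 1) by (field; lra).
  apply ln_le_sub_1, Rdiv_lt_0_compat; lra.
Qed.

Lemma ln_sub_ge x y : 0 < x <= y -> (y - x) / y <= ln y - ln x.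
Proof.
  intros Hxy. pose proof (ln_le_sub_1 (x / y) ltac:(apply Rdiv_lt_0_compat; lra)) as Hle.
  rewrite ln_div in Hle by lra.
  replace ((y - x) / y) with (1 - x / y) by (field; lra). lra.
Qed.

Lemma INR_2_pow k : INR (2 ^ k) = 2 ^ k.
Proof. now rewrite pow_INR. Qed.

Lemma pow_4_eq_pow_2_sqr k : 4 ^ k = 2 ^ k * 2 ^ k.
Proof. rewrite <- Rpow_mult_distr. f_equal. Qed.

Lemma INR_lt_2_pow n : INR n < 2 ^ n.
Proof. rewrite <- INR_2_pow. apply lt_INR, Nat.pow_gt_lin_r. lia. Qed.

Lemma le_2_pow_eventually x : exists k0, forall k, (k0 <= k)%nat -> x <= 2 ^ k.
Proof.
  destruct (INR_archimed 1 x Rlt_0_1) as [k0 Hk0]. exists k0. intros k Hk.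
  apply le_INR in Hk. pose proof (INR_lt_2_pow k). lra.
Qed.

Lemma div_2_pow_lt_eventually c e : 0 < e ->
  exists n0, forall n, (n0 <= n)%nat -> c / 2 ^ n < e.
Proof.
  intros He. destruct (cv_pow_half c e He) as [n0 Hn0]. exists n0. intros n Hn.
  specialize (Hn0 n Hn). unfold Rdist in Hn0. rewrite Rminus_0_r in Hn0.
  pose proof (Rle_abs (c / 2 ^ n)). lra.
Qed.

Definition ceil_log2 (t : R) : nat := Z.to_nat (up (ln t / ln 2)).

Lemma ceil_log2_spec t : 1 <= t ->
  (1 <= ceil_log2 t)%nat /\ t <= 2 ^ ceil_log2 t /\ INR (ceil_log2 t) <= 2 * (1 + ln t).
Proof.
  intros Ht. pose proof ln_lt_2. pose proof (ln_nonneg t Ht) as Hln.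
  assert (Hlog : 0 <= ln t / ln 2) by (apply Rdiv_le_0_compat; lra).
  assert (Hlog_le : ln t / ln 2 <= 2 * ln t) by (apply Rle_div_l; nra).
  destruct (archimed (ln t / ln 2)) as [Hup1 Hup2].
  assert (Hup : (0 < up (ln t / ln 2))%Z) by (apply lt_IZR; lra).
  assert (HINR : INR (ceil_log2 t) = IZR (up (ln t / ln 2)))
    by (unfold ceil_log2; rewrite INR_IZR_INZ, Z2Nat.id by lia; reflexivity).
  split; [unfold ceil_log2; lia|split; [|lra]].
  rewrite <- Rpower_pow, HINR by lra. rewrite <- (exp_ln t) at 1 by lra.
  apply exp_le. apply Rle_div_l; lra.
Qed.

Lemma INR_div_ge_half a l : (1 <= l <= a)%nat -> INR a <= 2 * INR l * INR (a / l).
Proof.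
  intros Hla. change 2 with (INR 2). rewrite <- !mult_INR. apply le_INR.
  pose proof (Nat.div_mod_eq a l). pose proof (Nat.mod_upper_bound a l).
  assert (1 <= a / l)%nat by (apply Nat.div_le_lower_bound; lia). nia.
Qed.

Lemma exp_opp_le_cube y : 0 < y -> exp (- y) <= 27 / y ^ 3.
Proof.
  intros Hy. assert (Hcube : (y / 3) ^ 3 <= exp y).
  { replace (exp y) with (exp (y / 3) ^ 3)
      by (simpl; rewrite Rmult_1_r, <- !exp_plus; f_equal; field).
    apply pow_incr. pose proof (exp_ineq1_le (y / 3)). lra. }
  replace (27 / y ^ 3) with (/ (y / 3) ^ 3) by (field; lra).
  rewrite exp_Ropp. apply Rinv_le_contravar; [apply pow_lt; lra|exact Hcube].
Qed.

Lemma bounded_below_nat (f : nat -> nat) N : exists M, forall a, (a < N)%nat -> (f a <= M)%nat.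
Proof.
  induction N as [|N [M HM]]; [exists 0%nat; lia|].
  exists (max M (f N)). intros a Ha. destruct (Nat.eq_dec a N) as [->|Hne]; [lia|].
  specialize (HM a ltac:(lia)). lia.
Qed.

Lemma exists_least_nat (P : nat -> Prop) : (exists n, P n) ->
  exists n, P n /\ forall m, (m < n)%nat -> ~ P m.
Proof.
  intros Hex.
  destruct (dec_inh_nat_subset_has_unique_least_element P (fun n => classic (P n)) Hex)
    as [n [[Hn Hmin] _]].
  exists n. split; [exact Hn|]. intros m Hm HPm. specialize (Hmin m HPm). lia.
Qed.

Lemma uniform_on_list {A : Type} (P : A -> R -> Prop) (l : list A) :
  (forall a e e', 0 < e' <= e -> P a e -> P a e') ->
  (forall a, In a l -> exists e, 0 < e /\ P a e) ->
  exists e, 0 < e /\ forall a, In a l -> P a e.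
Proof.
  intros Hmono. induction l as [|a l IH]; intros Hl; [now exists 1; split; [lra|]|].
  destruct (Hl a) as [e1 [He1 Ha]]; [now left|].
  destruct IH as [e2 [He2 Hrest]]; [intros; apply Hl; now right|].
  pose proof (Rmin_glb_lt _ _ _ He1 He2) as Hmin.
  exists (Rmin e1 e2). split; [exact Hmin|]. intros b [<-|Hb].
  - apply (Hmono a e1); [pose proof (Rmin_l e1 e2); lra|exact Ha].
  - apply (Hmono b e2); [pose proof (Rmin_r e1 e2); lra|auto].
Qed.

Lemma Rpower_div_opp a b s : 0 < a -> 0 < b ->
  Rpower (a / b) (- s) = Rpower a (- s) * Rpower b s.
Proof.
  intros Ha Hb. unfold Rdiv.
  rewrite <- Rpower_mult_distr, Rpower_inv_l, Ropp_involutive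
    by (try apply Rinv_0_lt_compat; assumption).
  reflexivity.
Qed.

Lemma Rpower_div_Rabs_ln_le A lam p s : 1 <= A -> 0 < lam -> 0 < p -> lam <= - ln p ->
  Rpower p s / Rabs (ln p) <=
  Rpower A s * ((1 + ln A) / lam + 1) * (Rpower (A / p) (- s) / (1 + ln (A / p))).
Proof.
  intros HA Hlam Hp Hy. pose proof (ln_nonneg A HA).
  rewrite Rabs_left, ln_div, Rpower_div_opp, Rpower_Ropp by lra.
  pose proof (Rpower_pos A s). pose proof (Rpower_pos p s).
  set (y := - ln p) in *. replace (1 + (ln A - ln p)) with (1 + ln A + y) by (unfold y; ring).
  set (B := (1 + ln A) / lam). assert (HB : 1 + ln A <= B * y).
  { replace (1 + ln A) with (B * lam) by (unfold B; field; lra).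
    apply Rmult_le_compat_l; [apply Rdiv_le_0_compat; lra|exact Hy]. }
  replace (Rpower A s * (B + 1) * (/ Rpower A s * Rpower p s / (1 + ln A + y)))
    with (Rpower p s * ((B + 1) / (1 + ln A + y))) by (field; lra).
  apply Rmult_le_compat_l; [lra|]. apply Rle_div_r; [lra|].
  rewrite Rmult_comm. apply Rle_div_l; lra.
Qed.

(** * Condensation of logarithmic series *)

Lemma series_converges_tail_le (a : nat -> R) e : series_converges a -> 0 < e ->
  exists N, forall m n, (N <= m)%nat -> \sum_(i < n) a (m + i)%nat <= e.
Proof.
  intros [Q [l Hl]] He. destruct (Hl (e / 2)) as [N HN]; [lra|].
  exists (Q + S N)%nat. intros m n Hm. set (k := (m - Q - 1)%nat).
  pose proof (HN k ltac:(unfold k; lia)) as Hk.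
  pose proof (HN (k + n)%nat ltac:(unfold k; lia)) as Hkn.
  unfold Rdist in *. rewrite sum_f_R0_sum_lt in Hk, Hkn.
  change (S (k + n)) with (S k + n)%nat in Hkn. rewrite sum_lt_add in Hkn.
  apply Rabs_lt_between in Hk, Hkn.
  rewrite (sum_lt_ext _ (fun i => a (S k + i + Q)%nat)); [lra|].
  intros i _. f_equal. unfold k. lia.
Qed.

Lemma series_converges_of_bounded (a : nat -> R) Q C : (forall i, 0 <= a (Q + i)%nat) ->
  (forall n, \sum_(i < n) a (Q + i)%nat <= C) -> series_converges a.
Proof.
  intros Hpos HC. destruct (growing_cv (sum_f_R0 (fun n => a (n + Q)%nat))) as [l Hl].
  - intros n. simpl. rewrite <- (Nat.add_succ_l n Q), Nat.add_comm.
    specialize (Hpos (S n)). lra.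
  - exists C. intros x [n ->]. rewrite sum_f_R0_sum_lt.
    rewrite (sum_lt_ext _ (fun i => a (Q + i)%nat)); [apply HC|].
    intros i _. f_equal. lia.
  - exists Q, l. exact Hl.
Qed.

Lemma not_series_converges_of_diverges (a : nat -> R) Q0 :
  (forall Q, (Q0 <= Q)%nat -> diverges (fun i => a (Q + i)%nat)) -> ~ series_converges a.
Proof.
  intros Hdiv Hconv. destruct (series_converges_tail_le a 1 Hconv Rlt_0_1) as [N HN].
  destruct (Hdiv (max Q0 N) ltac:(lia) 2) as [n Hn].
  specialize (HN (max Q0 N) n ltac:(lia)). lra.
Qed.

Lemma harmonic_dyadic_le a r :
  \sum_(i < 2 ^ (a + r) - 2 ^ a) / INR (2 ^ a + i) <= INR r.
Proof.
  pose proof (sum_lt_consecutive_blocks (fun j => (2 ^ (a + j))%nat) (fun n => / INR n) r)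
    as Hblocks.
  cbv beta in Hblocks. rewrite Nat.add_0_r in Hblocks. rewrite <- Hblocks.
  - rewrite <- (Rmult_1_r (INR r)), <- sum_lt_const. apply sum_list_le. intros j _.
    replace (2 ^ (a + S j) - 2 ^ (a + j))%nat with (2 ^ (a + j))%nat
      by (rewrite Nat.add_succ_r; simpl; lia).
    set (m := (2 ^ (a + j))%nat). assert (Hm : 0 < INR m)
      by (apply lt_0_INR; pose proof (Nat.pow_nonzero 2 (a + j)); unfold m; lia).
    apply Rle_trans with (\sum_(i < m) / INR m).
    + apply sum_list_le. intros i _. apply Rinv_le_contravar; [exact Hm|]. apply le_INR. lia.
    + rewrite sum_lt_const, Rinv_r; lra.
  - intros j. apply Nat.pow_le_mono_r; lia.
Qed.

Section Condensation.

Variables (g : R -> R) (q0 : R).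

Hypothesis g_nonneg : forall q, q0 <= q -> 0 <= g q.
Hypothesis g_nonincreasing : forall x y, q0 <= x -> x <= y -> g y <= g x.

Definition log_term (k : nat) : R := ln (INR k) * g (INR k) / INR k.

Lemma log_term_nonneg k : (1 <= k)%nat -> q0 <= INR k -> 0 <= log_term k.
Proof.
  intros Hk Hq0. apply le_INR in Hk. simpl in Hk. apply Rdiv_le_0_compat; [|lra].
  apply Rmult_le_pos; [now apply ln_nonneg|now apply g_nonneg].
Qed.

Lemma log_term_dyadic_ge k i : q0 <= 2 ^ k -> (i < 2 ^ k)%nat ->
  INR k * ln 2 * g (2 ^ S k) / 2 ^ S k <= log_term (2 ^ k + i).
Proof.
  intros Hq0 Hi. unfold log_term. rewrite plus_INR, INR_2_pow.
  apply lt_INR in Hi. rewrite INR_2_pow in Hi. pose proof (pos_INR i). pose proof (pos_INR k).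
  pose proof ln_lt_2.
  assert (Hlog : INR k * ln 2 <= ln (2 ^ k + INR i)).
  { rewrite <- ln_pow by lra. apply ln_le; lra. }
  assert (HkS : 2 ^ S k = 2 * 2 ^ k) by reflexivity. rewrite HkS in *.
  pose proof (g_nonneg (2 * 2 ^ k) ltac:(lra)).
  apply Rmult_le_compat; [|left; apply Rinv_0_lt_compat; lra| |apply Rinv_le_contravar; lra].
  - apply Rmult_le_pos; nra.
  - apply Rmult_le_compat; [nra|assumption|exact Hlog|apply g_nonincreasing; lra].
Qed.

Lemma dyadic_block_ge k : (1 <= k)%nat -> q0 <= 2 ^ k ->
  INR (S (S k)) * g (2 ^ S k) <= 12 * (\sum_(i < 2 ^ k) log_term (2 ^ k + i)).
Proof.
  intros Hk Hq0. apply le_INR in Hk. simpl in Hk. pose proof ln_lt_2.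
  assert (H2k : 0 < 2 ^ k) by (apply pow_lt; lra).
  assert (HG : 0 <= g (2 ^ S k)) by (apply g_nonneg; simpl; lra).
  apply Rle_trans with (12 * (\sum_(i < 2 ^ k) INR k * ln 2 * g (2 ^ S k) / 2 ^ S k)).
  - rewrite sum_lt_const, INR_2_pow, !S_INR.
    replace (12 * (2 ^ k * (INR k * ln 2 * g (2 ^ S k) / 2 ^ S k))) with
      (6 * INR k * ln 2 * g (2 ^ S k)) by (simpl; field; lra).
    apply Rmult_le_compat_r; [exact HG|nra].
  - apply Rmult_le_compat_l; [lra|]. apply sum_lt_le. intros i Hi.
    now apply log_term_dyadic_ge.
Qed.

Lemma condensed_tail_le : series_converges log_term -> forall eps, 0 < eps ->
  exists K, q0 <= 2 ^ K /\ forall n, \sum_(j < n) INR (S (K + j)) * g (2 ^ (K + j)) <= eps.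
Proof.
  intros Hconv eps Heps.
  destruct (series_converges_tail_le _ (eps / 12) Hconv) as [N HN]; [lra|].
  destruct (le_2_pow_eventually q0) as [k Hk]. set (K := S (max N k)).
  exists (S K). split; [apply Hk; unfold K; lia|]. intros n.
  apply Rle_trans with (12 * (\sum_(j < n) (\sum_(i < 2 ^ (K + S j) - 2 ^ (K + j))
    log_term (2 ^ (K + j) + i)))).
  - rewrite <- sum_list_scal. apply sum_list_le. intros j _.
    replace (2 ^ (K + S j) - 2 ^ (K + j))%nat with (2 ^ (K + j))%nat
      by (rewrite Nat.add_succ_r; simpl; lia).
    apply dyadic_block_ge; [unfold K; lia|apply Hk; unfold K; lia].
  - rewrite (sum_lt_consecutive_blocks (fun j => (2 ^ (K + j))%nat) log_term n)
      by (intros; apply Nat.pow_le_mono_r; lia).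
    assert (HK : (N <= 2 ^ (K + 0))%nat)
      by (pose proof (Nat.pow_gt_lin_r 2 (K + 0)); unfold K in *; lia).
    specialize (HN _ (2 ^ (K + n) - 2 ^ (K + 0))%nat HK). lra.
Qed.

Lemma doubly_dyadic_block_le j : q0 <= 2 ^ 2 ^ j ->
  \sum_(i < 2 ^ 2 ^ S j - 2 ^ 2 ^ j) log_term (2 ^ 2 ^ j + i) <= 2 * (4 ^ j * g (2 ^ 2 ^ j)).
Proof.
  intros Hq0. assert (HG : 0 <= g (2 ^ 2 ^ j)) by now apply g_nonneg.
  assert (H2j : 0 < 2 ^ j) by (apply pow_lt; lra).
  assert (Hge1 : 1 <= 2 ^ 2 ^ j) by (apply pow_R1_Rle; lra).
  replace (2 ^ S j)%nat with (2 ^ j + 2 ^ j)%nat by (simpl; lia).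
  apply Rle_trans with (\sum_(i < 2 ^ (2 ^ j + 2 ^ j) - 2 ^ 2 ^ j)
    2 * 2 ^ j * g (2 ^ 2 ^ j) * / INR (2 ^ 2 ^ j + i)).
  - apply sum_lt_le. intros i Hi. unfold log_term.
    assert (Hlow : 2 ^ 2 ^ j <= INR (2 ^ 2 ^ j + i))
      by (rewrite <- INR_2_pow; apply le_INR; lia).
    assert (Hhigh : INR (2 ^ 2 ^ j + i) <= 2 ^ (2 ^ j + 2 ^ j)%nat)
      by (rewrite <- INR_2_pow; apply le_INR; lia).
    apply Rmult_le_compat_r; [left; apply Rinv_0_lt_compat; lra|].
    apply Rmult_le_compat; [apply ln_nonneg; lra|apply g_nonneg; lra| |apply g_nonincreasing; lra].
    eapply Rle_trans; [apply ln_le; [lra|exact Hhigh]|].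
    rewrite ln_pow, plus_INR, INR_2_pow by lra. pose proof (ln_le_sub_1 2 ltac:(lra)). nra.
  - rewrite sum_list_scal, pow_4_eq_pow_2_sqr.
    pose proof (harmonic_dyadic_le (2 ^ j) (2 ^ j)) as Hharm. rewrite INR_2_pow in Hharm.
    apply Rle_trans with (2 * 2 ^ j * g (2 ^ 2 ^ j) * 2 ^ j); [|right; ring].
    apply Rmult_le_compat_l; [nra|exact Hharm].
Qed.

Lemma condensed_diverges c : q0 <= 2 ^ 2 ^ c -> ~ series_converges log_term ->
  diverges (fun j => 4 ^ (c + j) * g (2 ^ 2 ^ (c + j))).
Proof.
  intros Hc Hnot M. apply NNPP. intros Hno. apply Hnot.
  set (N := fun j => (2 ^ 2 ^ (c + j))%nat).
  assert (HN : forall j, (N j < N (S j))%nat)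
    by (intros j; unfold N; apply Nat.pow_lt_mono_r; [lia|apply Nat.pow_lt_mono_r; lia]).
  assert (Hlarge : forall n, (n + N 0%nat <= N n)%nat)
    by (induction n as [|n IH]; [lia|specialize (HN n); lia]).
  assert (Hq0 : forall j, q0 <= 2 ^ 2 ^ (c + j)).
  { intros j. eapply Rle_trans; [exact Hc|]. apply Rle_pow; [lra|].
    apply Nat.pow_le_mono_r; lia. }
  assert (Hpos : forall i, 0 <= log_term (N 0%nat + i)).
  { intros i. assert (Hi : (1 <= N 0%nat)%nat) by (apply Nat.pow_lower_bound; lia).
    apply log_term_nonneg; [lia|]. rewrite plus_INR. unfold N at 1. rewrite INR_2_pow.
    pose proof (pos_INR i). specialize (Hq0 0%nat). lra. }
  apply (series_converges_of_bounded _ (N 0%nat) (2 * M) Hpos). intros n.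
  apply Rle_trans with (\sum_(i < N n - N 0%nat) log_term (N 0%nat + i)).
  - apply sum_lt_mono; [exact Hpos|]. specialize (Hlarge n). lia.
  - rewrite <- sum_lt_consecutive_blocks by (intros j; specialize (HN j); lia).
    apply Rle_trans with (\sum_(j < n) 2 * (4 ^ (c + j) * g (2 ^ 2 ^ (c + j)))).
    + apply sum_list_le. intros j _. unfold N. rewrite Nat.add_succ_r.
      apply doubly_dyadic_block_le, Hq0.
    + rewrite sum_list_scal. apply Rmult_le_compat_l; [lra|].
      apply Rnot_lt_le. intros Hlt. apply Hno. exists n. lra.
Qed.

End Condensation.

Definition log_gauge (psi : R -> R) (s q : R) : R := Rpower (psi q) s / Rabs (ln (psi q)).

Section Gauges.

Variables (psi : R -> R) (q0 delta : R).

Hypothesis psi_pos : forall q, q0 <= q -> 0 < psi q.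
Hypothesis psi_nonincreasing : forall x y, q0 <= x -> x <= y -> psi y <= psi x.
Hypothesis delta_nonneg : 0 <= delta.

Lemma Rpower_psi_nonincreasing x y : q0 <= x -> x <= y ->
  Rpower (psi y) delta <= Rpower (psi x) delta.
Proof.
  intros Hx Hxy. apply Rle_Rpower_l; [exact delta_nonneg|].
  split; [apply psi_pos; lra|now apply psi_nonincreasing].
Qed.

Lemma term1_condensed : series_converges (term1 delta psi) -> forall eps, 0 < eps ->
  exists K, q0 <= 2 ^ K /\
    forall n, \sum_(j < n) INR (S (K + j)) * Rpower (psi (2 ^ (K + j))) delta <= eps.
Proof.
  apply (condensed_tail_le (fun q => Rpower (psi q) delta)); [|exact Rpower_psi_nonincreasing].
  intros q _. left. apply Rpower_pos.
Qed.

Hypothesis psi_lt_1 : forall q, q0 <= q -> psi q < 1.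

Lemma ln_psi_neg q : q0 <= q -> ln (psi q) < 0.
Proof. intros Hq. rewrite <- ln_1. apply ln_increasing; auto. Qed.

Lemma term2_condensed c : q0 <= 2 ^ 2 ^ c -> ~ series_converges (term2 delta psi) ->
  diverges (fun j => 4 ^ (c + j) * log_gauge psi delta (2 ^ 2 ^ (c + j))).
Proof.
  intros Hc Hnot.
  apply (condensed_diverges (log_gauge psi delta) q0); [| |exact Hc|].
  - intros q Hq. pose proof (ln_psi_neg q Hq).
    apply Rdiv_le_0_compat; [left; apply Rpower_pos|apply Rabs_pos_lt; lra].
  - intros x y Hx Hxy. pose proof (ln_psi_neg x Hx). pose proof (ln_psi_neg y ltac:(lra)).
    pose proof (ln_le _ _ (psi_pos y ltac:(lra)) (psi_nonincreasing x y Hx Hxy)).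
    unfold log_gauge. rewrite !Rabs_left by assumption.
    apply Rmult_le_compat; [left; apply Rpower_pos|left; apply Rinv_0_lt_compat; lra
      |now apply Rpower_psi_nonincreasing|apply Rinv_le_contravar; lra].
  - replace (log_term _) with (term2 delta psi); [exact Hnot|].
    apply functional_extensionality. intros k. unfold log_term, log_gauge, term2, Rdiv.
    rewrite Rinv_mult. ring.
Qed.

End Gauges.

(** * Hausdorff-null sets *)

Definition diam_le (U : R -> Prop) (d : R) : Prop :=
  0 <= d /\ forall x y, U x -> U y -> Rabs (x - y) <= d.

Lemma diam_le_ball c r : 0 <= r -> diam_le (fun x => Rabs (x - c) < r) (2 * r).
Proof.
  intros Hr. split; [lra|]. intros x y Hx Hy.
  replace (x - y) with ((x - c) - (y - c)) by ring.
  eapply Rle_trans; [apply Rabs_triang|]. rewrite Rabs_Ropp. lra.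
Qed.

Lemma rpow_nonneg d s : 0 <= rpow d s.
Proof. unfold rpow. destruct (Req_EM_T d 0); [lra|left; apply Rpower_pos]. Qed.

Lemma rpow_0 s : rpow 0 s = 0.
Proof. unfold rpow. destruct (Req_EM_T 0 0); [reflexivity|lra]. Qed.

Lemma rpow_Rpower d s : 0 < d -> rpow d s = Rpower d s.
Proof. intros Hd. unfold rpow. destruct (Req_EM_T d 0); [lra|reflexivity]. Qed.

Lemma le_of_rpow_le d eta s : 0 < s -> 0 < eta -> 0 <= d ->
  rpow d s <= Rpower eta s -> d <= eta.
Proof.
  intros Hs Heta Hd Hle. apply Rnot_lt_le. intros Hlt. rewrite rpow_Rpower in Hle by lra.
  pose proof (Rlt_Rpower_l eta d s Hs ltac:(lra)). lra.
Qed.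

(* For [0 < s] the scale restriction in [H_null] comes for free: a small value of [d ^ s]
   forces [d] to be small. *)
Lemma H_null_of_double_cover s (A : R -> Prop) : 0 < s ->
  (forall eps, 0 < eps -> exists (U : nat -> nat -> R -> Prop) (d : nat -> nat -> R),
     (forall x, A x -> exists k j, U k j x) /\
     (forall k j, diam_le (U k j) (d k j)) /\
     (forall n m, \sum_(k < n) (\sum_(j < m) rpow (d k j) s) <= eps)) ->
  H_null s A.
Proof.
  intros Hs Hcover eta eps Heta Heps.
  destruct (Hcover (Rmin eps (Rpower eta s))) as [U [d [HU [Hd Hsum]]]];
    [apply Rmin_glb_lt; [exact Heps|apply Rpower_pos]|].
  set (cost := fun kj => rpow (d (fst kj) (snd kj)) s).
  assert (Hcost : forall kj, 0 <= cost kj) by (intros; apply rpow_nonneg).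
  pose proof (sum_cantor_le cost _ Hcost Hsum) as Htotal.
  exists (fun i => U (fst (Cantor.of_nat i)) (snd (Cantor.of_nat i))),
    (fun i => d (fst (Cantor.of_nat i)) (snd (Cantor.of_nat i))).
  split; [|split].
  - intros x Hx. destruct (HU x Hx) as [k [j Hkj]]. exists (Cantor.to_nat (k, j)).
    now rewrite Cantor.cancel_of_to.
  - intros i. destruct (Hd (fst (Cantor.of_nat i)) (snd (Cantor.of_nat i))) as [Hd0 Hdiam].
    split; [split; [exact Hd0|]|exact Hdiam].
    apply (le_of_rpow_le _ _ s Hs Heta Hd0). change (cost (Cantor.of_nat i) <= Rpower eta s).
    specialize (Htotal (S i)). rewrite sum_lt_S in Htotal.
    assert (0 <= \sum_(i < i) cost (Cantor.of_nat i)) by now apply sum_list_nonneg.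
    pose proof (Rmin_r eps (Rpower eta s)). lra.
  - intros n. rewrite sum_f_R0_sum_lt.
    eapply Rle_trans; [apply (Htotal (S n))|apply Rmin_l].
Qed.

Lemma H_null_of_list_covers s (A : R -> Prop) : 0 < s ->
  (forall eps, 0 < eps -> exists C : nat -> list ((R -> Prop) * R),
     (forall x, A x -> exists k Ud, In Ud (C k) /\ fst Ud x) /\
     (forall k Ud, In Ud (C k) -> diam_le (fst Ud) (snd Ud)) /\
     (forall n, \sum_(k < n) (\sum_(Ud <- C k) rpow (snd Ud) s) <= eps)) ->
  H_null s A.
Proof.
  intros Hs Hcover. apply H_null_of_double_cover; [exact Hs|]. intros eps Heps.
  destruct (Hcover eps Heps) as [C [HC [Hd Hsum]]].
  set (empty := ((fun _ : R => False), 0)).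
  exists (fun k j => fst (nth j (C k) empty)), (fun k j => snd (nth j (C k) empty)).
  split; [|split].
  - intros x Hx. destruct (HC x Hx) as [k [Ud [Hin HUx]]]. exists k.
    destruct (In_nth _ _ empty Hin) as [j [_ Hj]]. exists j. now rewrite Hj.
  - intros k j. destruct (nth_in_or_default j (C k) empty) as [Hin| ->]; [exact (Hd _ _ Hin)|].
    split; [simpl; lra|intros x y Hx; destruct Hx].
  - intros n m. eapply Rle_trans; [|apply (Hsum n)]. apply sum_list_le. intros k _.
    apply (sum_lt_nth (fun Ud => rpow (snd Ud) s)); [intros; apply rpow_nonneg|apply rpow_0].
Qed.

Lemma H_null_of_finite_covers s (A : R -> Prop) : 0 < s ->
  (forall eps, 0 < eps -> exists C : list ((R -> Prop) * R),
     (forall x, A x -> exists Ud, In Ud C /\ fst Ud x) /\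
     (forall Ud, In Ud C -> diam_le (fst Ud) (snd Ud)) /\
     \sum_(Ud <- C) rpow (snd Ud) s <= eps) ->
  H_null s A.
Proof.
  intros Hs Hcover. apply H_null_of_list_covers; [exact Hs|]. intros eps Heps.
  destruct (Hcover eps Heps) as [C [HC [Hd Hsum]]].
  exists (fun k => match k with O => C | S _ => [] end). split; [|split].
  - intros x Hx. exists 0%nat. now apply HC.
  - intros [|k] Ud Hin; [now apply Hd|destruct Hin].
  - intros [|n]; [simpl; lra|]. rewrite sum_lt_S_l.
    rewrite (sum_list_eq_0 _ (seq 0 n)) by reflexivity. lra.
Qed.

Lemma H_null_Union s (A : R -> Prop) (B : nat -> R -> Prop) : 0 < s ->
  (forall k, H_null s (B k)) -> (forall x, A x -> exists k, B k x) -> H_null s A.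
Proof.
  intros Hs HB HA. apply H_null_of_double_cover; [exact Hs|]. intros eps Heps.
  destruct (constructive_indefinite_descr_fun_choice (@constructive_indefinite_description)
    (fun (k : nat) (Ud : (nat -> R -> Prop) * (nat -> R)) =>
      (forall x, B k x -> exists i, fst Ud i x) /\ (forall i, diam_le (fst Ud i) (snd Ud i)) /\
      (forall n, \sum_(i < n) rpow (snd Ud i) s <= eps * (/ 2) ^ S k))) as [Ud HUd].
  - intros k. assert (Hk : 0 < eps * (/ 2) ^ S k)
      by (apply Rmult_lt_0_compat; [exact Heps|apply pow_lt; lra]).
    destruct (HB k 1 _ Rlt_0_1 Hk) as [U [d [HU [Hd Hsum]]]].
    exists (U, d). split; [exact HU|split].
    + intros i. destruct (Hd i) as [Hdi Hdiam]. split; [apply Hdi|exact Hdiam].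
    + intros [|n]; [left; exact Hk|]. rewrite <- sum_f_R0_sum_lt. apply Hsum.
  - exists (fun k => fst (Ud k)), (fun k => snd (Ud k)). split; [|split].
    + intros x Hx. destruct (HA x Hx) as [k Hk]. exists k. now apply (HUd k).
    + intros k j. apply (HUd k).
    + intros n m. eapply Rle_trans; [|apply (sum_lt_half_pow_S_le eps n); lra].
      apply sum_list_le. intros k _. apply (HUd k).
Qed.

Lemma H_null_of_null_diff s (A B : R -> Prop) : 0 < s ->
  H_null s B -> H_null s (fun x => A x /\ ~ B x) -> H_null s A.
Proof.
  intros Hs HB HAB.
  apply (H_null_Union s A (fun k => match k with O => B | _ => fun x => A x /\ ~ B x end));
    [exact Hs|intros [|k]; assumption|].
  intros x Hx. destruct (classic (B x)); [now exists 0%nat|now exists 1%nat].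
Qed.

Lemma H_null_le s s' (A : R -> Prop) : s <= s' -> H_null s A -> H_null s' A.
Proof.
  intros Hs HA eta eps Heta Heps.
  destruct (HA (Rmin eta 1) eps) as [U [d [HU [Hd Hsum]]]]; [apply Rmin_glb_lt; lra|lra|].
  exists U, d. split; [exact HU|split].
  - intros i. destruct (Hd i) as [Hdi Hdiam]. pose proof (Rmin_l eta 1).
    split; [lra|exact Hdiam].
  - intros n. eapply Rle_trans; [|apply (Hsum n)]. rewrite !sum_f_R0_sum_lt.
    apply sum_list_le. intros i _. destruct (Hd i) as [[Hdi Hdi1] _]. pose proof (Rmin_r eta 1).
    destruct (Req_dec (d i) 0) as [->|Hne]; [rewrite !rpow_0; lra|].
    rewrite !rpow_Rpower by lra. apply exp_le.
    assert (ln (d i) <= 0) by (rewrite <- ln_1; apply ln_le; lra). nra.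
Qed.

(** * Words *)

Definition valid_list (F : IFS) (v : list nat) : Prop :=
  Forall (fun a => (a < ifsN F)%nat) v.

Definition shift (n : nat) (w : nat -> nat) : nat -> nat := fun i => w (n + i)%nat.

Definition prefix (w : nat -> nat) (n : nat) : list nat := map w (seq 0 n).

Fixpoint words (N n : nat) : list (list nat) :=
  match n with
  | O => [[]]
  | S k => flat_map (fun a => map (cons a) (words N k)) (seq 0 N)
  end.

Fixpoint is_prefix (c v : list nat) : bool :=
  match c, v with
  | [], _ => true
  | _ :: _, [] => false
  | b :: c', a :: v' => Nat.eqb a b && is_prefix c' v'
  end.

(* The word v_0 ... v_(n-1) followed by the cycle v_n ... v_(k-1) forever, where k is the
   length of [v]; meaningful for [n < k]. *)
Definition loop_word (v : list nat) (n : nat) : nat -> nat :=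
  fun i => nth (if Nat.ltb i n then i else n + (i - n) mod (length v - n)) v 0%nat.

Lemma firstn_app_length {A : Type} (u v : list A) : firstn (length u) (u ++ v) = u.
Proof. rewrite firstn_app, firstn_all, Nat.sub_diag. simpl. apply app_nil_r. Qed.

Lemma skipn_app_length {A : Type} (u v : list A) : skipn (length u) (u ++ v) = v.
Proof. now rewrite skipn_app, skipn_all, Nat.sub_diag. Qed.

Lemma firstn_skipn_app {A : Type} a b (u v : list A) : (a + b <= length u)%nat ->
  firstn b (skipn a (u ++ v)) = firstn b (skipn a u).
Proof.
  intros Hab. rewrite skipn_app. replace (a - length u)%nat with 0%nat by lia. simpl.
  rewrite firstn_app, length_skipn. replace (b - (length u - a))%nat with 0%nat by lia.
  apply app_nil_r.
Qed.

Lemma in_words N n v : In v (words N n) <-> length v = n /\ Forall (fun a => (a < N)%nat) v.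
Proof.
  revert v. induction n as [|n IH]; intros v; simpl.
  - split; [intros [<-|[]]; split; [reflexivity|constructor]|].
    intros [Hl _]. left. now destruct v.
  - rewrite in_flat_map. split.
    + intros [a [Ha Hv]]. apply in_map_iff in Hv. destruct Hv as [v' [<- Hv']].
      apply IH in Hv'. apply in_seq in Ha. destruct Hv' as [<- Hv'].
      split; [reflexivity|]. constructor; [lia|exact Hv'].
    + intros [Hl Hv]. destruct v as [|a v]; [discriminate|]. inversion Hv; subst.
      exists a. split; [apply in_seq; lia|]. apply in_map, IH.
      split; [now injection Hl|assumption].
Qed.

Lemma length_prefix w n : length (prefix w n) = n.
Proof. unfold prefix. now rewrite length_map, length_seq. Qed.

Lemma nth_prefix w n i : (i < n)%nat -> nth i (prefix w n) 0%nat = w i.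
Proof.
  intros Hi. unfold prefix. rewrite nth_indep with (d' := w 0%nat).
  - now rewrite map_nth, seq_nth.
  - now rewrite length_map, length_seq.
Qed.

Lemma prefix_eq_iff w w' n : prefix w n = prefix w' n <-> forall i, (i < n)%nat -> w i = w' i.
Proof.
  split; intros Hww'.
  - intros i Hi. rewrite <- (nth_prefix w n i Hi), Hww'. now apply nth_prefix.
  - apply map_ext_in. intros i Hi. apply in_seq in Hi. apply Hww'. lia.
Qed.

Lemma shift_shift a b w : shift a (shift b w) = shift (b + a) w.
Proof. apply functional_extensionality. intros i. unfold shift. f_equal. lia. Qed.

Lemma map_seq_shift w a n : map w (seq a n) = prefix (shift a w) n.
Proof.
  unfold prefix. rewrite <- (Nat.add_0_r a) at 1. generalize 0%nat as b.
  induction n as [|n IH]; intros b; simpl; [reflexivity|].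
  rewrite <- IH, Nat.add_succ_r. reflexivity.
Qed.

Lemma prefix_add w n m : prefix w (n + m) = prefix w n ++ prefix (shift n w) m.
Proof. unfold prefix at 1. rewrite seq_app, map_app. f_equal. apply map_seq_shift. Qed.

Lemma prefix_S w n : prefix w (S n) = prefix w n ++ [w n].
Proof. unfold prefix. now rewrite seq_S, map_app. Qed.

Lemma skipn_prefix w a n : skipn a (prefix w n) = prefix (shift a w) (n - a).
Proof. unfold prefix at 1. rewrite skipn_map, skipn_seq. apply map_seq_shift. Qed.

Lemma firstn_prefix w a n : (a <= n)%nat -> firstn a (prefix w n) = prefix w a.
Proof.
  intros Ha. replace n with (a + (n - a))%nat by lia. rewrite prefix_add.
  rewrite <- (length_prefix w a) at 1. apply firstn_app_length.
Qed.

Lemma valid_prefix F w n : valid_word F w -> valid_list F (prefix w n).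
Proof. intros Hw. apply Forall_map, Forall_forall. intros i _. apply Hw. Qed.

Lemma valid_shift F w n : valid_word F w -> valid_word F (shift n w).
Proof. intros Hw i. apply Hw. Qed.

Lemma valid_firstn F n v : valid_list F v -> valid_list F (firstn n v).
Proof.
  intros Hv. rewrite <- (firstn_skipn n v) in Hv. now apply Forall_app in Hv.
Qed.

Lemma is_prefix_firstn c u v :
  is_prefix c (u ++ v) = true -> is_prefix (firstn (length u) c) u = true.
Proof.
  revert c. induction u as [|a u IH]; intros [|b c]; simpl; try reflexivity.
  intros Hpre. apply andb_prop in Hpre. destruct Hpre as [-> Hpre]. now apply IH.
Qed.

Lemma is_prefix_prefix c w n : is_prefix c (prefix w n) = true -> c = prefix w (length c).
Proof.
  revert w n. induction c as [|b c IH]; intros w [|n] Hpre; try reflexivity; [discriminate|].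
  rewrite (prefix_add w 1 n : prefix w (S n) = _) in Hpre. simpl in Hpre.
  apply andb_prop in Hpre. destruct Hpre as [Hb Hpre]. apply Nat.eqb_eq in Hb. subst b.
  simpl length. rewrite (prefix_add w 1 (length c) : prefix w (S (length c)) = _).
  simpl. f_equal. now apply (IH _ n).
Qed.

Lemma first_difference (w w' : nat -> nat) n :
  (forall i, (i < n)%nat -> w i = w' i) \/
  exists l, (l < n)%nat /\ (forall i, (i < l)%nat -> w i = w' i) /\ w l <> w' l.
Proof.
  destruct (classic (exists l, w l <> w' l)) as [Hdiff|Hsame].
  - destruct (exists_least_nat _ Hdiff) as [l [Hl Hmin]].
    destruct (Nat.lt_ge_cases l n) as [Hln|Hnl]; [right; exists l; split; [exact Hln|split]|left].
    + intros i Hi. now apply NNPP, Hmin.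
    + exact Hl.
    + intros i Hi. apply NNPP, Hmin. lia.
  - left. intros i _. apply NNPP. intros Hi. apply Hsame. now exists i.
Qed.

Lemma word_of_extensible (N : nat) (P : list nat -> Prop) : P [] ->
  (forall v, P v -> exists a, (a < N)%nat /\ P (v ++ [a])) ->
  exists w, (forall i, (w i < N)%nat) /\ forall n, P (prefix w n).
Proof.
  intros Hnil Hext.
  set (next := fun v => epsilon (inhabits 0%nat) (fun a => (a < N)%nat /\ P (v ++ [a]))).
  assert (Hnext : forall v, P v -> (next v < N)%nat /\ P (v ++ [next v]))
    by (intros v Hv; apply epsilon_spec; now apply Hext).
  set (grow := fix grow n := match n with O => [] | S k => grow k ++ [next (grow k)] end).
  exists (fun n => next (grow n)).
  assert (Hgrow : forall n, prefix (fun n => next (grow n)) n = grow n)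
    by (induction n as [|n IH]; [reflexivity|now rewrite prefix_S, IH]).
  assert (HP : forall n, P (grow n))
    by (induction n as [|n IH]; [exact Hnil|now apply Hnext]).
  split; [intros n; now apply Hnext|intros n; now rewrite Hgrow].
Qed.

Lemma nth_loop_word v n i : (i < length v)%nat -> loop_word v n i = nth i v 0%nat.
Proof.
  intros Hi. unfold loop_word. destruct (Nat.ltb_spec i n) as [Hin|Hni]; [reflexivity|].
  rewrite Nat.mod_small by lia. f_equal. lia.
Qed.

Lemma prefix_loop_word v n : prefix (loop_word v n) (length v) = v.
Proof.
  apply (nth_ext _ _ 0%nat 0%nat); [apply length_prefix|]. intros i Hi.
  rewrite length_prefix in Hi. now rewrite nth_prefix, nth_loop_word.
Qed.

Lemma loop_word_periodic v n : periodic_from (loop_word v n) n (length v - n).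
Proof.
  intros i Hi. unfold loop_word.
  destruct (Nat.ltb_spec (i + (length v - n)) n) as [Hlt|_]; [lia|].
  destruct (Nat.ltb_spec i n) as [Hlt|_]; [lia|].
  replace (i + (length v - n) - n)%nat with (i - n + 1 * (length v - n))%nat by lia.
  now rewrite Nat.Div0.mod_add.
Qed.

Lemma valid_loop_word F v n :
  valid_list F v -> (n < length v)%nat -> valid_word F (loop_word v n).
Proof.
  intros Hv Hn i. unfold loop_word. unfold valid_list in Hv. rewrite Forall_forall in Hv.
  apply Hv, nth_In. destruct (Nat.ltb_spec i n) as [Hin|Hni]; [lia|].
  pose proof (Nat.mod_upper_bound (i - n) (length v - n)). lia.
Qed.

Lemma periodic_from_mul w n m i k : periodic_from w n m -> (n <= i)%nat ->
  w (i + k * m)%nat = w i.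
Proof.
  intros Hper Hi. induction k as [|k IH]; [f_equal; lia|].
  replace (i + S k * m)%nat with ((i + k * m) + m)%nat by lia.
  now rewrite Hper by lia.
Qed.

Lemma loop_word_prefix w n m : (1 <= m)%nat -> periodic_from w n m ->
  loop_word (prefix w (n + m)) n = w.
Proof.
  intros Hm Hper. apply functional_extensionality. intros i. unfold loop_word.
  rewrite length_prefix. replace (n + m - n)%nat with m by lia.
  destruct (Nat.ltb_spec i n) as [Hin|Hni]; [apply nth_prefix; lia|].
  pose proof (Nat.mod_upper_bound (i - n) m). rewrite nth_prefix by lia.
  rewrite <- (periodic_from_mul w n m _ ((i - n) / m) Hper) by lia. f_equal.
  pose proof (Nat.div_mod_eq (i - n) m). lia.
Qed.

Lemma loop_word_prefix_agree w n m r : (1 <= m)%nat ->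
  (forall i, (i < r)%nat -> w (n + m + i)%nat = w (n + i)%nat) ->
  forall i, (i < n + m + r)%nat -> w i = loop_word (prefix w (n + m)) n i.
Proof.
  intros Hm Hrep i. induction i as [i IH] using lt_wf_ind. intros Hi.
  destruct (Nat.lt_ge_cases i (n + m)) as [Hlow|Hhigh].
  - rewrite nth_loop_word, nth_prefix; [reflexivity|exact Hlow|now rewrite length_prefix].
  - pose proof (loop_word_periodic (prefix w (n + m)) n (i - m)%nat ltac:(lia)) as Hper.
    rewrite length_prefix in Hper. replace (i - m + (n + m - n))%nat with i in Hper by lia.
    rewrite Hper, <- IH by lia.
    replace i with (n + m + (i - n - m))%nat at 1 by lia. rewrite Hrep by lia. f_equal. lia.
Qed.

Lemma min_pre_period_exists w n m : (1 <= m)%nat -> periodic_from w n m ->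
  exists n0 m0, min_pre_period w n0 m0 /\ (n0 <= n)%nat /\ (m0 <= m)%nat.
Proof.
  intros Hm Hper.
  destruct (exists_least_nat (fun n' => exists m', (1 <= m')%nat /\ periodic_from w n' m'))
    as [n0 [[m1 [Hm1 Hper1]] Hn0]]; [now exists n, m|].
  destruct (exists_least_nat (fun m' => (1 <= m')%nat /\ periodic_from w n0 m'))
    as [m0 [[Hm0 Hper0] Hm0_min]]; [now exists m1|].
  assert (Hn0_min : forall n' m', (1 <= m')%nat -> periodic_from w n' m' -> (n0 <= n')%nat).
  { intros n' m' Hm' Hper'. apply Nat.nlt_ge. intros Hlt. apply (Hn0 n' Hlt). now exists m'. }
  assert (Hm0_min' : forall m', (1 <= m')%nat -> periodic_from w n0 m' -> (m0 <= m')%nat).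
  { intros m' Hm' Hper'. apply Nat.nlt_ge. intros Hlt. now apply (Hm0_min m' Hlt). }
  exists n0, m0. split; [repeat split; assumption|split; [now apply (Hn0_min n m)|]].
  apply Hm0_min'; [exact Hm|]. intros i Hi.
  rewrite <- (periodic_from_mul w n0 m0 i n Hper0),
    <- (periodic_from_mul w n0 m0 (i + m) n Hper0) by lia.
  replace (i + m + n * m0)%nat with (i + n * m0 + m)%nat by lia. apply Hper. nia.
Qed.

(** * The coding map *)

Lemma Un_cv_of_close (x y : nat -> R) l c :
  Un_cv x l -> (forall n, Rabs (y n - x n) <= c / 2 ^ n) -> Un_cv y l.
Proof.
  intros Hx Hy e He. destruct (Hx (e / 2)) as [n1 Hn1]; [lra|].
  destruct (div_2_pow_lt_eventually c (e / 2)) as [n2 Hn2]; [lra|].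
  exists (max n1 n2). intros n Hn. unfold Rdist in *.
  specialize (Hn1 n ltac:(lia)). specialize (Hn2 n ltac:(lia)). specialize (Hy n).
  replace (y n - l) with ((y n - x n) + (x n - l)) by ring.
  eapply Rle_lt_trans; [apply Rabs_triang|]. lra.
Qed.

Lemma Un_cv_Icc (x : nat -> R) l a b : Un_cv x l -> (forall n, a <= x n <= b) -> a <= l <= b.
Proof.
  assert (Hconst : forall c, Un_cv (fun _ => c) c)
    by (intros c e He; exists 0%nat; intros; now rewrite Rdist_eq).
  intros Hx Hab. split.
  - apply (Rle_cv_lim (Un := fun _ => a) (Vn := x)); [apply Hab|apply Hconst|exact Hx].
  - apply (Rle_cv_lim (Un := x) (Vn := fun _ => b)); [apply Hab|exact Hx|apply Hconst].
Qed.

Lemma comp_add F w n m x : comp F w (n + m) x = comp F w n (comp F (shift n w) m x).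
Proof.
  revert x. induction m as [|m IH]; intros x; simpl; [now rewrite Nat.add_0_r|].
  rewrite Nat.add_succ_r. simpl. now rewrite IH.
Qed.

Lemma comp_ext F w w' n x :
  (forall i, (i < n)%nat -> w i = w' i) -> comp F w n x = comp F w' n x.
Proof.
  revert x. induction n as [|n IH]; intros x Hww'; simpl; [reflexivity|].
  rewrite Hww' by lia. apply IH. intros i Hi. apply Hww'. lia.
Qed.

Lemma closed_balls_meet a b r s : 0 <= r -> 0 <= s -> Rabs (a - b) <= r + s ->
  exists t, Rabs (t - a) <= r /\ Rabs (t - b) <= s.
Proof.
  intros Hr Hs Hab. apply Rabs_le_between in Hab. exists (Rmax (a - r) (b - s)).
  unfold Rmax. destruct Rle_dec; split; apply Rabs_le; lra.
Qed.

Section RationalIFS.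

Variables (F : IFS) (lo hi : R).

Hypothesis two_letters : (2 <= ifsN F)%nat.
Hypothesis p_sign : forall a, (a < ifsN F)%nat -> ifsp F a = 1%Z \/ ifsp F a = (-1)%Z.
Hypothesis q_ge_2 : forall a, (a < ifsN F)%nat -> (2 <= ifsq F a)%nat.
Hypothesis lo_le_hi : lo <= hi.
Hypothesis u_invariant : forall a x,
  (a < ifsN F)%nat -> in_I lo hi x -> in_I lo hi (u F a x).
Hypothesis u_disjoint : forall a b x y, (a < ifsN F)%nat -> (b < ifsN F)%nat -> a <> b ->
  in_I lo hi x -> in_I lo hi y -> u F a x <> u F b y.

Definition denom (v : list nat) : R := fold_right (fun a r => INR (ifsq F a) * r) 1 v.

Definition coding_map (w : nat -> nat) : R := epsilon (inhabits 0) (coding F w).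

Lemma INR_q_ge_2 a : (a < ifsN F)%nat -> 2 <= INR (ifsq F a).
Proof. intros Ha. change 2 with (INR 2). now apply le_INR, q_ge_2. Qed.

Lemma denom_app v v' : denom (v ++ v') = denom v * denom v'.
Proof. induction v as [|a v IH]; simpl; [ring|rewrite IH; ring]. Qed.

Lemma denom_prefix_S w n : denom (prefix w (S n)) = denom (prefix w n) * INR (ifsq F (w n)).
Proof. rewrite prefix_S, denom_app. simpl. ring. Qed.

Lemma denom_ge_2_pow v : valid_list F v -> 2 ^ length v <= denom v.
Proof.
  induction 1 as [|a v Ha Hv IH]; simpl; [lra|].
  pose proof (INR_q_ge_2 a Ha). assert (0 < 2 ^ length v) by (apply pow_lt; lra). nra.
Qed.

Lemma denom_ge_1 v : valid_list F v -> 1 <= denom v.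
Proof.
  intros Hv. pose proof (denom_ge_2_pow v Hv).
  assert (1 <= 2 ^ length v) by (apply pow_R1_Rle; lra). lra.
Qed.

Lemma denom_le_pow M v : (forall a, (a < ifsN F)%nat -> INR (ifsq F a) <= M) ->
  valid_list F v -> denom v <= M ^ length v.
Proof.
  intros HM. induction 1 as [|a v Ha Hv IH]; simpl; [lra|].
  pose proof (denom_ge_1 v Hv). apply Rmult_le_compat; [apply pos_INR|lra|auto|exact IH].
Qed.

Lemma denom_prefix_ge_2_pow w n : valid_word F w -> 2 ^ n <= denom (prefix w n).
Proof. intros Hw. rewrite <- (length_prefix w n) at 1. now apply denom_ge_2_pow, valid_prefix. Qed.

Lemma denom_prefix_pos w n : valid_word F w -> 0 < denom (prefix w n).
Proof. intros Hw. pose proof (denom_ge_1 _ (valid_prefix F w n Hw)). lra. Qed.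

Lemma denom_prefix_le w n m : valid_word F w -> (n <= m)%nat ->
  denom (prefix w n) <= denom (prefix w m).
Proof.
  intros Hw Hnm. replace m with (n + (m - n))%nat by lia. rewrite prefix_add, denom_app.
  pose proof (denom_prefix_pos w n Hw).
  pose proof (denom_ge_1 _ (valid_prefix F _ (m - n) (valid_shift F w n Hw))). nra.
Qed.

Lemma dist_u a x y : (a < ifsN F)%nat ->
  Rabs (u F a x - u F a y) = Rabs (x - y) / INR (ifsq F a).
Proof.
  intros Ha. pose proof (INR_q_ge_2 a Ha). unfold u.
  replace (_ / _ - _ / _) with (IZR (ifsp F a) * ((x - y) / INR (ifsq F a))) by (field; lra).
  rewrite Rabs_mult, Rabs_div, (Rabs_pos_eq (INR _)) by lra.
  replace (Rabs (IZR (ifsp F a))) with 1; [ring|].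
  rewrite Rabs_Zabs. destruct (p_sign a Ha) as [-> | ->]; reflexivity.
Qed.

Lemma dist_comp w n x y : valid_word F w ->
  Rabs (comp F w n x - comp F w n y) = Rabs (x - y) / denom (prefix w n).
Proof.
  intros Hw. revert x y. induction n as [|n IH]; intros x y; [simpl; field|].
  rewrite denom_prefix_S. simpl. rewrite IH, dist_u by apply Hw.
  pose proof (denom_prefix_pos w n Hw). pose proof (INR_q_ge_2 (w n) (Hw n)). field. lra.
Qed.

Lemma dist_comp_le w n x y : valid_word F w ->
  Rabs (comp F w n x - comp F w n y) <= Rabs (x - y) / 2 ^ n.
Proof.
  intros Hw. rewrite dist_comp by exact Hw. apply Rmult_le_compat_l; [apply Rabs_pos|].
  apply Rinv_le_contravar; [apply pow_lt; lra|now apply denom_prefix_ge_2_pow].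
Qed.

Lemma comp_in_I w n x : valid_word F w -> in_I lo hi x -> in_I lo hi (comp F w n x).
Proof.
  intros Hw. revert x. induction n as [|n IH]; intros x Hx; simpl; [exact Hx|].
  apply IH, u_invariant; [apply Hw|exact Hx].
Qed.

Lemma lo_in_I : in_I lo hi lo.
Proof. unfold in_I. lra. Qed.

Lemma dist_in_I x y : in_I lo hi x -> in_I lo hi y -> Rabs (x - y) <= hi - lo.
Proof. intros [] []. apply Rabs_le. lra. Qed.

Lemma comp_lo_close w n m : valid_word F w -> (n <= m)%nat ->
  Rabs (comp F w m lo - comp F w n lo) <= (hi - lo) / 2 ^ n.
Proof.
  intros Hw Hnm. replace m with (n + (m - n))%nat by lia. rewrite comp_add.
  eapply Rle_trans; [now apply dist_comp_le|].
  apply Rmult_le_compat_r; [left; apply Rinv_0_lt_compat, pow_lt; lra|].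
  apply dist_in_I; [|apply lo_in_I]. apply comp_in_I; [now apply valid_shift|apply lo_in_I].
Qed.

Lemma coding_exists w : valid_word F w -> exists x, coding F w x.
Proof.
  intros Hw. destruct (R_complete (fun n => comp F w n lo)) as [x Hx].
  - intros e He. destruct (div_2_pow_lt_eventually (hi - lo) (e / 2)) as [n0 Hn0]; [lra|].
    specialize (Hn0 n0 (le_n _)). exists n0. intros n m Hn Hm. unfold Rdist.
    replace (comp F w n lo - comp F w m lo) with
      ((comp F w n lo - comp F w n0 lo) - (comp F w m lo - comp F w n0 lo)) by ring.
    eapply Rle_lt_trans; [apply Rabs_triang|]. rewrite Rabs_Ropp.
    pose proof (comp_lo_close w n0 n Hw Hn). pose proof (comp_lo_close w n0 m Hw Hm). lra.
  - exists x. apply (Un_cv_of_close _ _ _ (Rabs (0 - lo)) Hx). intros n. now apply dist_comp_le.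
Qed.

Lemma coding_coding_map w : valid_word F w -> coding F w (coding_map w).
Proof. intros Hw. unfold coding_map. now apply epsilon_spec, coding_exists. Qed.

Lemma coding_unique w x : valid_word F w -> coding F w x -> x = coding_map w.
Proof. intros Hw Hx. exact (UL_sequence _ _ _ Hx (coding_coding_map w Hw)). Qed.

Lemma limit_set_coding_map w : valid_word F w -> limit_set F (coding_map w).
Proof. intros Hw. exists w. split; [exact Hw|now apply coding_coding_map]. Qed.

Lemma limit_set_inv x : limit_set F x -> exists w, valid_word F w /\ x = coding_map w.
Proof. intros [w [Hw Hx]]. exists w. split; [exact Hw|now apply coding_unique]. Qed.

Lemma coding_map_in_I w : valid_word F w -> in_I lo hi (coding_map w).
Proof.
  intros Hw. apply (Un_cv_Icc (fun n => comp F w n lo)).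
  - apply (Un_cv_of_close (fun n => comp F w n 0) _ _ (Rabs (lo - 0)));
      [now apply coding_coding_map|intros n; now apply dist_comp_le].
  - intros n. apply comp_in_I; [exact Hw|apply lo_in_I].
Qed.

Lemma coding_map_comp w n : valid_word F w ->
  coding_map w = comp F w n (coding_map (shift n w)).
Proof.
  intros Hw. symmetry. apply coding_unique; [exact Hw|]. intros e He.
  destruct (coding_coding_map _ (valid_shift F w n Hw) e He) as [n0 Hn0].
  exists (n + n0)%nat. intros m Hm. replace m with (n + (m - n))%nat by lia.
  rewrite comp_add. unfold Rdist in *. rewrite dist_comp by exact Hw.
  pose proof (denom_ge_1 _ (valid_prefix F w n Hw)). specialize (Hn0 (m - n)%nat ltac:(lia)).
  apply Rlt_div_l; [lra|]. nra.
Qed.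

Lemma coding_map_close w w' n : valid_word F w -> valid_word F w' ->
  (forall i, (i < n)%nat -> w i = w' i) ->
  Rabs (coding_map w - coding_map w') <= (hi - lo) / denom (prefix w n).
Proof.
  intros Hw Hw' Hagree. rewrite (coding_map_comp w n Hw), (coding_map_comp w' n Hw').
  rewrite <- (comp_ext F w w' n _ Hagree), dist_comp by exact Hw.
  apply Rmult_le_compat_r; [left; apply Rinv_0_lt_compat; now apply denom_prefix_pos|].
  apply dist_in_I; apply coding_map_in_I; now apply valid_shift.
Qed.

Definition cylinder (v : list nat) (x : R) : Prop :=
  exists w, valid_word F w /\ prefix w (length v) = v /\ x = coding_map w.

Lemma diam_cylinder_le v : valid_list F v -> diam_le (cylinder v) ((hi - lo + 1) / denom v).
Proof.
  intros Hv. pose proof (denom_ge_1 v Hv). split; [apply Rdiv_le_0_compat; lra|].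
  intros x y [w [Hw [Hwv ->]]] [w' [Hw' [Hwv' ->]]].
  apply Rle_trans with ((hi - lo) / denom v).
  - rewrite <- Hwv. apply coding_map_close; [exact Hw|exact Hw'|].
    apply prefix_eq_iff. congruence.
  - apply Rmult_le_compat_r; [left; apply Rinv_0_lt_compat; lra|lra].
Qed.

Lemma u_preimage a c t : (a < ifsN F)%nat ->
  u F a (c + IZR (ifsp F a) * INR (ifsq F a) * (t - u F a c)) = t.
Proof.
  intros Ha. pose proof (INR_q_ge_2 a Ha). unfold u.
  destruct (p_sign a Ha) as [-> | ->]; field; lra.
Qed.

Definition image_center (a : nat) : R := u F a ((lo + hi) / 2).

Definition image_radius (a : nat) : R := (hi - lo) / 2 / INR (ifsq F a).

Lemma in_I_iff x : in_I lo hi x <-> Rabs (x - (lo + hi) / 2) <= (hi - lo) / 2.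
Proof. unfold in_I. rewrite Rabs_le_between'. lra. Qed.

Lemma u_in_image a x : (a < ifsN F)%nat -> in_I lo hi x ->
  Rabs (u F a x - image_center a) <= image_radius a.
Proof.
  intros Ha Hx. pose proof (INR_q_ge_2 a Ha). unfold image_center. rewrite dist_u by exact Ha.
  apply Rmult_le_compat_r; [left; apply Rinv_0_lt_compat; lra|now apply in_I_iff].
Qed.

Lemma u_onto_image a t : (a < ifsN F)%nat -> Rabs (t - image_center a) <= image_radius a ->
  exists x, in_I lo hi x /\ u F a x = t.
Proof.
  intros Ha Ht. pose proof (INR_q_ge_2 a Ha). unfold image_center, image_radius in Ht.
  eexists. split; [|apply (u_preimage a ((lo + hi) / 2) t Ha)].
  apply in_I_iff. rewrite Rplus_minus_l, !Rabs_mult, Rabs_Zabs, (Rabs_pos_eq (INR _)) by lra.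
  apply Rle_div_r in Ht; [|lra]. destruct (p_sign a Ha) as [-> | ->]; simpl; lra.
Qed.

Lemma u_gap a b : (a < ifsN F)%nat -> (b < ifsN F)%nat -> a <> b ->
  exists D, 0 < D /\ forall x y, in_I lo hi x -> in_I lo hi y ->
    D <= Rabs (u F a x - u F b y).
Proof.
  intros Ha Hb Hab.
  exists (Rabs (image_center a - image_center b) - image_radius a - image_radius b). split.
  - apply Rnot_le_lt. intros Hle.
    destruct (closed_balls_meet (image_center a) (image_center b)
      (image_radius a) (image_radius b)) as [t [Hta Htb]].
    1,2: unfold image_radius; apply Rdiv_le_0_compat;
      [lra|apply Rlt_le_trans with 2; [lra|now apply INR_q_ge_2]].
    { lra. }
    destruct (u_onto_image a t Ha Hta) as [x [Hx Hxt]].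
    destruct (u_onto_image b t Hb Htb) as [y [Hy Hyt]].
    apply (u_disjoint a b x y Ha Hb Hab Hx Hy). congruence.
  - intros x y Hx Hy. pose proof (u_in_image a x Ha Hx) as Hxa.
    pose proof (u_in_image b y Hb Hy) as Hyb. revert Hxa Hyb.
    unfold Rabs. repeat destruct Rcase_abs; lra.
Qed.

Lemma coding_map_head w : valid_word F w ->
  coding_map w = u F (w 0%nat) (coding_map (shift 1 w)).
Proof. apply (coding_map_comp w 1). Qed.

Lemma coding_map_separated : exists D, 0 < D /\
  forall w w' n, valid_word F w -> valid_word F w' ->
    (forall i, (i < n)%nat -> w i = w' i) -> w n <> w' n ->
    D / denom (prefix w n) <= Rabs (coding_map w - coding_map w').
Proof.
  destruct (uniform_on_list
    (fun ab D => fst ab <> snd ab -> forall x y, in_I lo hi x -> in_I lo hi y ->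
       D <= Rabs (u F (fst ab) x - u F (snd ab) y))
    (list_prod (seq 0 (ifsN F)) (seq 0 (ifsN F)))) as [D [HD Hgap]].
  - intros ab e e' He Hab Hne x y Hx Hy. specialize (Hab Hne x y Hx Hy). lra.
  - intros [a b] Hab. apply in_prod_iff in Hab. rewrite !in_seq in Hab.
    destruct (Nat.eq_dec a b) as [Heq|Hne]; [exists 1; split; [lra|contradiction]|].
    destruct (u_gap a b) as [D [HD Hgap]]; try lia. exists D. auto.
  - exists D. split; [exact HD|]. intros w w' n Hw Hw' Hagree Hne.
    rewrite (coding_map_comp w n Hw), (coding_map_comp w' n Hw').
    rewrite <- (comp_ext F w w' n _ Hagree), dist_comp by exact Hw.
    apply Rmult_le_compat_r; [left; apply Rinv_0_lt_compat; now apply denom_prefix_pos|].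
    rewrite (coding_map_head (shift n w)), (coding_map_head (shift n w'))
      by now apply valid_shift.
    apply (Hgap (shift n w 0%nat, shift n w' 0%nat));
      [| |apply coding_map_in_I; do 2 apply valid_shift; assumption..].
    + pose proof (valid_shift F w n Hw 0%nat). pose proof (valid_shift F w' n Hw' 0%nat).
      apply in_prod; apply in_seq; lia.
    + unfold shift. now rewrite Nat.add_0_r.
Qed.

(** * Weighted counts of finite words *)

Definition letter_weight (s : R) (a : nat) : R := Rpower (INR (ifsq F a)) (- s).

Definition weight (s : R) (v : list nat) : R :=
  fold_right (fun a r => letter_weight s a * r) 1 v.

Definition moran_sum (s : R) : R := \sum_(a < ifsN F) letter_weight s a.

Definition expect (s : R) (n : nat) (f : list nat -> R) : R :=
  \sum_(v <- words (ifsN F) n) weight s v * f v.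

Section FixedExponent.

Variable s : R.

Lemma letter_weight_pos a : 0 < letter_weight s a.
Proof. apply Rpower_pos. Qed.

Lemma weight_pos v : 0 < weight s v.
Proof.
  induction v as [|a v IH]; simpl; [lra|].
  apply Rmult_lt_0_compat; [apply letter_weight_pos|exact IH].
Qed.

Lemma weight_denom v : valid_list F v -> weight s v = Rpower (denom v) (- s).
Proof.
  induction 1 as [|a v Ha Hv IH]; simpl; [now rewrite Rpower_1_l|].
  pose proof (INR_q_ge_2 a Ha). pose proof (denom_ge_1 v Hv).
  rewrite IH. apply Rpower_mult_distr; lra.
Qed.

Lemma moran_sum_nonneg : 0 <= moran_sum s.
Proof. apply sum_list_nonneg. intros a _. left. apply letter_weight_pos. Qed.

Lemma expect_le n f g :
  (forall v, length v = n -> valid_list F v -> f v <= g v) -> expect s n f <= expect s n g.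
Proof.
  intros Hfg. apply sum_list_le. intros v Hv. apply in_words in Hv.
  apply Rmult_le_compat_l; [left; apply weight_pos|now apply Hfg].
Qed.

Lemma expect_ext n f g :
  (forall v, length v = n -> valid_list F v -> f v = g v) -> expect s n f = expect s n g.
Proof. intros Hfg. apply Rle_antisym; apply expect_le; intros; rewrite Hfg; auto; lra. Qed.

Lemma expect_plus n f g : expect s n (fun v => f v + g v) = expect s n f + expect s n g.
Proof.
  unfold expect. rewrite <- sum_list_plus. apply sum_list_ext. intros v _. ring.
Qed.

Lemma expect_scal n c f : expect s n (fun v => c * f v) = c * expect s n f.
Proof.
  unfold expect. rewrite <- sum_list_scal. apply sum_list_ext. intros v _. ring.
Qed.

Lemma expect_nonneg n f : (forall v, 0 <= f v) -> 0 <= expect s n f.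
Proof.
  intros Hf. apply sum_list_nonneg. intros v _.
  apply Rmult_le_pos; [left; apply weight_pos|apply Hf].
Qed.

Lemma expect_sum_list {A : Type} n (f : A -> list nat -> R) l :
  expect s n (fun v => \sum_(a <- l) f a v) = \sum_(a <- l) expect s n (f a).
Proof.
  unfold expect. rewrite sum_list_swap. apply sum_list_ext. intros v _.
  now rewrite sum_list_scal.
Qed.

Lemma expect_swap n m (f : list nat -> list nat -> R) :
  expect s n (fun u => expect s m (f u)) = expect s m (fun v => expect s n (fun u => f u v)).
Proof.
  unfold expect at 2 3. rewrite expect_sum_list. apply sum_list_ext. intros v _.
  apply expect_scal.
Qed.

Lemma expect_0 f : expect s 0 f = f [].
Proof. unfold expect. simpl. ring. Qed.

Lemma expect_S n f : expect s (S n) f =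
  \sum_(a < ifsN F) letter_weight s a * expect s n (fun v => f (a :: v)).
Proof.
  unfold expect. simpl words. rewrite sum_list_flat_map. apply sum_list_ext. intros a _.
  rewrite sum_list_map, <- sum_list_scal. apply sum_list_ext. intros v _. simpl. ring.
Qed.

Lemma expect_app n m f :
  expect s (n + m) f = expect s n (fun u => expect s m (fun v => f (u ++ v))).
Proof.
  revert f. induction n as [|n IH]; intros f; simpl Nat.add; [now rewrite expect_0|].
  rewrite !expect_S. apply sum_list_ext. intros a _. now rewrite IH.
Qed.

Lemma expect_1 n : expect s n (fun _ => 1) = moran_sum s ^ n.
Proof.
  induction n as [|n IH]; [now rewrite expect_0|]. rewrite expect_S, IH. simpl.
  unfold moran_sum at 2. rewrite Rmult_comm, <- sum_list_scal. apply sum_list_ext.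
  intros a _. ring.
Qed.

Lemma rpow_div_denom D v : 0 < D -> valid_list F v ->
  rpow (D / denom v) s = Rpower D s * weight s v.
Proof.
  intros HD Hv. pose proof (denom_ge_1 v Hv).
  rewrite rpow_Rpower by (apply Rdiv_lt_0_compat; lra).
  rewrite weight_denom, <- Rpower_inv_l by (exact Hv || lra).
  rewrite Rpower_mult_distr by (try apply Rinv_0_lt_compat; lra). reflexivity.
Qed.

(* Markov's inequality: the cylinders on which the test function [f] is at least 1 have
   total mass at most its expectation. *)
Lemma H_null_of_expect_small (A : R -> Prop) : 0 < s ->
  (forall eps, 0 < eps -> exists n f, (forall v, 0 <= f v) /\
     (forall x, A x -> exists w, valid_word F w /\ x = coding_map w /\ 1 <= f (prefix w n)) /\
     expect s n f <= eps) ->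
  H_null s A.
Proof.
  intros Hs Hf. apply H_null_of_finite_covers; [exact Hs|]. intros eps Heps.
  set (D := hi - lo + 1). assert (HD : 0 < D) by (unfold D; lra).
  pose proof (Rpower_pos D s) as HDs.
  destruct (Hf (eps / Rpower D s)) as [n [f [Hf0 [HA Hexp]]]]; [now apply Rdiv_lt_0_compat|].
  set (radius := fun v => if Rle_dec 1 (f v) then D / denom v else 0).
  exists (map (fun v => ((fun x => 1 <= f v /\ cylinder v x), radius v)) (words (ifsN F) n)).
  split; [|split].
  - intros x Hx. destruct (HA x Hx) as [w [Hw [Hxw Hfw]]].
    eexists. split; [apply in_map, in_words|].
    + split; [apply length_prefix|now apply (valid_prefix F w n)].
    + split; [exact Hfw|]. exists w. now rewrite length_prefix.
  - intros Ud Hin. apply in_map_iff in Hin. destruct Hin as [v [<- Hv]].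
    apply in_words in Hv. destruct Hv as [_ Hv]. simpl. unfold radius.
    destruct (Rle_dec 1 (f v)) as [Hfv|Hfv]; [|split; [lra|tauto]].
    destruct (diam_cylinder_le v Hv) as [Hd Hdiam]. split; [exact Hd|].
    intros x y [_ Hx] [_ Hy]. now apply Hdiam.
  - rewrite sum_list_map. apply Rle_trans with (Rpower D s * expect s n f);
      [|rewrite Rmult_comm; apply Rle_div_r in Hexp; lra].
    unfold expect. rewrite <- sum_list_scal. apply sum_list_le. intros v Hv.
    apply in_words in Hv. destruct Hv as [_ Hv]. simpl. unfold radius.
    pose proof (weight_pos v). specialize (Hf0 v).
    assert (0 <= Rpower D s * (weight s v * f v)) by (repeat apply Rmult_le_pos; lra).
    destruct (Rle_dec 1 (f v)) as [Hfv|Hfv]; [|rewrite rpow_0; lra].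
    rewrite rpow_div_denom by assumption. rewrite <- (Rmult_1_r (weight s v)) at 1.
    apply Rmult_le_compat_l; [lra|]. apply Rmult_le_compat_l; lra.
Qed.

Lemma limit_set_null : 0 < s -> moran_sum s < 1 -> H_null s (limit_set F).
Proof.
  intros Hs Hmoran. apply H_null_of_expect_small; [exact Hs|]. intros eps Heps.
  pose proof moran_sum_nonneg.
  destruct (pow_lt_1_zero (moran_sum s) ltac:(rewrite Rabs_pos_eq; lra) eps Heps) as [n Hn].
  specialize (Hn n (le_n _)). exists n, (fun _ => 1). split; [intros; lra|split].
  - intros x Hx. destruct (limit_set_inv x Hx) as [w [Hw Hxw]]. exists w.
    split; [exact Hw|split; [exact Hxw|lra]].
  - rewrite expect_1. pose proof (Rle_abs (moran_sum s ^ n)). lra.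
Qed.

(** * Moran's equation *)

(* The relative mass of the cylinder [v] inside the cylinder [u]. *)
Fixpoint relative_weight (v u : list nat) {struct u} : R :=
  match u, v with
  | [], _ => weight s v
  | _ :: _, [] => 1
  | a :: u', b :: v' => if Nat.eqb a b then relative_weight v' u' else 0
  end.

Lemma relative_weight_nonneg v u : 0 <= relative_weight v u.
Proof.
  revert v. induction u as [|a u IH]; intros v; simpl; [left; apply weight_pos|].
  destruct v as [|b v]; [lra|]. destruct (Nat.eqb a b); [apply IH|lra].
Qed.

Lemma relative_weight_diag v : relative_weight v v = 1.
Proof. induction v as [|a v IH]; simpl; [reflexivity|]. now rewrite Nat.eqb_refl. Qed.

Lemma relative_weight_children v u : relative_weight v u < 1 ->
  \sum_(a < ifsN F) letter_weight s a * relative_weight v (u ++ [a]) <= relative_weight v u.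
Proof.
  revert v. induction u as [|a u IH]; intros [|b v]; simpl; try (intros; lra).
  - intros _. rewrite (sum_lt_ext _
      (fun a => if Nat.eqb a b then letter_weight s a * weight s v else 0)).
    + rewrite sum_lt_eqb. pose proof (weight_pos (b :: v)) as Hbv. simpl in Hbv.
      destruct (Nat.ltb b (ifsN F)); lra.
    + intros a _. destruct (Nat.eqb a b); ring.
  - destruct (Nat.eqb a b); [apply IH|]. intros _.
    rewrite sum_list_eq_0; [lra|intros; ring].
Qed.

Lemma extend_relative_weights_le (v : nat -> list nat) c u : 1 <= moran_sum s -> c < 1 ->
  (forall n, \sum_(i < n) relative_weight (v i) u <= c) ->
  exists a, (a < ifsN F)%nat /\ forall n, \sum_(i < n) relative_weight (v i) (u ++ [a]) <= c.
Proof.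
  intros Hmoran Hc Hu. apply NNPP. intros Hno.
  destruct (sums_common_length (fun a i => relative_weight (v i) (u ++ [a])) c (ifsN F))
    as [n Hn]; [intros; apply relative_weight_nonneg| |].
  { intros a Ha. apply NNPP. intros Hle. apply Hno. exists a. split; [exact Ha|].
    intros n. apply Rnot_lt_le. intros Hlt. apply Hle. now exists n. }
  assert (Hlt : forall i, relative_weight (v i) u < 1).
  { intros i. specialize (Hu (S i)). rewrite sum_lt_S in Hu.
    assert (0 <= \sum_(i < i) relative_weight (v i) u)
      by (apply sum_list_nonneg; intros; apply relative_weight_nonneg). lra. }
  assert (Hchildren : \sum_(a < ifsN F)
    letter_weight s a * (\sum_(i < n) relative_weight (v i) (u ++ [a])) <= c).
  { eapply Rle_trans; [|apply (Hu n)].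
    rewrite (sum_list_ext _ (fun a => \sum_(i < n)
      letter_weight s a * relative_weight (v i) (u ++ [a])))
      by (intros; now rewrite sum_list_scal).
    rewrite sum_list_swap. apply sum_list_le. intros i _. now apply relative_weight_children. }
  assert (Hstrict : c * moran_sum s < \sum_(a < ifsN F)
    letter_weight s a * (\sum_(i < n) relative_weight (v i) (u ++ [a]))).
  { unfold moran_sum. rewrite <- sum_list_scal. apply sum_lt_lt; [lia|]. intros a Ha.
    rewrite Rmult_comm. apply Rmult_lt_compat_l; [apply letter_weight_pos|now apply Hn]. }
  specialize (Hu 0%nat). simpl in Hu. nra.
Qed.

(* Choosing the letters one by one so that the total relative mass of the cylinders stays
   at most [c] replaces a compactness argument. *)
Lemma exists_word_avoiding_cylinders (v : nat -> list nat) c : 1 <= moran_sum s -> c < 1 ->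
  (forall n, \sum_(i < n) weight s (v i) <= c) ->
  exists w, valid_word F w /\ forall i, prefix w (length (v i)) <> v i.
Proof.
  intros Hmoran Hc Hsum.
  destruct (word_of_extensible (ifsN F)
    (fun u => forall n, \sum_(i < n) relative_weight (v i) u <= c)) as [w [Hw Hgood]].
  - exact Hsum.
  - intros u Hu. now apply extend_relative_weights_le.
  - exists w. split; [exact Hw|]. intros i Hi.
    specialize (Hgood (length (v i)) (S i)). rewrite Hi, sum_lt_S, relative_weight_diag in Hgood.
    assert (0 <= \sum_(j < i) relative_weight (v j) (v i))
      by (apply sum_list_nonneg; intros; apply relative_weight_nonneg). lra.
Qed.

Lemma weight_prefix_le_eventually w e : 0 < s -> valid_word F w -> 0 < e ->
  exists n, weight s (prefix w n) <= e.
Proof.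
  intros Hs Hw He. destruct (div_2_pow_lt_eventually 1 (Rpower e (/ s)) (Rpower_pos _ _)) as [n Hn].
  specialize (Hn n (le_n _)). exists n. rewrite weight_denom by now apply valid_prefix.
  pose proof (denom_prefix_ge_2_pow w n Hw) as Hq. assert (0 < 2 ^ n) by (apply pow_lt; lra).
  rewrite <- Rpower_inv_l by lra.
  replace e with (Rpower (Rpower e (/ s)) s)
    by (rewrite Rpower_mult, Rinv_l, Rpower_1 by lra; reflexivity).
  apply Rle_Rpower_l; [lra|]. split; [apply Rinv_0_lt_compat; lra|].
  assert (/ denom (prefix w n) <= / 2 ^ n) by (apply Rinv_le_contravar; lra).
  unfold Rdiv in Hn. lra.
Qed.

Lemma exists_prefix_of_scale D w d e : 0 < s -> 0 < D -> valid_word F w -> 0 <= d -> 0 < e ->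
  exists n, (forall l, (l < n)%nat -> d < D / denom (prefix w l)) /\
    weight s (prefix w n) <= Rpower D (- s) * rpow d s + e.
Proof.
  intros Hs HD Hw Hd He. pose proof (fun l => denom_prefix_pos w l Hw) as Hq.
  destruct (Req_dec d 0) as [->|Hne].
  - destruct (weight_prefix_le_eventually w e Hs Hw He) as [n Hn]. exists n.
    rewrite rpow_0. split; [intros l _; now apply Rdiv_lt_0_compat|lra].
  - destruct (exists_least_nat (fun n => D / denom (prefix w n) <= d)) as [n [Hn Hmin]].
    { destruct (div_2_pow_lt_eventually D d) as [n Hn]; [lra|]. exists n.
      specialize (Hn n (le_n _)). pose proof (denom_prefix_ge_2_pow w n Hw).
      eapply Rle_trans; [|left; exact Hn]. apply Rmult_le_compat_l; [lra|].
      apply Rinv_le_contravar; [apply pow_lt; lra|assumption]. }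
    exists n. split; [intros l Hl; apply Rnot_le_lt; now apply Hmin|].
    specialize (Hq n). apply Rle_div_l in Hn; [|exact Hq].
    rewrite weight_denom by now apply valid_prefix. rewrite rpow_Rpower by lra.
    rewrite <- Rpower_div_opp by lra.
    apply Rle_trans with (Rpower (D / d) (- s)); [|lra]. apply Rle_Rpower_opp_l; [lra|].
    split; [apply Rdiv_lt_0_compat; lra|apply Rle_div_l; lra].
Qed.

Lemma exists_cylinder_of_set D : 0 < s -> 0 < D ->
  (forall w w' n, valid_word F w -> valid_word F w' ->
     (forall i, (i < n)%nat -> w i = w' i) -> w n <> w' n ->
     D / denom (prefix w n) <= Rabs (coding_map w - coding_map w')) ->
  forall U d e, 0 < e -> diam_le U d -> exists v,
    (forall w, valid_word F w -> U (coding_map w) -> prefix w (length v) = v) /\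
    weight s v <= Rpower D (- s) * rpow d s + e.
Proof.
  intros Hs HD Hsep U d e He [Hd HU].
  pose proof (Rmult_le_pos _ _ (Rlt_le _ _ (Rpower_pos D (- s))) (rpow_nonneg d s)).
  destruct (classic (exists w, valid_word F w /\ U (coding_map w))) as [[w [Hw HUw]]|Hempty].
  - destruct (exists_prefix_of_scale D w d e Hs HD Hw Hd He) as [n [Hn Hweight]].
    exists (prefix w n). split; [|exact Hweight]. intros w' Hw' HUw'.
    rewrite length_prefix. apply prefix_eq_iff.
    destruct (first_difference w w' n) as [Hsame|[l [Hl [Hsame Hdiff]]]];
      [intros i Hi; symmetry; now apply Hsame|exfalso].
    specialize (Hsep w w' l Hw Hw' Hsame Hdiff). specialize (Hn l Hl).
    specialize (HU _ _ HUw HUw'). lra.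
  - assert (Hzero : valid_word F (fun _ => 0%nat)) by (intros i; lia).
    destruct (weight_prefix_le_eventually _ e Hs Hzero He) as [n Hn].
    exists (prefix (fun _ => 0%nat) n). split; [|lra].
    intros w Hw HUw. destruct Hempty. now exists w.
Qed.

Lemma limit_set_not_null : 0 < s -> 1 <= moran_sum s -> ~ H_null s (limit_set F).
Proof.
  intros Hs Hmoran Hnull. destruct coding_map_separated as [D [HD Hsep]].
  set (C := Rpower D (- s)). assert (HC : 0 < C) by apply Rpower_pos.
  destruct (Hnull 1 (/ (4 * C))) as [U [d [HU [Hd Hsum]]]]; [lra|apply Rinv_0_lt_compat; lra|].
  destruct (constructive_indefinite_descr_fun_choice (@constructive_indefinite_description)
    (fun (i : nat) (v : list nat) =>
      (forall w, valid_word F w -> U i (coding_map w) -> prefix w (length v) = v) /\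
      weight s v <= C * rpow (d i) s + / 4 * (/ 2) ^ S i)) as [v Hv].
  { intros i. destruct (Hd i) as [[Hdi _] Hdiam].
    apply exists_cylinder_of_set; [exact Hs|exact HD|exact Hsep| |now split].
    apply Rmult_lt_0_compat; [lra|apply pow_lt; lra]. }
  destruct (exists_word_avoiding_cylinders v (1 / 2) Hmoran) as [w [Hw Hmiss]]; [lra| |].
  - intros n. apply Rle_trans with (\sum_(i < n) (C * rpow (d i) s + / 4 * (/ 2) ^ S i));
      [apply sum_list_le; intros i _; apply (Hv i)|].
    rewrite sum_list_plus, sum_list_scal. pose proof (sum_lt_half_pow_S_le (/ 4) n ltac:(lra)).
    assert (Hdn : \sum_(i < n) rpow (d i) s <= / (4 * C)).
    { eapply Rle_trans; [|apply (Hsum n)]. rewrite sum_f_R0_sum_lt.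
      apply sum_lt_mono; [intros; apply rpow_nonneg|lia]. }
    apply (Rmult_le_compat_l C) in Hdn; [|lra].
    replace (C * / (4 * C)) with (/ 4) in Hdn by (field; lra). lra.
  - destruct (HU (coding_map w)) as [i Hi]; [now apply limit_set_coding_map|].
    apply (Hmiss i). now apply (Hv i).
Qed.

End FixedExponent.

Lemma moran_sum_le_add M s h : 0 <= h ->
  (forall a, (a < ifsN F)%nat -> INR (ifsq F a) <= M) ->
  Rpower M (- h) * moran_sum s <= moran_sum (s + h).
Proof.
  intros Hh HM. unfold moran_sum. rewrite <- sum_list_scal. apply sum_lt_le. intros a Ha.
  unfold letter_weight. replace (- (s + h)) with (- h + - s) by ring. rewrite Rpower_plus.
  apply Rmult_le_compat_r; [left; apply Rpower_pos|].
  pose proof (INR_q_ge_2 a Ha). apply Rle_Rpower_opp_l; [exact Hh|]. split; [lra|auto].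
Qed.

Lemma q_bounded : exists M, 1 < M /\ forall a, (a < ifsN F)%nat -> INR (ifsq F a) <= M.
Proof.
  destruct (bounded_below_nat (ifsq F) (ifsN F)) as [M HM]. exists (INR M + 2).
  pose proof (pos_INR M). split; [lra|]. intros a Ha. specialize (HM a Ha).
  apply le_INR in HM. lra.
Qed.

(* Since [moran_sum] is continuous, a value other than 1 at the dimension would make the
   limit set null slightly below it or not null slightly above it. *)
Lemma moran_sum_le_1_of_dim delta : hausdorff_dim (limit_set F) delta ->
  0 <= delta -> moran_sum delta <= 1.
Proof.
  intros [_ Hglb] Hdelta. apply Rnot_lt_le. intros Hgt.
  destruct q_bounded as [M [HM HqM]]. pose proof (ln_pos M HM). pose proof (ln_pos _ Hgt).
  set (h := ln (moran_sum delta) / ln M).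
  assert (Hh : 0 < h) by (apply Rdiv_lt_0_compat; lra).
  assert (Hmoran : 1 <= moran_sum (delta + h)).
  { eapply Rle_trans; [|apply (moran_sum_le_add M delta h); [lra|exact HqM]].
    rewrite <- (exp_ln (moran_sum delta)) at 1 by lra. unfold Rpower.
    rewrite <- exp_plus, <- exp_0. apply exp_le. right. unfold h. field. lra. }
  apply (limit_set_not_null (delta + h)); [lra|exact Hmoran|].
  apply NNPP. intros Hnot. apply (Rlt_not_le (delta + h) delta); [lra|].
  apply Hglb. intros s [_ Hs]. apply Rnot_lt_le. intros Hlt. apply Hnot.
  apply (H_null_le s); [lra|exact Hs].
Qed.

Lemma moran_sum_0 : moran_sum 0 = INR (ifsN F).
Proof.
  unfold moran_sum. rewrite (sum_lt_ext _ (fun _ => 1)), sum_lt_const; [ring|].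
  intros a Ha. unfold letter_weight. rewrite Ropp_0. apply Rpower_O.
  pose proof (INR_q_ge_2 a Ha). lra.
Qed.

Lemma dim_pos delta : hausdorff_dim (limit_set F) delta -> 0 < delta.
Proof.
  intros Hdim. assert (Hdelta : 0 <= delta) by (apply Hdim; intros s [Hs _]; exact Hs).
  destruct Hdelta as [Hdelta|<-]; [exact Hdelta|exfalso].
  pose proof (moran_sum_le_1_of_dim 0 Hdim (Rle_refl 0)) as Hle. rewrite moran_sum_0 in Hle.
  pose proof (le_INR _ _ two_letters) as HN. simpl in HN. lra.
Qed.

Lemma moran_sum_ge_1_of_dim delta : hausdorff_dim (limit_set F) delta -> 1 <= moran_sum delta.
Proof.
  intros Hdim. pose proof (dim_pos delta Hdim) as Hdelta.
  apply Rnot_lt_le. intros Hlt. destruct q_bounded as [M [HM HqM]]. pose proof (ln_pos M HM).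
  assert (Hmoran : 0 < moran_sum delta).
  { apply Rlt_le_trans with (Rpower M (- delta) * moran_sum 0).
    - rewrite moran_sum_0. apply Rmult_lt_0_compat; [apply Rpower_pos|apply lt_0_INR; lia].
    - rewrite <- (Rplus_0_l delta) at 2. apply moran_sum_le_add; [lra|exact HqM]. }
  assert (Hln : ln (moran_sum delta) < 0) by (rewrite <- ln_1; now apply ln_increasing).
  set (h := Rmin (delta / 2) (- ln (moran_sum delta) / (2 * ln M))).
  assert (Hh : 0 < h) by (apply Rmin_glb_lt; [lra|apply Rdiv_lt_0_compat; lra]).
  assert (Hh1 : h <= delta / 2) by apply Rmin_l.
  assert (Hh2 : h <= - ln (moran_sum delta) / (2 * ln M)) by apply Rmin_r.
  apply (Rlt_not_le delta (delta - h)); [lra|]. apply Hdim. split; [lra|].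
  apply limit_set_null; [lra|].
  pose proof (moran_sum_le_add M (delta - h) h ltac:(lra) HqM) as Hle.
  replace (delta - h + h) with delta in Hle by ring. rewrite Rpower_Ropp in Hle.
  pose proof (Rpower_pos M h). apply Rmult_lt_reg_l with (/ Rpower M h);
    [now apply Rinv_0_lt_compat|].
  rewrite Rmult_1_r, <- Rpower_Ropp. rewrite <- Rpower_Ropp in Hle.
  eapply Rle_lt_trans; [exact Hle|]. rewrite <- (exp_ln (moran_sum delta)) by exact Hmoran.
  apply exp_increasing. apply Rle_div_r in Hh2; nra.
Qed.

Lemma moran_sum_dim delta : hausdorff_dim (limit_set F) delta -> moran_sum delta = 1.
Proof.
  intros Hdim. apply Rle_antisym; [|now apply moran_sum_ge_1_of_dim].
  apply moran_sum_le_1_of_dim; [exact Hdim|left; now apply dim_pos].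
Qed.


(** * Rational points of the limit set *)

Definition periodic_point (v : list nat) (n : nat) : R := coding_map (loop_word v n).

Definition periodic_denom (v : list nat) (n : nat) : R :=
  IZR (q_int F (loop_word v n) n (length v - n)).

Definition eventually_periodic_point (x : R) : Prop :=
  exists v n, valid_list F v /\ (n < length v)%nat /\ x = periodic_point v n.

Lemma periodic_point_prefix w n m : (1 <= m)%nat -> periodic_from w n m ->
  periodic_point (prefix w (n + m)) n = coding_map w.
Proof. intros Hm Hper. unfold periodic_point. now rewrite loop_word_prefix. Qed.

Lemma periodic_denom_prefix w n m : (1 <= m)%nat -> periodic_from w n m ->
  periodic_denom (prefix w (n + m)) n = IZR (q_int F w n m).
Proof.
  intros Hm Hper. unfold periodic_denom. rewrite loop_word_prefix, length_prefix by assumption.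
  now replace (n + m - n)%nat with m by lia.
Qed.

Lemma IZR_prodZ_q w n : IZR (prodZ (fun i => Z.of_nat (ifsq F (w i))) n) = denom (prefix w n).
Proof.
  induction n as [|n IH]; [reflexivity|]. rewrite denom_prefix_S.
  simpl. now rewrite mult_IZR, IH, <- INR_IZR_INZ.
Qed.

Lemma IZR_prodZ_p_bounds w n : valid_word F w ->
  -1 <= IZR (prodZ (fun i => ifsp F (w i)) n) <= 1.
Proof.
  intros Hw. induction n as [|n IH]; simpl; [lra|].
  rewrite mult_IZR. destruct (p_sign (w n) (Hw n)) as [-> | ->]; lra.
Qed.

Lemma denom_prefix_ge_2 w m : valid_word F w -> (1 <= m)%nat -> 2 <= denom (prefix w m).
Proof.
  intros Hw Hm. eapply Rle_trans; [|now apply denom_prefix_ge_2_pow].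
  replace 2 with (2 ^ 1) at 1 by ring. apply Rle_pow; [lra|exact Hm].
Qed.

Lemma q_int_bounds w n m : valid_word F w -> (1 <= m)%nat ->
  denom (prefix w (n + m)) / 2 <= IZR (q_int F w n m) <= 2 * denom (prefix w (n + m)).
Proof.
  intros Hw Hm. pose proof (valid_shift F w n Hw) as Hs.
  unfold q_int. rewrite mult_IZR, minus_IZR, prefix_add, denom_app.
  change (fun i => Z.of_nat (ifsq F (w (n + i)%nat)))
    with (fun i => Z.of_nat (ifsq F (shift n w i))).
  change (fun i => ifsp F (w (n + i)%nat)) with (fun i => ifsp F (shift n w i)).
  rewrite !IZR_prodZ_q. pose proof (IZR_prodZ_p_bounds (shift n w) m Hs).
  pose proof (denom_prefix_pos w n Hw). pose proof (denom_prefix_ge_2 _ m Hs Hm).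
  split; nra.
Qed.

Lemma periodic_denom_bounds v n : valid_list F v -> (n < length v)%nat ->
  denom v / 2 <= periodic_denom v n <= 2 * denom v.
Proof.
  intros Hv Hn.
  pose proof (q_int_bounds _ n (length v - n) (valid_loop_word F v n Hv Hn) ltac:(lia)) as Hq.
  replace (n + (length v - n))%nat with (length v) in Hq by lia.
  now rewrite prefix_loop_word in Hq.
Qed.

Lemma comp_affine w n : valid_word F w -> exists P S Q : Z,
  IZR Q = denom (prefix w n) /\ -1 <= IZR P <= 1 /\
  forall x, comp F w n x = (IZR P * x + IZR S) / IZR Q.
Proof.
  intros Hw. induction n as [|n [P [S [Q [HQ [HP Hcomp]]]]]].
  - exists 1%Z, 0%Z, 1%Z. split; [reflexivity|split; [lra|]]. intros x. simpl. field.
  - exists (P * ifsp F (w n))%Z,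
      (P * ifsr F (w n) + S * Z.of_nat (ifsq F (w n)))%Z, (Q * Z.of_nat (ifsq F (w n)))%Z.
    split; [|split].
    + now rewrite mult_IZR, <- INR_IZR_INZ, HQ, denom_prefix_S.
    + rewrite mult_IZR. destruct (p_sign (w n) (Hw n)) as [-> | ->]; lra.
    + intros x. simpl. rewrite Hcomp. unfold u.
      rewrite !mult_IZR, plus_IZR, !mult_IZR, <- !INR_IZR_INZ.
      pose proof (INR_q_ge_2 (w n) (Hw n)). pose proof (denom_prefix_pos w n Hw).
      field. lra.
Qed.

Lemma is_rational_fixed_point w m : valid_word F w -> (1 <= m)%nat -> shift m w = w ->
  is_rational (coding_map w).
Proof.
  intros Hw Hm Hfix. destruct (comp_affine w m Hw) as [P [S [Q [HQ [HP Hcomp]]]]].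
  pose proof (coding_map_comp w m Hw) as Hx. rewrite Hfix, Hcomp in Hx.
  pose proof (denom_prefix_ge_2 w m Hw Hm) as HQ2. rewrite <- HQ in HQ2.
  exists S, (Q - P)%Z. rewrite minus_IZR. split.
  - intros Heq0. apply (f_equal IZR) in Heq0. rewrite minus_IZR in Heq0. lra.
  - apply Rmult_eq_reg_r with (IZR Q - IZR P); [|lra].
    replace (IZR S / (IZR Q - IZR P) * (IZR Q - IZR P)) with (IZR S) by (field; lra).
    apply (f_equal (fun y => y * IZR Q)) in Hx.
    replace ((IZR P * coding_map w + IZR S) / IZR Q * IZR Q) with
      (IZR P * coding_map w + IZR S) in Hx by (field; lra).
    lra.
Qed.

Lemma is_rational_comp w n y : valid_word F w -> is_rational y -> is_rational (comp F w n y).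
Proof.
  intros Hw [a [b [Hb ->]]]. destruct (comp_affine w n Hw) as [P [S [Q [HQ [_ Hcomp]]]]].
  pose proof (denom_prefix_pos w n Hw) as HQ0. rewrite <- HQ in HQ0. apply not_0_IZR in Hb.
  exists (P * a + S * b)%Z, (Q * b)%Z. split.
  - intros Heq0. apply (f_equal IZR) in Heq0. rewrite mult_IZR in Heq0.
    apply Rmult_integral in Heq0. lra.
  - rewrite Hcomp, plus_IZR, !mult_IZR. field. lra.
Qed.

Lemma is_rational_periodic w n m : valid_word F w -> (1 <= m)%nat -> periodic_from w n m ->
  is_rational (coding_map w).
Proof.
  intros Hw Hm Hper. rewrite (coding_map_comp w n Hw). apply is_rational_comp; [exact Hw|].
  apply (is_rational_fixed_point _ m); [now apply valid_shift|exact Hm|].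
  apply functional_extensionality. intros i. unfold shift.
  replace (n + (m + i))%nat with (n + i + m)%nat by lia. apply Hper. lia.
Qed.

Definition loop_codes (k : nat) : list (list nat * nat) :=
  list_prod (words (ifsN F) k) (seq 0 k).

Lemma in_loop_codes v n : valid_list F v -> (n < length v)%nat ->
  In (v, n) (loop_codes (length v)).
Proof. intros Hv Hn. apply in_prod; [now apply in_words|apply in_seq; lia]. Qed.

Lemma loop_codes_inv k v n : In (v, n) (loop_codes k) ->
  length v = k /\ valid_list F v /\ (n < k)%nat.
Proof.
  intros Hin. apply in_prod_iff in Hin. rewrite in_words, in_seq in Hin.
  destruct Hin as [[Hl Hv] Hn]. repeat split; [exact Hl|exact Hv|lia].
Qed.

Lemma eventually_periodic_points_null s : 0 < s -> H_null s eventually_periodic_point.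
Proof.
  intros Hs. apply H_null_of_list_covers; [exact Hs|]. intros eps Heps.
  exists (fun k => map (fun vn => (eq (periodic_point (fst vn) (snd vn)), 0)) (loop_codes k)).
  split; [|split].
  - intros x [v [n [Hv [Hn Hx]]]]. exists (length v). eexists.
    split; [apply in_map, (in_loop_codes v n Hv Hn)|now symmetry].
  - intros k Ud Hin. apply in_map_iff in Hin. destruct Hin as [vn [<- _]].
    split; [simpl; lra|]. intros x y <- <-. rewrite Rminus_diag, Rabs_R0. simpl. lra.
  - intros n. rewrite sum_list_eq_0; [lra|]. intros k _. rewrite sum_list_map.
    apply sum_list_eq_0. intros vn _. apply rpow_0.
Qed.

Lemma uniform_on_short_loops (P : list nat -> nat -> R -> Prop) k :
  (forall v n e e', 0 < e' <= e -> P v n e -> P v n e') ->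
  (forall v n, valid_list F v -> (n < length v)%nat -> exists e, 0 < e /\ P v n e) ->
  exists e, 0 < e /\
    forall v n, valid_list F v -> (n < length v)%nat -> (length v < k)%nat -> P v n e.
Proof.
  intros Hmono HP.
  destruct (uniform_on_list (fun vn => P (fst vn) (snd vn)) (flat_map loop_codes (seq 0 k)))
    as [e [He Hall]].
  - intros vn. apply Hmono.
  - intros [v n] Hin. apply in_flat_map in Hin. destruct Hin as [l [_ Hin]].
    apply loop_codes_inv in Hin. destruct Hin as [<- [Hv Hn]]. now apply HP.
  - exists e. split; [exact He|]. intros v n Hv Hn Hl. apply (Hall (v, n)).
    apply in_flat_map. exists (length v). split; [apply in_seq; lia|now apply in_loop_codes].
Qed.

Lemma dist_periodic_point_pos x v n : ~ eventually_periodic_point x ->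
  valid_list F v -> (n < length v)%nat -> 0 < Rabs (x - periodic_point v n).
Proof.
  intros Hx Hv Hn. apply Rabs_pos_lt. intros Heq0. apply Hx. exists v, n.
  split; [exact Hv|split; [exact Hn|lra]].
Qed.

(** * The convergence part *)

Section Convergence.

Variables (psi : R -> R) (q0 s : R).

Hypothesis psi_pos : forall q, q0 <= q -> 0 < psi q.
Hypothesis psi_nonincreasing : forall x y, q0 <= x -> x <= y -> psi y <= psi x.
Hypothesis s_pos : 0 < s.

Definition target_radius (v : list nat) (n : nat) : R :=
  psi (periodic_denom v n) / periodic_denom v n.

Lemma target_radius_pos v n : valid_list F v -> (n < length v)%nat ->
  q0 <= 2 ^ (length v - 1) -> 0 < target_radius v n.
Proof.
  intros Hv Hn Hq0. pose proof (periodic_denom_bounds v n Hv Hn).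
  pose proof (denom_ge_2_pow v Hv) as Hd. replace (length v) with (S (length v - 1)) in Hd by lia.
  simpl in Hd. assert (0 < 2 ^ (length v - 1)) by (apply pow_lt; lra).
  apply Rdiv_lt_0_compat; [apply psi_pos; lra|lra].
Qed.

Lemma target_radius_pow_le v n : valid_list F v -> (n < length v)%nat ->
  q0 <= 2 ^ (length v - 1) ->
  rpow (2 * target_radius v n) s <=
  Rpower 4 s * Rpower (psi (2 ^ (length v - 1))) s * weight s v.
Proof.
  intros Hv Hn Hq0. pose proof (target_radius_pos v n Hv Hn Hq0) as Hr.
  pose proof (psi_pos _ Hq0) as Hpsi. pose proof (periodic_denom_bounds v n Hv Hn) as Hpd.
  pose proof (denom_ge_2_pow v Hv) as Hd. replace (length v) with (S (length v - 1)) in Hd by lia.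
  simpl in Hd. assert (0 < 2 ^ (length v - 1)) by (apply pow_lt; lra).
  pose proof (Rinv_0_lt_compat (denom v) ltac:(lra)).
  rewrite rpow_Rpower, weight_denom, <- Rpower_inv_l by (exact Hv || lra).
  rewrite !Rpower_mult_distr by nra. apply Rle_Rpower_l; [lra|split; [lra|]].
  assert (Hinv : / periodic_denom v n <= 2 * / denom v).
  { replace (2 * / denom v) with (/ (denom v / 2)) by (field; lra).
    apply Rinv_le_contravar; lra. }
  assert (Hle : psi (periodic_denom v n) <= psi (2 ^ (length v - 1)))
    by (apply psi_nonincreasing; lra).
  pose proof (psi_pos (periodic_denom v n) ltac:(lra)).
  unfold target_radius, Rdiv. nra.
Qed.

(* The finitely many rational points of short period, where [psi] need not even be positive,
   are kept away from [x] by shrinking [eps]. *)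
Lemma badly_symb_approx_of_no_long_hit x k : ~ eventually_periodic_point x ->
  (forall v n, valid_list F v -> (n < length v)%nat -> (k <= length v)%nat ->
     target_radius v n <= Rabs (x - periodic_point v n)) ->
  badly_symb_approx F psi x.
Proof.
  intros Hx Hlong.
  destruct (uniform_on_short_loops
    (fun v n e => e * target_radius v n <= Rabs (x - periodic_point v n)) k) as [e [He Hshort]].
  - intros v n e e' He Hle. pose proof (Rabs_pos (x - periodic_point v n)).
    destruct (Rle_lt_dec 0 (target_radius v n)); nra.
  - intros v n Hv Hn. pose proof (dist_periodic_point_pos x v n Hx Hv Hn) as Hdist.
    set (d := Rabs (x - periodic_point v n)) in *. set (r := target_radius v n).
    pose proof (Rabs_pos r). pose proof (Rle_abs r).
    exists (d / (1 + Rabs r)). split; [apply Rdiv_lt_0_compat; lra|].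
    replace (d / (1 + Rabs r) * r) with (d * (r / (1 + Rabs r))) by (field; lra).
    assert (r / (1 + Rabs r) <= 1) by (apply Rle_div_l; lra). nra.
  - exists (Rmin e 1). pose proof (Rmin_glb_lt e 1 0 He Rlt_0_1) as Hmin.
    split; [exact Hmin|]. intros y w n m _ _ Hw Hy [Hm [Hper _]].
    apply coding_unique in Hy; [|exact Hw].
    rewrite Hy, <- (periodic_point_prefix w n m Hm Hper), <- (periodic_denom_prefix w n m Hm Hper).
    pose proof (valid_prefix F w (n + m) Hw) as Hv. pose proof (length_prefix w (n + m)) as Hl.
    set (v := prefix w (n + m)) in *. unfold Rdiv. rewrite Rmult_assoc.
    change (psi _ * / _) with (target_radius v n).
    apply Rle_ge. pose proof (Rabs_pos (x - periodic_point v n)).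
    pose proof (Rmin_l e 1). pose proof (Rmin_r e 1).
    destruct (Nat.lt_ge_cases (length v) k) as [Hlk|Hkl].
    + specialize (Hshort v n Hv ltac:(lia) Hlk). destruct (Rle_lt_dec 0 (target_radius v n)); nra.
    + specialize (Hlong v n Hv ltac:(lia) Hkl). destruct (Rle_lt_dec 0 (target_radius v n)); nra.
Qed.

Lemma target_cover_cost_le k : (1 <= k)%nat -> q0 <= 2 ^ (k - 1) -> moran_sum s <= 1 ->
  \sum_(vn <- loop_codes k) rpow (2 * target_radius (fst vn) (snd vn)) s <=
  Rpower 4 s * (INR k * Rpower (psi (2 ^ (k - 1))) s).
Proof.
  intros Hk Hq0 Hmoran. set (c := Rpower 4 s * Rpower (psi (2 ^ (k - 1))) s).
  assert (Hc : 0 < c) by (apply Rmult_lt_0_compat; apply Rpower_pos).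
  apply Rle_trans with (\sum_(vn <- loop_codes k) c * weight s (fst vn)).
  - apply sum_list_le. intros [v n] Hin. apply loop_codes_inv in Hin.
    destruct Hin as [Hl [Hv Hn]]. unfold c. rewrite <- Hl in *.
    now apply target_radius_pow_le.
  - unfold loop_codes. rewrite list_prod_as_flat_map, sum_list_flat_map.
    rewrite (sum_list_ext _ (fun v => INR k * c * (weight s v * 1))).
    + rewrite sum_list_scal. fold (expect s k (fun _ => 1)). rewrite expect_1.
      pose proof (moran_sum_nonneg s).
      assert (moran_sum s ^ k <= 1) by (rewrite <- (pow1 k); apply pow_incr; lra).
      pose proof (Rmult_le_pos _ _ (pos_INR k) (Rlt_le _ _ Hc)).
      apply Rle_trans with (INR k * c * 1); [apply Rmult_le_compat_l; lra|].
      right. unfold c. ring.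
    + intros v _. rewrite sum_list_map. simpl. rewrite sum_lt_const. ring.
Qed.

Lemma badly_symb_approx_ae : moran_sum s <= 1 ->
  (forall eps, 0 < eps -> exists K, q0 <= 2 ^ K /\
     forall n, \sum_(j < n) INR (S (K + j)) * Rpower (psi (2 ^ (K + j))) s <= eps) ->
  mu_ae F s (badly_symb_approx F psi).
Proof.
  intros Hmoran Hsmall.
  apply (H_null_of_null_diff s _ eventually_periodic_point s_pos);
    [now apply eventually_periodic_points_null|].
  apply H_null_of_list_covers; [exact s_pos|]. intros eps Heps.
  destruct (Hsmall (eps / Rpower 4 s)) as [K [HK Hsum]];
    [apply Rdiv_lt_0_compat; [exact Heps|apply Rpower_pos]|].
  assert (Hq0 : forall j, q0 <= 2 ^ (S (K + j) - 1)).
  { intros j. eapply Rle_trans; [exact HK|]. apply Rle_pow; [lra|lia]. }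
  exists (fun j => map (fun vn => ((fun x => Rabs (x - periodic_point (fst vn) (snd vn))
    < target_radius (fst vn) (snd vn)), 2 * target_radius (fst vn) (snd vn)))
    (loop_codes (S (K + j)))).
  split; [|split].
  - intros x [[_ Hnot] Hx]. apply NNPP. intros Hmiss. apply Hnot.
    apply (badly_symb_approx_of_no_long_hit x (S K) Hx). intros v n Hv Hn Hl.
    apply Rnot_lt_le. intros Hhit. apply Hmiss. exists (length v - S K)%nat.
    replace (S (K + (length v - S K))) with (length v) by lia. eexists.
    split; [apply in_map, (in_loop_codes v n Hv Hn)|exact Hhit].
  - intros j Ud Hin. apply in_map_iff in Hin. destruct Hin as [[v n] [<- Hin]].
    apply loop_codes_inv in Hin. destruct Hin as [Hl [Hv Hn]].
    apply diam_le_ball. left. apply target_radius_pos; [exact Hv|simpl; lia|].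
    simpl. rewrite Hl. apply Hq0.
  - intros n. specialize (Hsum n). apply Rle_div_r in Hsum; [|apply Rpower_pos].
    eapply Rle_trans; [|exact Hsum]. rewrite Rmult_comm, <- sum_list_scal.
    apply sum_list_le. intros j _. rewrite sum_list_map. simpl fst. simpl snd.
    eapply Rle_trans; [apply target_cover_cost_le; [lia|apply Hq0|exact Hmoran]|].
    simpl Nat.sub. rewrite Nat.sub_0_r. lra.
Qed.

End Convergence.

(** * Repetitions in random words *)

Definition indicator (b : bool) : R := if b then 1 else 0.

(* The shortest prefix of [z] with denominator at least [t], or [z] if there is none. *)
Fixpoint cut (t : R) (z : list nat) : list nat :=
  match z with
  | [] => []
  | a :: z' => if Rle_dec t 1 then [] else a :: cut (t / INR (ifsq F a)) z'
  end.

Definition count_occurrences (t : R) (L : nat) (f z : list nat) : R :=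
  \sum_(i < L) indicator (is_prefix (cut t z) (skipn i f)).

Fixpoint block_sum (g : list nat -> R) (l B : nat) (v : list nat) : R :=
  match B with
  | O => 0
  | S B' => g (firstn l v) + block_sum g l B' (skipn l v)
  end.

(* The first [L + l] letters of [v] are the text; each of the [B] blocks of length [l] that
   follow is cut and looked up in the text. *)
Definition stage_hits (t : R) (L l B : nat) (v : list nat) : R :=
  block_sum (count_occurrences t L (firstn (L + l) v)) l B (skipn (L + l) v).

Definition no_hit (t : R) (L l B : nat) (v : list nat) : R :=
  if Req_EM_T (stage_hits t L l B v) 0 then 1 else 0.

Lemma indicator_bounds b : 0 <= indicator b <= 1.
Proof. destruct b; simpl; lra. Qed.

Lemma count_occurrences_nonneg t L f z : 0 <= count_occurrences t L f z.
Proof. apply sum_list_nonneg. intros. apply indicator_bounds. Qed.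

Lemma no_hit_cases t L l B v : no_hit t L l B v = 0 \/ no_hit t L l B v = 1.
Proof. unfold no_hit. destruct (Req_EM_T _ _); auto. Qed.

Lemma cut_le_1 t z : t <= 1 -> cut t z = [].
Proof. intros Ht. destruct z as [|a z]; simpl; [reflexivity|]. now destruct (Rle_dec t 1). Qed.

Lemma valid_cut t z : valid_list F z -> valid_list F (cut t z).
Proof.
  intros Hz. revert t. induction Hz as [|a z Ha Hz IH]; intros t; simpl; [constructor|].
  destruct (Rle_dec t 1); [constructor|constructor; [exact Ha|apply IH]].
Qed.

Lemma length_cut_le t z : (length (cut t z) <= length z)%nat.
Proof.
  revert t. induction z as [|a z IH]; intros t; simpl; [lia|].
  destruct (Rle_dec t 1); simpl; [lia|]. specialize (IH (t / INR (ifsq F a))). lia.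
Qed.

Lemma is_prefix_cut t z : is_prefix (cut t z) z = true.
Proof.
  revert t. induction z as [|a z IH]; intros t; simpl; [reflexivity|].
  destruct (Rle_dec t 1); simpl; [reflexivity|]. now rewrite Nat.eqb_refl, IH.
Qed.

Lemma div_q_le_2_pow t a n : (a < ifsN F)%nat -> t <= 2 ^ S n -> t / INR (ifsq F a) <= 2 ^ n.
Proof.
  intros Ha Ht. pose proof (INR_q_ge_2 a Ha). apply Rle_div_l; [lra|]. simpl in Ht.
  assert (0 < 2 ^ n) by (apply pow_lt; lra). nra.
Qed.

Lemma denom_cut_ge t z : valid_list F z -> t <= 2 ^ length z -> t <= denom (cut t z).
Proof.
  intros Hz. revert t. induction Hz as [|a z Ha Hz IH]; intros t Ht; [exact Ht|]. simpl.
  destruct (Rle_dec t 1) as [Ht1|Ht1]; [exact Ht1|]. simpl.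
  specialize (IH _ (div_q_le_2_pow t a _ Ha Ht)). pose proof (INR_q_ge_2 a Ha).
  apply Rle_div_l in IH; lra.
Qed.

Lemma denom_cut_le M t z : (forall a, (a < ifsN F)%nat -> INR (ifsq F a) <= M) -> 1 <= M ->
  valid_list F z -> 1 <= t -> denom (cut t z) <= M * t.
Proof.
  intros HqM HM Hz. revert t. induction Hz as [|a z Ha Hz IH]; intros t Ht; simpl; [nra|].
  destruct (Rle_dec t 1) as [Ht1|Ht1]; simpl; [nra|].
  pose proof (INR_q_ge_2 a Ha). specialize (HqM a Ha).
  destruct (Rle_dec (t / INR (ifsq F a)) 1) as [Hta|Hta].
  - rewrite cut_le_1 by exact Hta. simpl. nra.
  - replace (M * t) with (INR (ifsq F a) * (M * (t / INR (ifsq F a)))) by (field; lra).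
    apply Rmult_le_compat_l; [lra|]. apply IH. lra.
Qed.

Lemma cut_eq_of_is_prefix t z y : valid_list F z -> t <= 2 ^ length z ->
  is_prefix (cut t z) y = true -> cut t y = cut t z.
Proof.
  intros Hz. revert t y. induction Hz as [|a z Ha Hz IH]; intros t y Ht;
    [intros _; now rewrite !cut_le_1|].
  simpl. destruct (Rle_dec t 1) as [Ht1|Ht1]; [intros _; now apply cut_le_1|].
  destruct y as [|b y]; simpl; [discriminate|]. intros Hpre. apply andb_prop in Hpre.
  destruct Hpre as [Hab Hpre]. apply Nat.eqb_eq in Hab. subst b.
  destruct (Rle_dec t 1) as [Ht1'|_]; [contradiction|]. f_equal.
  apply IH; [now apply div_q_le_2_pow|exact Hpre].
Qed.

Section Moments.

Variables (s M : R).

Hypothesis s_pos : 0 < s.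
Hypothesis moran_eq_1 : moran_sum s = 1.
Hypothesis M_ge_1 : 1 <= M.
Hypothesis q_le_M : forall a, (a < ifsN F)%nat -> INR (ifsq F a) <= M.

Definition decay : R := Rpower 2 (- s).

Lemma decay_bounds : 0 < decay < 1.
Proof.
  split; [apply Rpower_pos|]. unfold decay. rewrite <- (Rpower_O 2) by lra.
  apply Rpower_lt; lra.
Qed.

Lemma expect_const n c : expect s n (fun _ => c) = c.
Proof.
  rewrite (expect_ext s n _ (fun _ => c * 1)) by (intros; ring).
  rewrite expect_scal, expect_1, moran_eq_1, pow1. ring.
Qed.

Lemma expect_le_const n f c : (forall v, length v = n -> valid_list F v -> f v <= c) ->
  expect s n f <= c.
Proof. intros Hf. rewrite <- (expect_const n c). now apply expect_le. Qed.

Lemma expect_ge_const n f c : (forall v, length v = n -> valid_list F v -> c <= f v) ->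
  c <= expect s n f.
Proof. intros Hf. rewrite <- (expect_const n c). now apply expect_le. Qed.

Lemma expect_skipn i n h : expect s (i + n) (fun f => h (skipn i f)) = expect s n h.
Proof.
  rewrite expect_app. transitivity (expect s i (fun _ => expect s n h)); [|apply expect_const].
  apply expect_ext. intros u Hu _. apply expect_ext. intros v _ _.
  now rewrite <- Hu, skipn_app_length.
Qed.

Lemma expect_is_prefix_nil n : expect s n (fun v => indicator (is_prefix [] v)) = 1.
Proof. apply (expect_const n 1). Qed.

Lemma expect_is_prefix_cons n b c : expect s (S n) (fun v => indicator (is_prefix (b :: c) v)) =
  if Nat.ltb b (ifsN F)
  then letter_weight s b * expect s n (fun v => indicator (is_prefix c v)) else 0.
Proof.
  rewrite expect_S, <- (sum_lt_eqb (fun a =>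
    letter_weight s a * expect s n (fun v => indicator (is_prefix c v)))).
  apply sum_list_ext. intros a _. simpl. destruct (Nat.eqb a b); [reflexivity|].
  rewrite (expect_const n 0 : expect s n (fun v => indicator (false && is_prefix c v)) = 0).
  ring.
Qed.

Lemma expect_is_prefix_le n c : expect s n (fun v => indicator (is_prefix c v)) <= weight s c.
Proof.
  revert c. induction n as [|n IH]; intros [|b c];
    try (rewrite expect_is_prefix_nil; simpl; lra).
  - rewrite expect_0. simpl. left. apply (weight_pos s (b :: c)).
  - rewrite expect_is_prefix_cons. pose proof (weight_pos s (b :: c)).
    destruct (Nat.ltb b (ifsN F)); [|lra]. simpl.
    apply Rmult_le_compat_l; [left; apply letter_weight_pos|apply IH].
Qed.

Lemma expect_is_prefix n c : valid_list F c -> (length c <= n)%nat ->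
  expect s n (fun v => indicator (is_prefix c v)) = weight s c.
Proof.
  intros Hc. revert n. induction Hc as [|b c Hb Hc IH]; intros n Hn;
    [apply expect_is_prefix_nil|].
  destruct n as [|n]; [inversion Hn|]. rewrite expect_is_prefix_cons.
  apply Nat.ltb_lt in Hb. rewrite Hb. simpl in *. rewrite IH by lia. reflexivity.
Qed.

(* If [c] occurs at [0] and at [d], then the first [d] letters spell [firstn d c] and the
   remaining ones start with [c]: these two events are independent, overlap or not. *)
Lemma expect_is_prefix_twice_le n d c : (d <= n)%nat ->
  expect s n (fun f => indicator (is_prefix c f) * indicator (is_prefix c (skipn d f))) <=
  weight s (firstn d c) * weight s c.
Proof.
  intros Hd. replace n with (d + (n - d))%nat by lia. rewrite expect_app.
  set (tail := expect s (n - d) (fun v => indicator (is_prefix c v))).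
  apply Rle_trans with (expect s d (fun u => tail * indicator (is_prefix (firstn d c) u))).
  - apply expect_le. intros u Hu _. unfold tail. rewrite Rmult_comm, <- expect_scal.
    apply expect_le. intros v _ _. rewrite <- Hu, skipn_app_length.
    apply Rmult_le_compat_r; [apply indicator_bounds|].
    destruct (is_prefix c (u ++ v)) eqn:Hpre; [|apply indicator_bounds].
    rewrite (is_prefix_firstn _ _ _ Hpre). lra.
  - rewrite expect_scal, Rmult_comm.
    apply Rmult_le_compat; [| |apply expect_is_prefix_le|apply expect_is_prefix_le];
      apply expect_nonneg; intros; apply indicator_bounds.
Qed.

Lemma letter_weight_le_decay a : (a < ifsN F)%nat -> letter_weight s a <= decay.
Proof. intros Ha. apply Rle_Rpower_opp_l; [lra|]. pose proof (INR_q_ge_2 a Ha). lra. Qed.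

Lemma weight_le_decay_pow c : valid_list F c -> weight s c <= decay ^ length c.
Proof.
  induction 1 as [|a c Ha Hc IH]; simpl; [lra|].
  apply Rmult_le_compat; [left; apply letter_weight_pos|left; apply weight_pos
    |now apply letter_weight_le_decay|exact IH].
Qed.

Lemma weight_firstn_le d c : valid_list F c -> weight s (firstn d c) <= weight s c + decay ^ d.
Proof.
  intros Hc. pose proof decay_bounds. assert (0 < decay ^ d) by (apply pow_lt; lra).
  destruct (Nat.le_gt_cases (length c) d) as [Hcd|Hdc].
  - rewrite firstn_all2 by exact Hcd. lra.
  - pose proof (weight_le_decay_pow _ (valid_firstn F d c Hc)) as Hle.
    rewrite length_firstn, Nat.min_l in Hle by lia. pose proof (weight_pos s c). lra.
Qed.

Lemma expect_occurs_twice_le n i j c : (i <= n)%nat -> (j <= n)%nat -> valid_list F c ->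
  expect s n (fun f => indicator (is_prefix c (skipn i f)) * indicator (is_prefix c (skipn j f)))
  <= weight s c * (weight s c + decay ^ ((i - j) + (j - i))).
Proof.
  intros Hi Hj Hc. revert i j Hi Hj.
  assert (Hordered : forall i j, (i <= j)%nat -> (j <= n)%nat -> expect s n (fun f =>
    indicator (is_prefix c (skipn i f)) * indicator (is_prefix c (skipn j f)))
    <= weight s c * (weight s c + decay ^ (j - i))).
  { intros i j Hij Hj. replace n with (i + (n - i))%nat by lia.
    rewrite (expect_ext _ _ _ (fun f => (fun g => indicator (is_prefix c g) *
      indicator (is_prefix c (skipn (j - i) g))) (skipn i f))).
    - rewrite (expect_skipn i (n - i) (fun g => indicator (is_prefix c g) *
        indicator (is_prefix c (skipn (j - i) g)))).
      eapply Rle_trans; [apply expect_is_prefix_twice_le; lia|]. rewrite Rmult_comm.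
      apply Rmult_le_compat_l; [left; apply weight_pos|now apply weight_firstn_le].
    - intros f _ _. cbv beta. rewrite skipn_skipn. do 4 f_equal. lia. }
  intros i j Hi Hj. destruct (Nat.le_ge_cases i j) as [Hij|Hji].
  - replace (i - j + (j - i))%nat with (j - i)%nat by lia. now apply Hordered.
  - replace (i - j + (j - i))%nat with (i - j)%nat by lia.
    rewrite (expect_ext _ _ _ (fun f => indicator (is_prefix c (skipn j f)) *
      indicator (is_prefix c (skipn i f)))) by (intros; ring).
    now apply Hordered.
Qed.

Lemma weight_cut_le t z : valid_list F z -> 0 < t <= 2 ^ length z ->
  weight s (cut t z) <= Rpower t (- s).
Proof.
  intros Hz Ht. rewrite weight_denom by now apply valid_cut.
  apply Rle_Rpower_opp_l; [lra|]. split; [lra|now apply denom_cut_ge].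
Qed.

Lemma weight_cut_ge t z : valid_list F z -> 1 <= t ->
  Rpower M (- s) * Rpower t (- s) <= weight s (cut t z).
Proof.
  intros Hz Ht. pose proof (valid_cut t z Hz) as Hc. pose proof (denom_ge_1 _ Hc).
  rewrite weight_denom, Rpower_mult_distr by (exact Hc || lra).
  apply Rle_Rpower_opp_l; [lra|]. split; [lra|now apply denom_cut_le].
Qed.

(* All words whose cut is a prefix of [y] have the same cut, namely that of [y]. *)
Lemma expect_cut_is_prefix_le l t y : 0 < t <= 2 ^ l ->
  expect s l (fun z => indicator (is_prefix (cut t z) y)) <= Rpower t (- s).
Proof.
  intros Ht. destruct (classic (exists z, length z = l /\ valid_list F z /\
    is_prefix (cut t z) y = true)) as [[z [<- [Hz Hzy]]]|Hnone].
  - eapply Rle_trans; [|apply (weight_cut_le t z Hz Ht)].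
    eapply Rle_trans; [|apply (expect_is_prefix_le (length z))].
    apply expect_le. intros z' Hl Hz'. destruct (is_prefix (cut t z') y) eqn:Hz'y;
      [|apply indicator_bounds].
    rewrite <- (cut_eq_of_is_prefix t z y Hz (proj2 Ht) Hzy).
    rewrite (cut_eq_of_is_prefix t z' y Hz') by (assumption || (rewrite Hl; apply Ht)).
    rewrite is_prefix_cut. simpl. lra.
  - apply expect_le_const. intros z Hl Hz. pose proof (Rpower_pos t (- s)).
    destruct (is_prefix (cut t z) y) eqn:Hzy; simpl; [|lra]. destruct Hnone. now exists z.
Qed.

Lemma expect_count_occurrences_le t L l f : 0 < t <= 2 ^ l ->
  expect s l (count_occurrences t L f) <= INR L * Rpower t (- s).
Proof.
  intros Ht. unfold count_occurrences. rewrite expect_sum_list, <- sum_lt_const.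
  apply sum_list_le. intros i _. now apply expect_cut_is_prefix_le.
Qed.

Lemma expect_count_occurrences_ge t L l z : valid_list F z -> length z = l -> 1 <= t ->
  INR L * (Rpower M (- s) * Rpower t (- s)) <=
  expect s (L + l) (fun f => count_occurrences t L f z).
Proof.
  intros Hz Hl Ht. unfold count_occurrences. rewrite expect_sum_list, <- sum_lt_const.
  apply sum_lt_le. intros i Hi. replace (L + l)%nat with (i + (L + l - i))%nat by lia.
  rewrite (expect_skipn i _ (fun g => indicator (is_prefix (cut t z) g))).
  rewrite expect_is_prefix; [now apply weight_cut_ge|now apply valid_cut|].
  pose proof (length_cut_le t z). lia.
Qed.

Lemma expect_count_occurrences_sq_le t L l z :
  valid_list F z -> length z = l -> 0 < t <= 2 ^ l ->
  expect s (L + l) (fun f => count_occurrences t L f z * count_occurrences t L f z) <=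
  INR L * Rpower t (- s) * (INR L * Rpower t (- s) + 2 / (1 - decay)).
Proof.
  intros Hz <- Ht. pose proof (valid_cut t z Hz) as Hc. pose proof decay_bounds.
  pose proof (weight_cut_le t z Hz Ht) as Hct. pose proof (weight_pos s (cut t z)).
  set (c := cut t z) in *.
  apply Rle_trans with (\sum_(i < L) (\sum_(j < L)
    weight s c * (weight s c + decay ^ ((i - j) + (j - i))))).
  - rewrite (expect_ext _ _ _ (fun f => \sum_(i < L) (\sum_(j < L)
      indicator (is_prefix c (skipn i f)) * indicator (is_prefix c (skipn j f))))).
    + rewrite expect_sum_list. apply sum_lt_le. intros i Hi. rewrite expect_sum_list.
      apply sum_lt_le. intros j Hj. apply expect_occurs_twice_le; [lia|lia|exact Hc].
    + intros f _ _. unfold count_occurrences. fold c. rewrite <- sum_list_scal.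
      apply sum_list_ext. intros i _. rewrite sum_list_scal. apply Rmult_comm.
  - rewrite Rmult_assoc, <- sum_lt_const. apply sum_lt_le. intros i Hi.
    rewrite sum_list_scal, sum_list_plus, sum_lt_const.
    pose proof (sum_lt_pow_dist_le decay L i ltac:(lra) ltac:(lia)). pose proof (pos_INR L).
    assert (0 <= \sum_(j < L) decay ^ ((i - j) + (j - i)))
      by (apply sum_list_nonneg; intros; apply pow_le; lra).
    apply Rmult_le_compat; [lra|nra|exact Hct|nra].
Qed.

Lemma expect_block_sum g l B : expect s (B * l) (block_sum g l B) = INR B * expect s l g.
Proof.
  induction B as [|B IH]; [rewrite Nat.mul_0_l, expect_0; simpl; ring|].
  rewrite Nat.mul_succ_l, Nat.add_comm, expect_app, S_INR.
  rewrite (expect_ext _ l _ (fun u => g u + INR B * expect s l g)).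
  - rewrite expect_plus, expect_const. ring.
  - intros u Hu _. rewrite (expect_ext _ _ _ (fun v => g u + block_sum g l B v)).
    + now rewrite expect_plus, expect_const, IH.
    + intros v _ _. simpl. now rewrite <- Hu, firstn_app_length, skipn_app_length.
Qed.

Lemma expect_block_sum_sq_le g l B :
  expect s (B * l) (fun v => block_sum g l B v * block_sum g l B v) <=
  INR B * expect s l (fun z => g z * g z) + INR B * INR B * (expect s l g * expect s l g).
Proof.
  set (G := expect s l g). set (G2 := expect s l (fun z => g z * g z)).
  induction B as [|B IH]; [rewrite Nat.mul_0_l, expect_0; simpl; lra|].
  rewrite Nat.mul_succ_l, Nat.add_comm, expect_app, S_INR.
  rewrite (expect_ext _ l _ (fun u => g u * g u + ((2 * INR B * G) * g u +
    expect s (B * l) (fun v => block_sum g l B v * block_sum g l B v)))).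
  - rewrite !expect_plus, expect_scal, expect_const. fold G G2. nra.
  - intros u Hu _. rewrite (expect_ext _ _ _ (fun v => g u * g u +
      ((2 * g u) * block_sum g l B v + block_sum g l B v * block_sum g l B v))).
    + rewrite expect_plus, expect_const, expect_plus, expect_scal.
      change (fun v => block_sum g l B v) with (block_sum g l B).
      rewrite expect_block_sum. fold G. ring.
    + intros v _ _. simpl. rewrite <- Hu, firstn_app_length, skipn_app_length. ring.
Qed.

(* Second moment method: the indicator of [X = 0] is at most [(1 - lam X) ^ 2]. *)
Lemma expect_eq_0_le n (X : list nat -> R) lam :
  expect s n (fun v => if Req_EM_T (X v) 0 then 1 else 0) <=
  1 - 2 * lam * expect s n X + lam * lam * expect s n (fun v => X v * X v).
Proof.
  apply Rle_trans with (expect s n (fun v => 1 + (- (2 * lam) * X v + (lam * lam) * (X v * X v)))).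
  - apply expect_le. intros v _ _. destruct (Req_EM_T (X v) 0) as [->|_]; [lra|].
    pose proof (Rle_0_sqr (1 - lam * X v)) as Hsq. unfold Rsqr in Hsq. nra.
  - rewrite !expect_plus, !expect_scal, expect_const.
    change (fun v => X v) with X. lra.
Qed.

Lemma expect_stage_hits t L l B (h : R -> R) :
  expect s (L + l + B * l) (fun v => h (stage_hits t L l B v)) =
  expect s (L + l) (fun f => expect s (B * l) (fun v =>
    h (block_sum (count_occurrences t L f) l B v))).
Proof.
  rewrite expect_app. apply expect_ext. intros f Hf _. apply expect_ext. intros v _ _.
  unfold stage_hits. now rewrite <- Hf, firstn_app_length, skipn_app_length.
Qed.

Definition stage_mass (t : R) (L B : nat) : R := INR L * INR B * Rpower t (- s).

Lemma stage_mass_nonneg t L B : 0 <= stage_mass t L B.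
Proof.
  repeat apply Rmult_le_pos; try apply pos_INR. left. apply Rpower_pos.
Qed.

Lemma expect_stage_hits_ge t L l B : 1 <= t ->
  Rpower M (- s) * stage_mass t L B <= expect s (L + l + B * l) (stage_hits t L l B).
Proof.
  intros Ht. rewrite (expect_stage_hits t L l B (fun x => x) : expect s _ (stage_hits t L l B) = _).
  rewrite (expect_ext _ _ _ (fun f => INR B * expect s l (count_occurrences t L f)))
    by (intros; apply expect_block_sum).
  rewrite expect_scal, (expect_swap s (L + l) l (count_occurrences t L) :
    expect s (L + l) (fun f => expect s l (count_occurrences t L f)) = _).
  replace (Rpower M (- s) * stage_mass t L B)
    with (INR B * (INR L * (Rpower M (- s) * Rpower t (- s)))) by (unfold stage_mass; ring).
  apply Rmult_le_compat_l; [apply pos_INR|]. apply expect_ge_const. intros z Hl Hz.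
  now apply expect_count_occurrences_ge.
Qed.

Lemma expect_stage_hits_sq_le t L l B : 0 < t <= 2 ^ l ->
  expect s (L + l + B * l) (fun v => stage_hits t L l B v * stage_hits t L l B v) <=
  stage_mass t L B * (2 * stage_mass t L B + 2 / (1 - decay)).
Proof.
  intros Ht. rewrite (expect_stage_hits t L l B (fun x => x * x)).
  set (x := INR L * Rpower t (- s)). set (K := 2 / (1 - decay)).
  assert (Hx : 0 <= x) by (apply Rmult_le_pos; [apply pos_INR|left; apply Rpower_pos]).
  pose proof (pos_INR B) as HB.
  apply Rle_trans with (expect s (L + l) (fun f => INR B * expect s l (fun z =>
    count_occurrences t L f z * count_occurrences t L f z) + INR B * INR B * (x * x))).
  - apply expect_le. intros f _ _. eapply Rle_trans; [apply expect_block_sum_sq_le|].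
    apply Rplus_le_compat_l, Rmult_le_compat_l; [nra|].
    pose proof (expect_nonneg s l _ (count_occurrences_nonneg t L f)).
    pose proof (expect_count_occurrences_le t L l f Ht).
    apply Rmult_le_compat; assumption.
  - rewrite expect_plus, expect_scal, expect_const, expect_swap.
    assert (Hsq : expect s l (fun z => expect s (L + l) (fun f =>
      count_occurrences t L f z * count_occurrences t L f z)) <= x * (x + K)).
    { apply expect_le_const. intros z Hl Hz. now apply expect_count_occurrences_sq_le. }
    apply (Rmult_le_compat_l (INR B)) in Hsq; [|exact HB].
    assert (HBB : INR B <= INR B * INR B).
    { destruct B as [|B]; [simpl; lra|]. rewrite S_INR in *. pose proof (pos_INR B). nra. }
    replace (stage_mass t L B) with (INR B * x) by (unfold stage_mass, x; ring).
    nra.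
Qed.

Definition hit_probability_bound (m : R) : R :=
  Rpower M (- s) * Rpower M (- s) * (m / (2 * m + 2 / (1 - decay))).

Lemma hit_probability_bound_nonneg m : 0 <= m -> 0 <= hit_probability_bound m.
Proof.
  intros Hm. pose proof decay_bounds.
  assert (0 < 2 / (1 - decay)) by (apply Rdiv_lt_0_compat; lra).
  apply Rmult_le_pos; [nra|apply Rdiv_le_0_compat; lra].
Qed.

Lemma expect_no_hit_le t L l B : 1 <= t <= 2 ^ l ->
  expect s (L + l + B * l) (no_hit t L l B) <= 1 - hit_probability_bound (stage_mass t L B).
Proof.
  intros Ht. pose proof decay_bounds. pose proof (stage_mass_nonneg t L B) as Hm.
  pose proof (expect_stage_hits_ge t L l B (proj1 Ht)) as Hmean.
  pose proof (expect_stage_hits_sq_le t L l B ltac:(lra)) as Hsq.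
  set (m := stage_mass t L B) in *. set (c := Rpower M (- s)) in *.
  assert (Hc : 0 < c) by apply Rpower_pos.
  set (K := 2 / (1 - decay)) in *. assert (HK : 0 < K) by (apply Rdiv_lt_0_compat; lra).
  set (lam := c / (2 * m + K)). assert (Hlam : 0 < lam) by (apply Rdiv_lt_0_compat; lra).
  eapply Rle_trans; [apply (expect_eq_0_le _ (stage_hits t L l B) lam)|].
  replace (hit_probability_bound m) with (2 * lam * (c * m) - lam * lam * (m * (2 * m + K)))
    by (unfold hit_probability_bound, lam; fold c K; field; lra).
  apply (Rmult_le_compat_l (lam * lam)) in Hsq; [|nra].
  apply (Rmult_le_compat_l (2 * lam)) in Hmean; [|lra]. lra.
Qed.

End Moments.

Lemma repetition_approx w n m r t : valid_word F w -> (1 <= m)%nat -> 0 < t ->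
  (forall i, (i < r)%nat -> w (n + m + i)%nat = w (n + i)%nat) ->
  t <= denom (prefix (shift (n + m) w) r) ->
  Rabs (coding_map w - periodic_point (prefix w (n + m)) n) <=
  (hi - lo) / (denom (prefix w (n + m)) * t).
Proof.
  intros Hw Hm Ht Hrep Hr. pose proof (denom_prefix_pos w (n + m) Hw).
  eapply Rle_trans; [apply (coding_map_close w _ (n + m + r) Hw)|].
  - apply valid_loop_word; [now apply valid_prefix|rewrite length_prefix; lia].
  - now apply loop_word_prefix_agree.
  - rewrite prefix_add, denom_app. apply Rmult_le_compat_l; [lra|].
    apply Rinv_le_contravar; [now apply Rmult_lt_0_compat|].
    apply Rmult_le_compat_l; lra.
Qed.

Lemma block_sum_neq_0 g l B v : block_sum g l B v <> 0 ->
  exists b, (b < B)%nat /\ g (firstn l (skipn (b * l) v)) <> 0.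
Proof.
  revert v. induction B as [|B IH]; intros v Hsum; simpl in Hsum; [lra|].
  destruct (Req_EM_T (g (firstn l v)) 0) as [Heq0|Hne].
  - destruct (IH (skipn l v)) as [b [Hb Hgb]]; [lra|]. exists (S b). split; [lia|].
    rewrite skipn_skipn in Hgb. simpl. now rewrite Nat.add_comm.
  - exists 0%nat. split; [lia|exact Hne].
Qed.

Lemma stage_hits_neq_0 w t L l B : stage_hits t L l B (prefix w (L + l + B * l)) <> 0 ->
  exists i b, (i < L)%nat /\ (b < B)%nat /\
    let c := cut t (prefix (shift (L + l + b * l) w) l) in
    c = prefix (shift (L + l + b * l) w) (length c) /\ c = prefix (shift i w) (length c).
Proof.
  intros Hhits. apply block_sum_neq_0 in Hhits. destruct Hhits as [b [Hb Hcount]].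
  apply sum_list_neq_0 in Hcount. destruct Hcount as [i [Hi Hpre]]. apply in_seq in Hi.
  exists i, b. split; [lia|split; [exact Hb|]].
  rewrite firstn_prefix, !skipn_prefix in Hpre by lia.
  assert (Hbl : (b * l + l <= B * l)%nat) by nia.
  rewrite firstn_prefix in Hpre by lia. cbv zeta.
  rewrite shift_shift in Hpre.
  split; [exact (is_prefix_prefix _ _ l (is_prefix_cut _ _))|].
  destruct (is_prefix _ _) eqn:Htext in Hpre; [|now contradiction Hpre].
  exact (is_prefix_prefix _ _ _ Htext).
Qed.

Lemma stage_hit_approx w T t L l B : valid_word F w -> 0 < t <= 2 ^ l ->
  stage_hits t L l B (prefix (shift T w) (L + l + B * l)) <> 0 ->
  exists n m, (1 <= m)%nat /\ (L <= n + m <= T + (L + l + B * l))%nat /\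
    Rabs (coding_map w - periodic_point (prefix w (n + m)) n) <=
    (hi - lo) / (denom (prefix w (n + m)) * t).
Proof.
  intros Hw Ht Hhits. apply stage_hits_neq_0 in Hhits.
  destruct Hhits as [i [b [Hi [Hb [Hblock Htext]]]]].
  assert (Hbl : (b * l + l <= B * l)%nat) by nia.
  rewrite !shift_shift in Hblock. rewrite !shift_shift in Htext.
  set (N := (T + (L + l + b * l))%nat) in *.
  assert (Hvalid : valid_list F (prefix (shift N w) l)) by now apply valid_prefix, valid_shift.
  pose proof (denom_cut_ge t _ Hvalid) as Hdenom. rewrite length_prefix in Hdenom.
  set (c := cut t (prefix (shift N w) l)) in *.
  exists (T + i)%nat, (L + l + b * l - i)%nat.
  assert (HN : (T + i + (L + l + b * l - i))%nat = N) by (unfold N; lia).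
  split; [lia|split; [lia|]]. apply (repetition_approx w _ _ (length c)); [exact Hw|lia|lra| |].
  - intros k Hk. rewrite HN.
    apply (proj1 (prefix_eq_iff (shift N w) (shift (T + i) w) (length c)));
      [now rewrite <- Hblock, <- Htext|exact Hk].
  - rewrite HN, <- Hblock. now apply Hdenom.
Qed.

(** * Independent stages *)

Section IndependentStages.

Variables (s : R) (len : nat -> nat).

Hypothesis s_pos : 0 < s.
Hypothesis moran_eq_1 : moran_sum s = 1.

Fixpoint stage_start (j : nat) : nat :=
  match j with O => O | S i => (stage_start i + len i)%nat end.

Definition stage_list (j : nat) (v : list nat) : list nat :=
  firstn (len j) (skipn (stage_start j) v).

Lemma stage_start_mono i j : (i <= j)%nat -> (stage_start i <= stage_start j)%nat.
Proof. induction 1; simpl; lia. Qed.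

Lemma stage_list_app i j u v : (i < j)%nat -> length u = stage_start j ->
  stage_list i (u ++ v) = stage_list i u.
Proof.
  intros Hij Hu. apply firstn_skipn_app. rewrite Hu. apply (stage_start_mono (S i) j Hij).
Qed.

Lemma stage_list_prefix i j w : (i < j)%nat ->
  stage_list i (prefix w (stage_start j)) = prefix (shift (stage_start i) w) (len i).
Proof.
  intros Hij. unfold stage_list. rewrite skipn_prefix. apply firstn_prefix.
  pose proof (stage_start_mono (S i) j Hij) as Hle. simpl in Hle. lia.
Qed.

Lemma expect_prod_stages (g : nat -> list nat -> R) J k :
  expect s (stage_start (J + k)) (fun v =>
    prod_lt k (fun i => g (J + i)%nat (stage_list (J + i) v))) =
  prod_lt k (fun i => expect s (len (J + i)) (g (J + i)%nat)).
Proof.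
  induction k as [|k IH]; simpl prod_lt; [now apply expect_const|].
  rewrite <- IH, Rmult_comm, <- expect_scal, Nat.add_succ_r. simpl stage_start.
  rewrite expect_app. apply expect_ext. intros u Hu _.
  rewrite Rmult_comm, <- expect_scal. apply expect_ext. intros v Hv _.
  f_equal.
  - apply prod_lt_ext. intros i Hi. now rewrite (stage_list_app _ (J + k)) by (exact Hu || lia).
  - f_equal. unfold stage_list. rewrite <- Hu, skipn_app_length. apply firstn_all2. lia.
Qed.

(* The second Borel-Cantelli lemma. *)
Lemma H_null_of_independent_stages (g : nat -> list nat -> R) (p : nat -> R) J :
  (forall j v, 0 <= g j v) -> (forall j, expect s (len j) (g j) <= 1 - p j) ->
  diverges (fun i => p (J + i)%nat) ->
  H_null s (fun x => exists w, valid_word F w /\ x = coding_map w /\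
    forall j, (J <= j)%nat -> g j (prefix (shift (stage_start j) w) (len j)) = 1).
Proof.
  intros Hg Hexp Hdiv. apply H_null_of_expect_small; [exact s_pos|]. intros eps Heps.
  destruct (Hdiv (- ln eps)) as [k Hk].
  exists (stage_start (J + k)),
    (fun v => prod_lt k (fun i => g (J + i)%nat (stage_list (J + i) v))).
  split; [|split].
  - intros v. apply prod_lt_nonneg. intros i. apply Hg.
  - intros x [w [Hw [Hx Hone]]]. exists w. split; [exact Hw|split; [exact Hx|]].
    right. symmetry. apply prod_lt_1. intros i Hi.
    rewrite stage_list_prefix by lia. apply Hone. lia.
  - rewrite expect_prod_stages. eapply Rle_trans.
    + apply (prod_lt_le_exp k _ (fun i => p (J + i)%nat)). intros i.
      split; [apply expect_nonneg; apply Hg|apply Hexp].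
    + rewrite <- (exp_ln eps Heps). apply exp_le. lra.
Qed.

End IndependentStages.

(* A block cut at denominator [t] has about [ln t] letters and is found at a given place with
   probability about [t ^ (- s)]. *)
Definition hit_density (s t : R) : R := Rpower t (- s) / (1 + ln t).

Section Stages.

Variables (s : R) (t : nat -> R).

Hypothesis s_pos : 0 < s.
Hypothesis moran_eq_1 : moran_sum s = 1.
Hypothesis t_ge_1 : forall j, 1 <= t j.

Definition block_length (j : nat) : nat := Nat.min (ceil_log2 (t j)) (2 ^ j).

Definition block_count (j : nat) : nat := (2 ^ j / ceil_log2 (t j))%nat.

Definition stage_length (j : nat) : nat :=
  (2 ^ j + block_length j + block_count j * block_length j)%nat.

Definition stage_miss (j : nat) : list nat -> R :=
  no_hit (t j) (2 ^ j) (block_length j) (block_count j).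

Definition misses_from (J : nat) (w : nat -> nat) : Prop := forall j, (J <= j)%nat ->
  stage_miss j (prefix (shift (stage_start stage_length j) w) (stage_length j)) = 1.

Lemma stage_length_le j : (stage_length j <= 3 * 2 ^ j)%nat.
Proof.
  unfold stage_length, block_length, block_count.
  pose proof (Nat.Div0.mul_div_le (2 ^ j) (ceil_log2 (t j))).
  nia.
Qed.

Lemma stage_start_le j : (stage_start stage_length j <= 3 * 2 ^ j)%nat.
Proof.
  induction j as [|j IH]; simpl; [lia|]. pose proof (stage_length_le j). lia.
Qed.

Lemma t_le_2_pow_block_length j : block_count j <> 0%nat -> t j <= 2 ^ block_length j.
Proof.
  intros Hcount. destruct (ceil_log2_spec (t j) (t_ge_1 j)) as [_ [Ht _]].
  unfold block_length. rewrite Nat.min_l; [exact Ht|]. apply Nat.nlt_ge. intros Hlt.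
  apply Hcount. now apply Nat.div_small.
Qed.

Lemma expect_stage_miss_le M j : (forall a, (a < ifsN F)%nat -> INR (ifsq F a) <= M) -> 1 <= M ->
  expect s (stage_length j) (stage_miss j) <=
  1 - hit_probability_bound s M (stage_mass s (t j) (2 ^ j) (block_count j)).
Proof.
  intros HqM HM. destruct (Nat.eq_dec (block_count j) 0) as [Heq0|Hne].
  - unfold stage_mass, hit_probability_bound. rewrite Heq0. simpl INR.
    rewrite Rmult_0_r, Rmult_0_l, Rdiv_0_l, Rmult_0_r, Rminus_0_r.
    apply expect_le_const; [exact moran_eq_1|]. intros v _ _.
    destruct (no_hit_cases (t j) (2 ^ j) (block_length j) (block_count j) v) as [Hv|Hv];
      unfold stage_miss; rewrite Hv; lra.
  - apply expect_no_hit_le; try assumption. split; [apply t_ge_1|].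
    now apply t_le_2_pow_block_length.
Qed.

Lemma stage_mass_ge_of_short_blocks j : (ceil_log2 (t j) <= 2 ^ j)%nat ->
  4 ^ j * hit_density s (t j) <=
  4 * stage_mass s (t j) (2 ^ j) (block_count j).
Proof.
  intros Hl. destruct (ceil_log2_spec (t j) (t_ge_1 j)) as [Hl1 [_ Hlog]].
  pose proof (INR_div_ge_half (2 ^ j) (ceil_log2 (t j)) (conj Hl1 Hl)) as Hcount.
  fold (block_count j) in Hcount. unfold stage_mass. rewrite INR_2_pow in *.
  pose proof (ln_nonneg (t j) (t_ge_1 j)). pose proof (Rpower_pos (t j) (- s)).
  pose proof (pos_INR (block_count j)). assert (0 < 2 ^ j) by (apply pow_lt; lra).
  assert (Hj : 2 ^ j / (1 + ln (t j)) <= 4 * INR (block_count j)) by (apply Rle_div_l; nra).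
  rewrite pow_4_eq_pow_2_sqr.
  replace (2 ^ j * 2 ^ j * hit_density s (t j)) with
    (2 ^ j * Rpower (t j) (- s) * (2 ^ j / (1 + ln (t j)))) by (unfold hit_density; field; lra).
  replace (4 * (2 ^ j * INR (block_count j) * Rpower (t j) (- s))) with
    (2 ^ j * Rpower (t j) (- s) * (4 * INR (block_count j))) by ring.
  apply Rmult_le_compat_l; [nra|exact Hj].
Qed.

Lemma negligible_of_long_blocks j : (2 ^ j < ceil_log2 (t j))%nat ->
  4 ^ j * hit_density s (t j) <= exp s * 216 / s ^ 3 * (/ 2) ^ j.
Proof.
  intros Hl. destruct (ceil_log2_spec (t j) (t_ge_1 j)) as [_ [_ Hlog]].
  apply lt_INR in Hl. rewrite INR_2_pow in Hl.
  pose proof (ln_nonneg (t j) (t_ge_1 j)). assert (0 < 2 ^ j) by (apply pow_lt; lra).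
  assert (Hpow : Rpower (t j) (- s) <= exp s * (27 / (s * 2 ^ j / 2) ^ 3)).
  { apply Rle_trans with (exp s * exp (- (s * 2 ^ j / 2))).
    - rewrite <- exp_plus. apply exp_le. nra.
    - apply Rmult_le_compat_l; [left; apply exp_pos|]. apply exp_opp_le_cube. nra. }
  apply Rle_trans with (4 ^ j * Rpower (t j) (- s)).
  - apply Rmult_le_compat_l; [apply pow_le; lra|]. apply Rle_div_l; [lra|].
    pose proof (Rpower_pos (t j) (- s)). nra.
  - apply Rle_trans with (4 ^ j * (exp s * (27 / (s * 2 ^ j / 2) ^ 3)));
      [apply Rmult_le_compat_l; [apply pow_le; lra|exact Hpow]|].
    right. rewrite pow_4_eq_pow_2_sqr, pow_inv. field. lra.
Qed.

Lemma stage_mass_diverges :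
  diverges (fun j => 4 ^ j * hit_density s (t j)) ->
  diverges (fun j => stage_mass s (t j) (2 ^ j) (block_count j)).
Proof.
  set (C := exp s * 216 / s ^ 3).
  assert (HC : 0 < C).
  { apply Rdiv_lt_0_compat; [|now apply pow_lt]. pose proof (exp_pos s). lra. }
  apply (diverges_le _ _ (fun j => C * (/ 2) ^ j) 4 (C * 2)); [lra| |].
  - intros j. pose proof (stage_mass_nonneg s (t j) (2 ^ j) (block_count j)).
    assert (0 < C * (/ 2) ^ j) by (apply Rmult_lt_0_compat; [exact HC|apply pow_lt; lra]).
    destruct (Nat.le_gt_cases (ceil_log2 (t j)) (2 ^ j)) as [Hshort|Hlong].
    + pose proof (stage_mass_ge_of_short_blocks j Hshort). lra.
    + pose proof (negligible_of_long_blocks j Hlong) as Hneg. fold C in Hneg. lra.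
  - intros n. rewrite sum_list_scal. apply Rmult_le_compat_l; [lra|].
    eapply Rle_trans; [apply sum_lt_geometric_le; lra|]. right. field.
Qed.

Lemma stage_misses_null J :
  diverges (fun j => 4 ^ j * hit_density s (t j)) ->
  H_null s (fun x => exists w, valid_word F w /\ x = coding_map w /\ misses_from J w).
Proof.
  intros Hdiv. destruct q_bounded as [M [HM HqM]].
  set (m := fun j => stage_mass s (t j) (2 ^ j) (block_count j)).
  assert (Hm : forall j, 0 <= m j) by (intros; apply stage_mass_nonneg).
  apply (H_null_of_independent_stages s stage_length s_pos moran_eq_1 stage_miss
    (fun j => hit_probability_bound s M (m j))).
  - intros j v. unfold stage_miss.
    destruct (no_hit_cases (t j) (2 ^ j) (block_length j) (block_count j) v) as [-> | ->]; lra.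
  - intros j. apply expect_stage_miss_le; [exact HqM|lra].
  - pose proof (Rpower_pos M (- s)) as Hc. set (c := Rpower M (- s)) in *.
    apply (diverges_add (fun j => hit_probability_bound s M (m j)));
      [intros j; now apply hit_probability_bound_nonneg|].
    pose proof (decay_bounds s s_pos).
    apply (diverges_scal_le (fun j => m j / (2 * m j + 2 / (1 - decay s))) _ (/ (c * c))).
    + apply Rinv_0_lt_compat. nra.
    + intros j. unfold hit_probability_bound. fold c. right. rewrite <- Rmult_assoc, Rinv_l; nra.
    + apply diverges_saturate; [apply Rdiv_lt_0_compat; lra|exact Hm|].
      now apply stage_mass_diverges.
Qed.

End Stages.

(** * The divergence part *)

Lemma two_denom_le_doubly_exponential : exists c0, forall c j v, (c0 <= c)%nat ->
  valid_list F v -> (length v <= 8 * 2 ^ j)%nat -> 2 * denom v <= 2 ^ 2 ^ (c + j).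
Proof.
  destruct q_bounded as [M [HM HqM]]. destruct (le_2_pow_eventually M) as [k Hk].
  specialize (Hk k (le_n _)). exists (k + 3)%nat. intros c j v Hc Hv Hl.
  pose proof (denom_le_pow M v HqM Hv) as Hd.
  apply Rle_trans with (2 ^ S (k * length v)).
  - simpl. rewrite pow_mult. apply Rmult_le_compat_l; [lra|]. eapply Rle_trans; [exact Hd|].
    apply pow_incr. lra.
  - apply Rle_pow; [lra|]. apply Nat.le_trans with (2 ^ (k + 3 + j))%nat;
      [|apply Nat.pow_le_mono_r; lia].
    rewrite !Nat.pow_add_r. pose proof (Nat.pow_gt_lin_r 2 k ltac:(lia)).
    pose proof (Nat.pow_nonzero 2 j ltac:(lia)). simpl (2 ^ 3)%nat. nia.
Qed.

Section Divergence.

Variables (psi : R -> R) (q0 s : R).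

Hypothesis psi_pos : forall q, q0 <= q -> 0 < psi q.
Hypothesis psi_nonincreasing : forall x y, q0 <= x -> x <= y -> psi y <= psi x.
Hypothesis s_pos : 0 < s.

Lemma badly_symb_approx_lower_bound x :
  badly_symb_approx F psi x -> ~ eventually_periodic_point x ->
  exists eps kappa, 0 < eps /\ 0 < kappa /\ forall v n Q,
    valid_list F v -> (n < length v)%nat -> 2 * denom v <= Q ->
    kappa <= Rabs (x - periodic_point v n) \/
    eps * psi Q / (2 * denom v) <= Rabs (x - periodic_point v n).
Proof.
  intros [eps [Heps Hbad]] Hx. destruct (le_2_pow_eventually (2 * q0)) as [k Hk].
  destruct (uniform_on_short_loops (fun v n e => e <= Rabs (x - periodic_point v n)) k)
    as [kappa [Hkappa Hshort]]; [intros; lra| |].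
  { intros v n Hv Hn. exists (Rabs (x - periodic_point v n)).
    split; [now apply dist_periodic_point_pos|lra]. }
  exists eps, kappa. split; [exact Heps|split; [exact Hkappa|]]. intros v n Q Hv Hn HQ.
  pose proof (valid_loop_word F v n Hv Hn) as Hw. pose proof (loop_word_periodic v n) as Hper.
  set (w := loop_word v n) in *.
  destruct (min_pre_period_exists w n (length v - n) ltac:(lia) Hper)
    as [n0 [m0 [Hmin [Hn0 Hm0]]]].
  pose proof Hmin as [Hm0_pos [Hper0 _]].
  pose proof (periodic_point_prefix w n0 m0 Hm0_pos Hper0) as Hpoint.
  change (periodic_point v n) with (coding_map w).
  destruct (Nat.lt_ge_cases (n0 + m0) k) as [Hlt|Hge]; [left|right].
  - rewrite <- Hpoint. apply Hshort; [now apply valid_prefix| |]; rewrite length_prefix; lia.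
  - specialize (Hbad (coding_map w) w n0 m0 (is_rational_periodic w n0 m0 Hw Hm0_pos Hper0)
      (limit_set_coding_map w Hw) Hw (coding_coding_map w Hw) Hmin).
    pose proof (q_int_bounds w n0 m0 Hw Hm0_pos) as Hq.
    pose proof (denom_prefix_le w (n0 + m0) (length v) Hw ltac:(lia)) as Hdenom.
    unfold w in Hdenom at 2. rewrite prefix_loop_word in Hdenom.
    pose proof (denom_prefix_ge_2_pow w (n0 + m0) Hw). specialize (Hk _ Hge).
    assert (0 < 2 ^ (n0 + m0)) by (apply pow_lt; lra).
    set (q := IZR (q_int F w n0 m0)) in *.
    assert (Hpsi : psi Q <= psi q) by (apply psi_nonincreasing; lra).
    pose proof (psi_pos Q ltac:(lra)).
    eapply Rle_trans; [|apply Rge_le, Hbad].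
    apply Rmult_le_compat; [nra|left; apply Rinv_0_lt_compat; lra|nra|].
    apply Rinv_le_contravar; lra.
Qed.

Definition scale (c j : nat) : R := 2 ^ 2 ^ (c + j).

Definition threshold (A : R) (c j : nat) : R := A / psi (scale c j).

Lemma le_scale c j : q0 <= scale c 0 -> q0 <= scale c j.
Proof.
  intros Hc. eapply Rle_trans; [exact Hc|]. apply Rle_pow; [lra|].
  apply Nat.pow_le_mono_r; lia.
Qed.

Hypothesis psi_lt_1 : forall q, q0 <= q -> psi q < 1.

Lemma threshold_ge_1 A c j : 1 <= A -> q0 <= scale c 0 -> 1 <= threshold A c j.
Proof.
  intros HA Hc. pose proof (le_scale c j Hc) as Hj.
  pose proof (psi_pos _ Hj). pose proof (psi_lt_1 _ Hj). apply Rle_div_r; lra.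
Qed.

Lemma hit_radius_lt A eps p d : 0 < A -> 0 < p -> 0 < d -> 2 * (hi - lo) < A * eps ->
  (hi - lo) / (d * (A / p)) < eps * p / (2 * d).
Proof.
  intros HA Hp Hd HAeps.
  replace ((hi - lo) / (d * (A / p))) with (2 * (hi - lo) / A * (p / (2 * d))) by (field; lra).
  replace (eps * p / (2 * d)) with (eps * (p / (2 * d))) by (field; lra).
  apply Rmult_lt_compat_r; [apply Rdiv_lt_0_compat; lra|]. apply Rlt_div_l; lra.
Qed.

Lemma misses_from_of_badly_symb_approx c w : q0 <= scale c 0 ->
  (forall j v, valid_list F v -> (length v <= 8 * 2 ^ j)%nat -> 2 * denom v <= scale c j) ->
  valid_word F w -> badly_symb_approx F psi (coding_map w) ->
  ~ eventually_periodic_point (coding_map w) ->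
  exists r J, misses_from (threshold (INR (S r)) c) J w.
Proof.
  intros Hc Hgrowth Hw Hbad Hx.
  destruct (badly_symb_approx_lower_bound _ Hbad Hx) as [eps [kappa [Heps [Hkappa Hlower]]]].
  destruct (INR_archimed eps (2 * (hi - lo)) Heps) as [r Hr].
  destruct (div_2_pow_lt_eventually (hi - lo) kappa Hkappa) as [J HJ].
  exists r, J. intros j Hj. set (A := INR (S r)). set (t := threshold A c).
  assert (HA : 1 <= A) by (unfold A; rewrite S_INR; pose proof (pos_INR r); lra).
  assert (HAeps : 2 * (hi - lo) < A * eps) by (unfold A; rewrite S_INR; nra).
  assert (Ht : forall i, 1 <= t i) by (intros i; now apply threshold_ge_1).
  unfold stage_miss, no_hit. destruct (Req_EM_T _ 0) as [_|Hhit]; [reflexivity|exfalso].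
  assert (Hcount : block_count t j <> 0%nat)
    by (intros Heq0; apply Hhit; now rewrite Heq0).
  apply (stage_hit_approx w _ (t j)) in Hhit;
    [|exact Hw|split; [specialize (Ht j); lra|now apply t_le_2_pow_block_length]].
  destruct Hhit as [n [m [Hm [Hnm Hclose]]]].
  pose proof (stage_length_le t j) as Hlen. pose proof (stage_start_le t j).
  pose proof (Nat.pow_gt_lin_r 2 j ltac:(lia)). pose proof (length_prefix w (n + m)).
  pose proof (denom_prefix_ge_2_pow w (n + m) Hw).
  pose proof (valid_prefix F w (n + m) Hw) as Hv. set (v := prefix w (n + m)) in *.
  assert (Hpow : 0 < 2 ^ (n + m)) by (apply pow_lt; lra). specialize (Ht j).
  destruct (Hlower v n (scale c j) Hv ltac:(lia)) as [Hfar|Hfar].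
  - apply Hgrowth; [exact Hv|]. unfold stage_length in Hlen. lia.
  - specialize (HJ (n + m)%nat ltac:(lia)).
    assert ((hi - lo) / (denom v * t j) <= (hi - lo) / 2 ^ (n + m)).
    { apply Rmult_le_compat_l; [lra|]. apply Rinv_le_contravar; [exact Hpow|nra]. }
    lra.
  - assert (Hpsi : 0 < psi (scale c j)) by now apply psi_pos, le_scale.
    pose proof (hit_radius_lt A eps _ (denom v) ltac:(lra) Hpsi ltac:(lra) HAeps) as Hnear.
    change (A / psi (scale c j)) with (t j) in Hnear. lra.
Qed.

Lemma threshold_series_diverges A c : 1 <= A -> q0 <= scale c 0 ->
  diverges (fun j => 4 ^ (c + j) * log_gauge psi s (scale c j)) ->
  diverges (fun j => 4 ^ j * hit_density s (threshold A c j)).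
Proof.
  intros HA Hc.
  assert (Hpsi : forall j, 0 < psi (scale c j) <= psi (scale c 0)).
  { intros j. pose proof (le_scale c j Hc). split; [now apply psi_pos|].
    apply psi_nonincreasing; [exact Hc|]. apply Rle_pow; [lra|].
    apply Nat.pow_le_mono_r; lia. }
  assert (Hlam : ln (psi (scale c 0)) < 0)
    by (rewrite <- ln_1; apply ln_increasing; [apply Hpsi|now apply psi_lt_1]).
  set (lam := - ln (psi (scale c 0))) in *. pose proof (ln_nonneg A HA).
  set (B := Rpower A s * ((1 + ln A) / lam + 1)). assert (HB : 0 < B).
  { apply Rmult_lt_0_compat; [apply Rpower_pos|].
    apply Rplus_le_lt_0_compat; [apply Rdiv_le_0_compat; unfold lam|]; lra. }
  apply (diverges_scal_le _ _ (4 ^ c * B)).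
  - apply Rmult_lt_0_compat; [apply pow_lt; lra|exact HB].
  - intros j. destruct (Hpsi j) as [Hj Hj0]. pose proof (ln_le _ _ Hj Hj0).
    rewrite pow_add. replace (4 ^ c * B * (4 ^ j * hit_density s (threshold A c j))) with
      (4 ^ c * 4 ^ j * (B * hit_density s (threshold A c j))) by ring.
    apply Rmult_le_compat_l; [apply Rmult_le_pos; apply pow_le; lra|].
    apply Rpower_div_Rabs_ln_le; [exact HA|unfold lam; lra|exact Hj|unfold lam; lra].
Qed.

Hypothesis moran_eq_1 : moran_sum s = 1.

Lemma symb_well_approx_ae :
  (forall c, q0 <= scale c 0 ->
     diverges (fun j => 4 ^ (c + j) * log_gauge psi s (scale c j))) ->
  mu_ae F s (symb_well_approx F psi).
Proof.
  intros Hdiv. destruct two_denom_le_doubly_exponential as [c0 Hgrowth].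
  destruct (le_2_pow_eventually q0) as [k Hk]. set (c := max c0 k).
  assert (Hc : q0 <= scale c 0).
  { apply Hk. pose proof (Nat.pow_gt_lin_r 2 (c + 0) ltac:(lia)). unfold c in *. lia. }
  assert (HA : forall r, 1 <= INR (S r))
    by (intros r; rewrite S_INR; pose proof (pos_INR r); lra).
  apply (H_null_of_null_diff s _ eventually_periodic_point s_pos);
    [now apply eventually_periodic_points_null|].
  set (missed := fun r J x => exists w, valid_word F w /\ x = coding_map w /\
    misses_from (threshold (INR (S r)) c) J w).
  apply (H_null_Union s _ (fun r x => exists J, missed r J x) s_pos).
  - intros r. apply (H_null_Union s _ (missed r) s_pos); [|auto]. intros J.
    apply stage_misses_null; try assumption.
    + intros j. now apply threshold_ge_1.
    + apply threshold_series_diverges; auto.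
  - intros x [[HxJ Hnot] Hx]. apply NNPP in Hnot.
    destruct (limit_set_inv x HxJ) as [w [Hw ->]].
    destruct (misses_from_of_badly_symb_approx c w Hc) as [r [J HJ]]; try assumption.
    + intros j v. apply Hgrowth. unfold c. lia.
    + exists r, J, w. auto.
Qed.

End Divergence.

Lemma symb_approx_dichotomy delta psi q0 :
  hausdorff_dim (limit_set F) delta -> admissible psi q0 ->
  (series_converges (term1 delta psi) -> mu_ae F delta (badly_symb_approx F psi)) /\
  ((forall q, q0 <= q -> psi q < 1) -> ~ series_converges (term2 delta psi) ->
   mu_ae F delta (symb_well_approx F psi)).
Proof.
  intros Hdim [Hpos [Hdecr _]]. pose proof (dim_pos delta Hdim) as Hdelta.
  pose proof (moran_sum_dim delta Hdim) as Hmoran. split.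
  - intros Hconv. apply (badly_symb_approx_ae psi q0); try assumption; [lra|].
    apply term1_condensed; assumption || lra.
  - intros Hlt1 Hnot. apply (symb_well_approx_ae psi q0); try assumption. intros c Hc.
    unfold scale in Hc. rewrite Nat.add_0_r in Hc.
    apply (term2_condensed psi q0); assumption || lra.
Qed.

End RationalIFS.

(** * Logarithmic gauges *)

Lemma exp_1_lt_3 : exp 1 < 3.
Proof.
  assert (Hpow : (5 / 6) ^ 6 <= exp (- (1 / 6)) ^ 6)
    by (apply pow_incr; pose proof (exp_ineq1_le (- (1 / 6))); lra).
  assert (Hprod : exp 1 * exp (- (1 / 6)) ^ 6 = 1).
  { simpl. rewrite Rmult_1_r, <- !exp_plus, <- exp_0. f_equal. field. }
  assert (1 / 3 < (5 / 6) ^ 6) by (simpl; lra). nra.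
Qed.

Lemma ln_gt_1 q : 3 <= q -> 1 < ln q.
Proof.
  intros Hq. rewrite <- (ln_exp 1). apply ln_increasing; [apply exp_pos|].
  pose proof exp_1_lt_3. lra.
Qed.

Lemma psi_log_lt_1 t q : 0 < t -> 3 <= q -> psi_log t q < 1.
Proof.
  intros Ht Hq. pose proof (ln_gt_1 q Hq). unfold psi_log.
  rewrite <- (Rpower_O (ln q)) by lra. apply Rpower_lt; lra.
Qed.

Lemma psi_log_admissible t : 0 < t -> admissible (psi_log t) 3.
Proof.
  intros Ht. split; [|split; [|split]].
  - intros q _. apply Rpower_pos.
  - intros x y Hx Hxy. pose proof (ln_gt_1 x Hx). apply Rle_Rpower_opp_l; [lra|].
    split; [lra|apply ln_le; lra].
  - exists 1. intros q Hq. left. now apply psi_log_lt_1.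
  - intros K HK. exists (Rpower 2 (- t)), (Rpower (/ 2) (- t)), (exp (2 * Rabs (ln K) + 2)).
    split; [apply Rpower_pos|split; [apply Rpower_pos|]]. intros q Hq.
    pose proof (exp_pos (2 * Rabs (ln K) + 2)).
    assert (Hln : 2 * Rabs (ln K) + 2 <= ln q)
      by (rewrite <- (ln_exp (2 * Rabs (ln K) + 2)); apply ln_le; lra).
    pose proof (Rle_abs (ln K)).
    pose proof (Rabs_maj2 (ln K)).
    unfold psi_log. rewrite ln_mult, !Rpower_mult_distr by lra.
    split; apply Rle_Rpower_opp_l; lra.
Qed.

Lemma Rpower_opp_sub_ge e x y : 0 < e -> 0 < x <= y ->
  e * (Rpower y (- (1 + e)) * (y - x)) <= Rpower x (- e) - Rpower y (- e).
Proof.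
  intros He Hxy. pose proof (Rpower_pos y (- e)). pose proof (ln_sub_ge x y Hxy).
  replace (Rpower x (- e)) with (Rpower y (- e) * exp (e * (ln y - ln x)))
    by (unfold Rpower; rewrite <- exp_plus; f_equal; ring).
  replace (Rpower y (- (1 + e))) with (Rpower y (- e) * / y)
    by (replace (- (1 + e)) with (- e + - (1)) by ring;
        rewrite Rpower_plus, (Rpower_Ropp y 1), Rpower_1 by lra; reflexivity).
  pose proof (exp_ineq1_le (e * (ln y - ln x))).
  apply Rle_trans with (Rpower y (- e) * (e * (ln y - ln x))); [|nra].
  replace (e * (Rpower y (- e) * / y * (y - x))) with
    (Rpower y (- e) * (e * ((y - x) / y))) by (unfold Rdiv; ring).
  apply Rmult_le_compat_l; [lra|]. apply Rmult_le_compat_l; lra.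
Qed.

Lemma term1_psi_log delta eps k : 0 < delta -> (3 <= k)%nat ->
  term1 delta (psi_log (2 / delta + eps)) k =
  Rpower (ln (INR k)) (- (1 + eps * delta)) / INR k.
Proof.
  intros Hdelta Hk. apply le_INR in Hk. replace (INR 3) with 3 in Hk by (simpl; ring).
  pose proof (ln_gt_1 _ Hk). unfold term1, psi_log. rewrite Rpower_mult. f_equal.
  rewrite <- (Rpower_1 (ln (INR k))) at 1 by lra. rewrite <- Rpower_plus. f_equal. field. lra.
Qed.

Lemma term1_psi_log_converges delta eps : 0 < delta -> 0 < eps ->
  series_converges (term1 delta (psi_log (2 / delta + eps))).
Proof.
  intros Hdelta Heps. set (e := eps * delta). assert (He : 0 < e) by (unfold e; nra).
  set (L := fun i => - (/ e * Rpower (ln (INR (2 + i))) (- e))).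
  apply (series_converges_of_bounded _ 3 (- L 0%nat)).
  - intros i. rewrite term1_psi_log by (exact Hdelta || lia).
    apply Rdiv_le_0_compat; [left; apply Rpower_pos|apply lt_0_INR; lia].
  - intros n. apply Rle_trans with (\sum_(i < n) (L (S i) - L i)).
    + apply sum_list_le. intros i _. rewrite term1_psi_log by (exact Hdelta || lia). fold e.
      unfold L. replace (2 + S i)%nat with (3 + i)%nat by lia.
      replace (INR (3 + i)) with (INR (2 + i) + 1) by (rewrite !plus_INR; simpl; ring).
      set (x := INR (2 + i)).
      assert (Hx : 2 <= x) by (unfold x; rewrite plus_INR; pose proof (pos_INR i); simpl; lra).
      pose proof (ln_pos x ltac:(lra)). pose proof (ln_le x (x + 1) ltac:(lra) ltac:(lra)).
      pose proof (Rpower_opp_sub_ge e (ln x) (ln (x + 1)) He ltac:(lra)) as Hdiff.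
      pose proof (ln_sub_ge x (x + 1) ltac:(lra)) as Hln.
      replace ((x + 1 - x) / (x + 1)) with (/ (x + 1)) in Hln by (field; lra).
      pose proof (Rpower_pos (ln (x + 1)) (- (1 + e))).
      apply Rmult_le_reg_l with e; [exact He|].
      replace (e * (- (/ e * Rpower (ln (x + 1)) (- e)) - - (/ e * Rpower (ln x) (- e)))) with
        (Rpower (ln x) (- e) - Rpower (ln (x + 1)) (- e)) by (field; lra).
      eapply Rle_trans; [|exact Hdiff]. apply Rmult_le_compat_l; [lra|].
      apply Rmult_le_compat_l; lra.
    + rewrite sum_lt_telescope.
      unfold L. pose proof (Rpower_pos (ln (INR (2 + n))) (- e)).
      pose proof (Rinv_0_lt_compat e He). nra.
Qed.

Lemma ln_ln_ln_succ_sub_le x : 3 <= x ->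
  ln (ln (ln (x + 1))) - ln (ln (ln x)) <= / (x * ln x * ln (ln x)).
Proof.
  intros Hx. pose proof (ln_gt_1 x Hx) as Hl. pose proof (ln_pos _ Hl) as Hll.
  assert (ln x <= ln (x + 1)) by (apply ln_le; lra).
  assert (ln (ln x) <= ln (ln (x + 1))) by (apply ln_le; lra).
  pose proof (ln_sub_le x (x + 1) ltac:(lra)) as Hinner.
  pose proof (ln_sub_le (ln x) (ln (x + 1)) ltac:(lra)) as Hmiddle.
  pose proof (ln_sub_le (ln (ln x)) (ln (ln (x + 1))) ltac:(lra)) as Houter.
  apply Rle_div_r in Hmiddle; [|lra]. apply Rle_div_r in Houter; [|lra].
  replace ((x + 1 - x) / x) with (/ x) in Hinner by (field; lra).
  replace (/ (x * ln x * ln (ln x))) with (/ x / ln x / ln (ln x)) by (field; lra).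
  apply Rle_div_r; [lra|]. apply Rle_trans with (ln (ln (x + 1)) - ln (ln x)); [exact Houter|].
  apply Rle_div_r; lra.
Qed.

Lemma term2_psi_log delta k : 0 < delta -> (3 <= k)%nat ->
  term2 delta (psi_log (2 / delta)) k =
  delta / 2 * / (INR k * ln (INR k) * ln (ln (INR k))).
Proof.
  intros Hdelta Hk. apply le_INR in Hk. replace (INR 3) with 3 in Hk by (simpl; ring).
  pose proof (ln_gt_1 _ Hk) as Hl. pose proof (ln_pos _ Hl).
  assert (Hexponent : 0 < 2 / delta) by (apply Rdiv_lt_0_compat; lra).
  unfold term2, psi_log. rewrite Rpower_mult, ln_Rpower.
  replace (- (2 / delta) * delta) with (- (1) + - (1)) by (field; lra).
  rewrite Rpower_plus, Rpower_Ropp, Rpower_1, Rabs_left by (assumption || nra || lra).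
  field. lra.
Qed.

Lemma term2_psi_log_diverges delta : 0 < delta ->
  ~ series_converges (term2 delta (psi_log (2 / delta))).
Proof.
  intros Hdelta. apply (not_series_converges_of_diverges _ 3). intros Q HQ.
  apply (diverges_of_telescope _ (fun i => delta / 2 * ln (ln (ln (INR (Q + i)))))).
  - intros i. rewrite term2_psi_log by (exact Hdelta || lia).
    rewrite <- Rmult_minus_distr_l. apply Rmult_le_compat_l; [lra|].
    rewrite Nat.add_succ_r, S_INR. apply ln_ln_ln_succ_sub_le.
    replace 3 with (INR 3) by (simpl; ring). apply le_INR. lia.
  - intros M. set (b := 2 / delta * M).
    destruct (INR_archimed 1 (exp (exp (exp b))) Rlt_0_1) as [n Hn]. exists n.
    assert (Hb : b <= ln (ln (ln (INR (Q + n))))).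
    { rewrite <- (ln_exp b), <- (ln_exp (exp b)), <- (ln_exp (exp (exp b))).
      do 3 (apply ln_le; [try rewrite !ln_exp; apply exp_pos|]).
      rewrite plus_INR. pose proof (pos_INR Q). lra. }
    replace M with (delta / 2 * b) by (unfold b; field; lra).
    apply Rmult_le_compat_l; lra.
Qed.

Theorem theorem4p5 (F : IFS) (delta : R) :
  rational_IFS F -> hausdorff_dim (limit_set F) delta ->
  (forall (psi : R -> R) (q0 : R), admissible psi q0 ->
     (series_converges (term1 delta psi) ->
        mu_ae F delta (badly_symb_approx F psi)) /\
     ((forall q, q0 <= q -> psi q < 1) ->
        ~ series_converges (term2 delta psi) ->
        mu_ae F delta (symb_well_approx F psi))) /\
  (forall eps, 0 < eps ->
     let psi := psi_log (2 / delta + eps) in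
     admissible psi 3 /\ series_converges (term1 delta psi) /\
     mu_ae F delta (badly_symb_approx F psi)) /\
  (let psi := psi_log (2 / delta) in
     admissible psi 3 /\ (forall q, 3 <= q -> psi q < 1) /\
     ~ series_converges (term2 delta psi) /\
     mu_ae F delta (symb_well_approx F psi)).
Proof.
  intros [HN [Hp [Hq [lo [hi [Hlohi [Hinv Hdisj]]]]]]] Hdim.
  pose proof (dim_pos F lo hi HN Hp Hq Hlohi Hinv Hdisj delta Hdim) as Hdelta.
  pose proof (fun psi q0 =>
    symb_approx_dichotomy F lo hi HN Hp Hq Hlohi Hinv Hdisj delta psi q0 Hdim) as Hdichotomy.
  assert (Hexponent : 0 < 2 / delta) by (apply Rdiv_lt_0_compat; lra).
  split; [exact Hdichotomy|split].
  - intros eps Heps psi.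
    assert (Hadm : admissible psi 3) by (apply psi_log_admissible; lra).
    assert (Hconv : series_converges (term1 delta psi)) by now apply term1_psi_log_converges.
    split; [exact Hadm|split; [exact Hconv|now apply (Hdichotomy psi 3)]].
  - intros psi.
    assert (Hadm : admissible psi 3) by now apply psi_log_admissible.
    assert (Hlt1 : forall q, 3 <= q -> psi q < 1) by (intros; now apply psi_log_lt_1).
    assert (Hdiv : ~ series_converges (term2 delta psi)) by now apply term2_psi_log_diverges.
    split; [exact Hadm|split; [exact Hlt1|split; [exact Hdiv|now apply (Hdichotomy psi 3)]]].
Qed.
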